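(* Let $m,\nu,\mu,\lambda\in\mathbb{R}$, $k\in\mathbb{Z}\setminus\{0\}$, and let $h$, $h^*$, $h^0$ be the radial Dirac operators defined in the context. Set $$\delta:=(k+\lambda)^2+\mu^2-\nu^2,$$ assume $\delta\ge \tfrac14$, and set $\gamma:=\sqrt{\delta}$. The following hold: (i) If $\gamma>\tfrac12$, then $h$ is essentially self-adjoint on $C_c^\infty(0,+\infty)^2$ and $\mathcal{D}(\overline{h})=\mathcal{D}(h^0)$. (ii) If $\gamma=\tfrac12$, then $h$ is essentially self-adjoint on $C_c^\infty(0,+\infty)^2$ and $\mathcal{D}(h^0)\subset\mathcal{D}(\overline{h})$.
   Context: All operators act in the Hilbert space $L^2(0,+\infty)^2=L^2((0,+\infty);\mathbb{C}^2)$ (Lebesgue measure $dr$). $\overline{h}$ denotes the closure of $h$, and $\mathcal{D}(\cdot)$ denotes the domain. The integer $k$ is the index $k=k_j=\pm(j+1/2)$, $j\in\{1/2,3/2,\dots\}$, of a partial wave subspace; the operators below (written $h_{m_j,k_j}$ etc. in the paper) are the restrictions to that subspace of the corresponding three-dimensional Dirac operators, and depend only on $k$ and on $m,\nu,\mu,\lambda$. Minimal operator: $\mathcal{D}(h)=C_c^\infty(0,+\infty)^2$ (with values in $\mathbb{C}^2$), and $$h\begin{pmatrix} f^+\\ f^-\end{pmatrix}=\begin{pmatrix} m+\frac{\nu+\mu}{r} & -\partial_r+\frac{k+\lambda}{r}\\ \partial_r+\frac{k+\lambda}{r} & -m+\frac{\nu-\mu}{r}\end{pmatrix}\begin{pmatrix}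 f^+\\ f^-\end{pmatrix}.$$ Maximal operator: $h^*$ is given by the same matrix differential expression, understood in the sense of distributions on $(0,+\infty)$, with domain $\mathcal{D}(h^* )=\{(f^+,f^-)\in L^2(0,+\infty)^2 : h^*(f^+,f^-)\in L^2(0,+\infty)^2\}$; it is the adjoint of $h$. Free operator: $\mathcal{D}(h^0)=\{(f^+,f^-)\in L^2(0,+\infty)^2 : (\partial_r\pm\frac{k}{r})f^\pm\in L^2(0,+\infty)\}$ and $$h^0\begin{pmatrix} f^+\\ f^-\end{pmatrix}=\begin{pmatrix} m & -\partial_r+\frac{k}{r}\\ \partial_r+\frac{k}{r} & -m\end{pmatrix}\begin{pmatrix} f^+\\ f^-\end{pmatrix}.$$ *)

(* Defs.v *)
From HB Require Import structures.
From mathcomp Require Import all_boot all_order all_algebra.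
From mathcomp Require Import complex.
From mathcomp Require Import all_classical all_reals all_analysis.

Set Implicit Arguments.
Unset Strict Implicit.
Unset Printing Implicit Defensive.

Import Order.TTheory GRing.Theory Num.Theory.
Import numFieldNormedType.Exports.

Local Open Scope classical_set_scope.
Local Open Scope ring_scope.
Local Open Scope complex_scope.

(* Elements of L^2((0,+oo); C^2) are represented by functions on R of which
   only the restriction to (0,+oo) matters: every integral below is over
   (0,+oo), and functions equal almost everywhere there stand for the same
   vector. *)
Definition half_line (R : realType) : set R := `]0, +oo[.

(* The pair (f^+, f^-). *)
Definition spinor (R : realType) : Type := ((R -> R[i]) * (R -> R[i]))%type.

Section HilbertSpace.
Context {R : realType}.
Implicit Types (f g : spinor R) (u v : R -> R[i]).

Definition cintegral u : R[i] :=
  Rintegral lebesgue_measure (@half_line R) (fun r => complex.Re (u r)) +i*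
  Rintegral lebesgue_measure (@half_line R) (fun r => complex.Im (u r)).

Definition cmeasurable u : Prop :=
  measurable_fun (@half_line R) (fun r => complex.Re (u r)) /\
  measurable_fun (@half_line R) (fun r => complex.Im (u r)).

Definition sqnormc (z : R[i]) : R := complex.Re z ^+ 2 + complex.Im z ^+ 2.

Definition scalar_sqnorm u : \bar R :=
  (\int[lebesgue_measure]_(r in @half_line R) (sqnormc (u r))%:E)%E.

Definition scalar_L2 u : Prop := cmeasurable u /\ (scalar_sqnorm u < +oo)%E.

Definition L2 f : Prop := scalar_L2 f.1 /\ scalar_L2 f.2.

Definition sqnorm f : \bar R := (scalar_sqnorm f.1 + scalar_sqnorm f.2)%E.

Definition inner f g : R[i] :=
  cintegral (fun r => f.1 r * (g.1 r)^* + f.2 r * (g.2 r)^*).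

Definition L2_cvg (F : nat -> spinor R) f : Prop :=
  (fun n => sqnorm (F n - f)) @ \oo --> 0%E.

End HilbertSpace.

(* An (unbounded) operator is given by its graph, a set of pairs (f, T f). *)
Definition operator (R : realType) : Type := set (spinor R * spinor R).

Section Operators.
Context {R : realType}.
Implicit Types (T : operator R).

Definition domain T : set (spinor R) := [set f | exists g, T (f, g)].

Definition densely_defined T : Prop :=
  forall f, L2 f ->
  exists F : nat -> spinor R, (forall n, domain T (F n)) /\ L2_cvg F f.

(* The graph closure; it is again the graph of an operator when T is
   closable, in particular when T is symmetric. *)
Definition op_closure T : operator R :=
  [set fg | [/\ L2 fg.1, L2 fg.2 &
     exists F : nat -> spinor R * spinor R,
       [/\ forall n, T (F n),
           L2_cvg (fun n => (F n).1) fg.1 &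
           L2_cvg (fun n => (F n).2) fg.2]]].

Definition adjoint T : operator R :=
  [set fg | [/\ L2 fg.1, L2 fg.2 &
     forall u v, T (u, v) -> inner v fg.1 = inner u fg.2]].

Definition symmetric_op T : Prop :=
  densely_defined T /\ T `<=` adjoint T.

Definition self_adjoint T : Prop :=
  densely_defined T /\ T = adjoint T.

Definition essentially_self_adjoint T : Prop :=
  symmetric_op T /\ self_adjoint (op_closure T).

End Operators.

Section Distributions.
Context {R : realType}.
Implicit Types (u phi : R -> R[i]) (a : R -> R).

Definition smooth (w : R -> R) : Prop :=
  forall (n : nat) (x : R), derivable (derive1n n w) x 1.

(* C_c^oo(0,+oo), its elements being extended by 0 to R. *)
Definition test_fun phi : Prop :=
  [/\ smooth (fun r => complex.Re (phi r)),
      smooth (fun r => complex.Im (phi r)) &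
      exists a b : R, 0 < a /\ (forall r, phi r != 0 -> a <= r <= b)].

Definition cderive u : R -> R[i] := fun r =>
  derive1 (fun s => complex.Re (u s)) r +i* derive1 (fun s => complex.Im (u s)) r.

(* Distributions on (0,+oo), only ever evaluated at test functions. *)
Definition distribution : Type := (R -> R[i]) -> R[i].

Definition of_fun u : distribution :=
  fun phi => cintegral (fun r => u r * phi r).

Definition distr_derive (S : distribution) : distribution :=
  fun phi => - S (cderive phi).

(* Product with a real function, smooth on (0,+oo). *)
Definition distr_mul a (S : distribution) : distribution :=
  fun phi => S (fun r => (a r)%:C * phi r).

Definition distr_add (S1 S2 : distribution) : distribution :=
  fun phi => S1 phi + S2 phi.

Definition distr_opp (S : distribution) : distribution := fun phi => - S phi.

Definition distr_eq (S1 S2 : distribution) : Prop :=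
  forall phi, test_fun phi -> S1 phi = S2 phi.

Definition distr_L2 (S : distribution) : Prop :=
  exists2 g, scalar_L2 g & distr_eq S (of_fun g).

End Distributions.

Section RadialDirac.
Context {R : realType}.
Implicit Types (m nu mu lambda : R) (k : int).

(* The differential expression of h on differentiable functions. *)
Definition dirac_expr m nu mu lambda k (f : spinor R) : spinor R :=
  ((fun r => (m + (nu + mu) / r)%:C * f.1 r
             + (- cderive f.2 r + ((k%:~R + lambda) / r)%:C * f.2 r)),
   (fun r => (cderive f.1 r + ((k%:~R + lambda) / r)%:C * f.1 r)
             + (- m + (nu - mu) / r)%:C * f.2 r)).

(* The minimal operator h. *)
Definition dirac_min m nu mu lambda k : operator R :=
  [set fg | [/\ test_fun fg.1.1, test_fun fg.1.2 &
                fg.2 = dirac_expr m nu mu lambda k fg.1]].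

(* (d/dr + k/r) u and (d/dr - k/r) u, for k and -k, as distributions. *)
Definition radial_derive (k : int) (u : R -> R[i]) : distribution :=
  distr_add (distr_derive (of_fun u))
            (distr_mul (fun r => k%:~R / r) (of_fun u)).

Definition free_domain (k : int) : set (spinor R) :=
  [set f | [/\ L2 f, distr_L2 (radial_derive k f.1) &
               distr_L2 (radial_derive (- k) f.2)]].

(* The free operator h^0; note that - d/dr + k/r = - (d/dr - k/r). *)
Definition dirac_free m k : operator R :=
  [set fg | [/\ free_domain k fg.1, L2 fg.2,
     distr_eq (of_fun fg.2.1)
       (distr_add (distr_mul (fun=> m) (of_fun fg.1.1))
                  (distr_opp (radial_derive (- k) fg.1.2))) &
     distr_eq (of_fun fg.2.2)
       (distr_add (radial_derive k fg.1.1)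
                  (distr_mul (fun=> - m) (of_fun fg.1.2)))]].

End RadialDirac.

(* Main.v *)
Require Import Defs.
From mathcomp Require Import all_boot all_order all_algebra.
From mathcomp Require Import complex.
From mathcomp Require Import all_classical all_reals all_analysis.
From mathcomp Require Import measurable_realfun ring lra.

(** Write [p = nu + mu], [q = nu - mu], [kap = k + lambda], so that
    [delta = kap ^+ 2 - p * q = gamma ^+ 2].

    The coefficients of the Dirac expression are real.  Hence a pair [(f, g)]
    lies in the graph of the adjoint of [h] exactly when the real parts and the
    imaginary parts of [f] and [g] separately solve, in the sense of weak
    derivatives, the same real 2x2 first-order system ([adjointP]).  Everything
    is thereby reduced to real functions on the half-line.

    The Coulomb matrix [M = [[- kap, - q], [p, kap]]] of that system satisfies
    [M ^+ 2 = gamma ^+ 2].  The combinations [(M + gamma) a] and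
    [(M - gamma) a] of a solution [a] therefore solve scalar equations
    [w' = c w / r + g] with [g] in L2 and [c = gamma], resp. [c = - gamma]
    ([weak_dirac_scalar]); they determine [a], their difference being
    [2 gamma a].

    For a scalar equation, testing the square of [w] against a weight that
    behaves like [1 / r] near the origin gives, when [1/2 < |c|], Hardy's
    inequality: [w / r] is in L2 ([hardy]).  When [|c| = 1/2] the leading terms
    cancel; the weight [1 / (r lg r)], with the logarithm
    [lg r = 1 + ln (1 + 1 / r)], leaves a positive remainder, and
    [w / (r lg r)] is in L2 near the origin ([log_hardy]).  The common part of the two arguments is
    [energy_estimate].

    Essential self-adjointness means that a weak solution [(a, b)] is a limit
    of test functions in the graph norm.  Multiplying [a] by a cutoff [chi]
    perturbs [b] by [chi' a].  The cutoffs of [cutoff_seq] depend on the double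
    logarithm [ln (lg r)], whose derivative is at most [1 / (r lg r)] in
    absolute value, so that [chi' a] tends to 0 in L2 by dominated convergence
    and [log_hardy].  Once the support is compact in the open half-line, the
    coefficients are bounded and the approximation of [wd_approx] by test
    functions, convergent along with its derivatives, finishes the proof
    ([weak_dirac_clos]).  So the adjoint is contained in the closure; the
    reverse inclusion is symmetry, and the closure of [h] is self-adjoint
    ([closure_self_adjoint]) with domain that of the adjoint.

    It remains to compare that domain with the domain of the free operator.
    The components of an element of the latter solve scalar equations with
    exponents [- k] and [k], and [1 <= |k|]; by Hardy's inequality the Coulomb
    terms are in L2, hence the element is in the domain of the adjoint
    ([free_sub_adjoint]).  Conversely, when [1/2 < gamma], Hardy's inequality
    for the system says that the Coulomb terms are in L2 on the domain of the
    adjoint, and they can be subtracted ([adjoint_sub_free]). *)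

Set Implicit Arguments.
Unset Strict Implicit.
Unset Printing Implicit Defensive.

Import Order.TTheory GRing.Theory Num.Theory.
Import numFieldNormedType.Exports.

Local Open Scope classical_set_scope.
Local Open Scope ring_scope.

(** * Square-integrable real functions on the half-line *)

Section RealL2.
Context {R : realType}.
Notation mu := (@lebesgue_measure R).
Notation H := (@half_line R).
Implicit Types (f g h : R -> R).

Lemma sqr_le_norm (x y : R) : `|x| <= `|y| -> x ^+ 2 <= y ^+ 2.
Proof.
by move=> xy; rewrite -(real_normK (num_real x)) -(real_normK (num_real y)) ler_sqr ?nnegrE.
Qed.

Definition rint f : R := Rintegral mu H f.
Definition integ f : Prop := mu.-integrable H (EFin \o f).
Definition rL2 f : Prop := measurable_fun H f /\ integ (fun r => f r ^+ 2).
Definition sqnrm f : R := rint (fun r => f r ^+ 2).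

Lemma half_lineP (r : R) : H r = (0 < r) :> Prop.
Proof. by rewrite /half_line /= in_itv /= andbT. Qed.

Lemma measurable_half_line : measurable H.
Proof. exact: measurable_itv. Qed.

#[local] Hint Resolve measurable_half_line : core.

Lemma eq_rint f g : (forall r : R, 0 < r -> f r = g r) -> rint f = rint g.
Proof.
move=> fg; apply: eq_Rintegral => r; rewrite inE half_lineP; exact: fg.
Qed.

Lemma eq_integ f g : (forall r : R, 0 < r -> f r = g r) -> integ f -> integ g.
Proof.
move=> fg; apply: eq_integrable; first exact: measurable_half_line.
by move=> r; rewrite inE half_lineP => r0 /=; rewrite fg.
Qed.

Lemma integD f g : integ f -> integ g -> integ (fun r => f r + g r).
Proof. by move=> fi gi; exact: (@integrableD _ _ R mu H measurable_half_line _ _ fi gi). Qed.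

Lemma integZ (c : R) f : integ f -> integ (fun r => c * f r).
Proof. by move=> fi; exact: (@integrableZl _ _ R mu H measurable_half_line c _ fi). Qed.

Lemma integN f : integ f -> integ (fun r => - f r).
Proof.
move=> fi; apply: eq_integ (integZ (-1) fi) => r _; by rewrite mulN1r.
Qed.

Lemma integB f g : integ f -> integ g -> integ (fun r => f r - g r).
Proof. by move=> fi gi; apply: integD => //; apply: integN. Qed.

Lemma integ0 : integ (fun=> 0).
Proof. exact: integrable0. Qed.

Lemma integ_le f g : measurable_fun H f -> integ g ->
  (forall r : R, 0 < r -> `|f r| <= g r) -> integ f.
Proof.
move=> mf gi fg; apply: le_integrable gi => //; first exact/measurable_EFinP.
move=> r; rewrite half_lineP => r0 /=.
by rewrite lee_fin (le_trans (fg _ r0))// ler_norm.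
Qed.

Lemma rintD f g : integ f -> integ g ->
  rint (fun r => f r + g r) = rint f + rint g.
Proof. by move=> *; apply: RintegralD. Qed.

Lemma rintZ (c : R) f : integ f -> rint (fun r => c * f r) = c * rint f.
Proof. by move=> *; apply: RintegralZl. Qed.

Lemma rintN f : integ f -> rint (fun r => - f r) = - rint f.
Proof.
move=> fi; rewrite -mulN1r -rintZ//; apply: eq_rint => r _; by rewrite mulN1r.
Qed.

Lemma rintB f g : integ f -> integ g ->
  rint (fun r => f r - g r) = rint f - rint g.
Proof. by move=> *; apply: RintegralB. Qed.

Lemma rint0 : rint (fun=> 0) = 0.
Proof. by rewrite /rint /Rintegral integral0. Qed.

Lemma rint_ge0 f : (forall r : R, 0 < r -> 0 <= f r) -> 0 <= rint f.
Proof. by move=> f0; apply: Rintegral_ge0 => r; rewrite half_lineP; exact: f0. Qed.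

Lemma rint_le f g : integ f -> integ g -> (forall r : R, 0 < r -> f r <= g r) ->
  rint f <= rint g.
Proof.
move=> fi gi fg; apply: (@le_Rintegral _ _ R mu H _ _ measurable_half_line fi gi) => r.
by rewrite half_lineP; exact: fg.
Qed.

Lemma EFin_rint f : integ f -> (\int[mu]_(x in H) (f x)%:E)%E = (rint f)%:E.
Proof.
move=> fi; rewrite /rint /Rintegral fineK//.
exact: (@integrable_fin_num _ _ R mu H measurable_half_line _ fi).
Qed.

Lemma nrm_ge0 f : 0 <= sqnrm f.
Proof. by apply: rint_ge0 => r _; exact: sqr_ge0. Qed.

Lemma eq_nrm f g : (forall r : R, 0 < r -> f r = g r) -> sqnrm f = sqnrm g.
Proof. by move=> fg; apply: eq_rint => r /fg ->. Qed.

Lemma measurable_half_eq f g : (forall r : R, 0 < r -> f r = g r) ->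
  measurable_fun H f -> measurable_fun H g.
Proof.
move=> fg; apply: eq_measurable_fun => r; rewrite inE half_lineP; exact: fg.
Qed.

Lemma eq_rL2 f g : (forall r : R, 0 < r -> f r = g r) -> rL2 f -> rL2 g.
Proof.
move=> fg [mf fi]; split; first exact: measurable_half_eq mf.
by apply: eq_integ fi => r /fg ->.
Qed.

Lemma rL2_mul f g : rL2 f -> rL2 g -> integ (fun r => f r * g r).
Proof.
move=> [mf fi] [mg gi]; apply: (integ_le _ (integD fi gi)).
  exact: measurable_funM.
move=> r _; rewrite ler_norml; apply/andP; split; nra.
Qed.

Lemma rL2_le f g : measurable_fun H f -> rL2 g ->
  (forall r : R, 0 < r -> `|f r| <= `|g r|) -> rL2 f.
Proof.
move=> mf [mg gi] fg; split=> //; apply: (integ_le _ gi).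
  exact: measurable_funX.
by move=> r /fg fgr; rewrite ger0_norm ?sqr_ge0//; exact: sqr_le_norm.
Qed.

Lemma rL20 : rL2 (fun=> 0).
Proof.
split; first exact: measurable_cst.
by apply: eq_integ integ0 => r _; rewrite expr0n.
Qed.

Lemma rL2Z (c : R) f : rL2 f -> rL2 (fun r => c * f r).
Proof.
move=> [mf fi]; split; first by apply: measurable_funM.
by apply: eq_integ (integZ (c ^+ 2) fi) => r _; rewrite exprMn.
Qed.

Lemma rL2D f g : rL2 f -> rL2 g -> rL2 (fun r => f r + g r).
Proof.
move=> fi gi; split; first by apply: measurable_funD; [case: fi|case: gi].
have [_ f2] := fi; have [_ g2] := gi.
have := integD (integD f2 g2) (integZ 2 (rL2_mul fi gi)).
by apply: eq_integ => r _ /=; ring.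
Qed.

Lemma rL2N f : rL2 f -> rL2 (fun r => - f r).
Proof. by move=> /(rL2Z (-1)); apply: eq_rL2 => r _; rewrite mulN1r. Qed.

Lemma rL2B f g : rL2 f -> rL2 g -> rL2 (fun r => f r - g r).
Proof. by move=> fi gi; apply: rL2D => //; exact: rL2N. Qed.

Lemma rL2_bounded (M : R) (b f : R -> R) : measurable_fun H b ->
  (forall r : R, 0 < r -> `|b r| <= M) -> rL2 f -> rL2 (fun r => b r * f r).
Proof.
move=> mb bM fi; apply: rL2_le (rL2Z M fi) _ => [|r r0].
  by apply: measurable_funM => //; case: fi.
rewrite !normrM ler_wpM2r// (le_trans (bM _ r0))// ler_norm//.
Qed.

Lemma rL2_sqr f : rL2 f -> integ (fun r => f r ^+ 2).
Proof. by case. Qed.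

Lemma nrm_le f g : rL2 f -> rL2 g -> (forall r : R, 0 < r -> `|f r| <= `|g r|) ->
  sqnrm f <= sqnrm g.
Proof.
move=> fi gi fg; apply: rint_le; [exact: rL2_sqr|exact: rL2_sqr|] => r /fg.
exact: sqr_le_norm.
Qed.

Lemma nrmZ (c : R) f : rL2 f -> sqnrm (fun r => c * f r) = c ^+ 2 * sqnrm f.
Proof.
move=> [_ fi]; rewrite -rintZ//; apply: eq_rint => r _; by rewrite exprMn.
Qed.

Lemma nrmD f g : rL2 f -> rL2 g ->
  sqnrm (fun r => f r + g r) = sqnrm f + sqnrm g + 2 * rint (fun r => f r * g r).
Proof.
move=> fi gi; have fgi := rL2_mul fi gi; have [_ f2] := fi; have [_ g2] := gi.
rewrite -rintZ// -[sqnrm f + _]rintD// -rintD//; [|exact: integD|exact: integZ].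
by apply: eq_rint => r _; ring.
Qed.

Lemma nrmD_le f g : rL2 f -> rL2 g ->
  sqnrm (fun r => f r + g r) <= 2 * sqnrm f + 2 * sqnrm g.
Proof.
move=> fi gi; have [_ f2] := fi; have [_ g2] := gi.
rewrite -mulrDr -rintD// -rintZ; last exact: integD.
apply: rint_le => [|| r _]; [by case: (rL2D fi gi)|by apply/integZ/integD|].
by have := sqr_ge0 (f r - g r); nra.
Qed.

(** Since the squared norm of [s f + t g] is a nonnegative quadratic form in
    [(s, t)], its discriminant is nonpositive. *)
Lemma cauchy_schwarz f g : rL2 f -> rL2 g ->
  rint (fun r => f r * g r) ^+ 2 <= sqnrm f * sqnrm g.
Proof.
move=> fi gi; set p := rint _.
have q (s t : R) : 0 <= s ^+ 2 * sqnrm f + t ^+ 2 * sqnrm g + 2 * (s * t * p).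
  have := nrm_ge0 (fun r => s * f r + t * g r).
  rewrite (nrmD (rL2Z s fi) (rL2Z t gi)) !nrmZ//.
  rewrite (_ : rint (fun r => s * f r * (t * g r)) = s * t * p)//.
  rewrite -rintZ; last exact: rL2_mul.
  by apply: eq_rint => r _; ring.
have := nrm_ge0 f; have := nrm_ge0 g => g0 f0.
have [g00|gn0] := eqVneq (sqnrm g) 0.
  (* The form is affine in its second argument when the norm of [g] vanishes,
     and this value would make it negative. *)
  have := q 1 (- (sqnrm f + 1) / p); rewrite g00 => Q.
  rewrite mulr0; have [->|p0] := eqVneq p 0; first by rewrite expr0n.
  exfalso; move: Q; rewrite mulr0 addr0 expr1n mul1r mul1r.
  rewrite mulfVK//; lra.
have gp : 0 < sqnrm g by rewrite lt_neqAle eq_sym gn0.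
(* The value of the second argument at which the form is minimal. *)
have := q (sqnrm g) (- p).
rewrite (_ : _ + _ = sqnrm g * (sqnrm f * sqnrm g - p ^+ 2)); last by ring.
by rewrite pmulr_rge0// subr_ge0.
Qed.

Lemma norm_rint_mul f g : rL2 f -> rL2 g ->
  `|rint (fun r => f r * g r)| <= Num.sqrt (sqnrm f) * Num.sqrt (sqnrm g).
Proof.
move=> fi gi; rewrite -sqrtr_sqr -sqrtrM ?nrm_ge0// ler_wsqrtr//.
exact: cauchy_schwarz.
Qed.

Definition cvL2 (F : nat -> R -> R) f : Prop :=
  sqnrm (fun r => F n r - f r) @[n --> \oo] --> (0 : R).

Lemma cv_le (F : nat -> R -> R) f (e : nat -> R) :
  (\forall n \near \oo, sqnrm (fun r => F n r - f r) <= e n) -> e @ \oo --> (0 : R) ->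
  cvL2 F f.
Proof.
move=> Fe e0; apply: (squeeze_cvgr _ _ e0); last exact: cvg_cst.
by apply: filterS Fe => n ->; rewrite nrm_ge0.
Qed.

Lemma cv_inv (F : nat -> R -> R) f :
  (forall n, sqnrm (fun r => F n r - f r) <= n.+1%:R^-1) -> cvL2 F f.
Proof.
move=> Fe; apply: (@cv_le _ _ (fun n => n.+1%:R^-1)); first exact: nearW.
exact: cvg_harmonic.
Qed.

Lemma cvP (F : nat -> R -> R) f e : cvL2 F f -> 0 < e ->
  \forall n \near \oo, sqnrm (fun r => F n r - f r) < e.
Proof.
move=> /cvgrPdist_lt Fe e0; have := Fe _ e0; apply: filterS => n.
by rewrite sub0r normrN ger0_norm ?nrm_ge0.
Qed.

Lemma cv_cst f : cvL2 (fun=> f) f.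
Proof.
rewrite /cvL2 (_ : (fun _ => _) = fun=> 0); first exact: cvg_cst.
apply/funext => n; rewrite -[RHS]rint0; apply: eq_rint => r _.
by rewrite subrr expr0n.
Qed.

Lemma eq_cv (F G : nat -> R -> R) f g :
  (forall n (r : R), 0 < r -> F n r = G n r) -> (forall r : R, 0 < r -> f r = g r) ->
  cvL2 F f -> cvL2 G g.
Proof.
move=> FG fg; rewrite /cvL2.
rewrite (_ : (fun n => sqnrm (fun r => F n r - f r)) =
  (fun n => sqnrm (fun r => G n r - g r)))//.
by apply/funext => n; apply: eq_nrm => r r0; rewrite FG// fg.
Qed.

Lemma cvD2 (F G : nat -> R -> R) f g :
  (forall n, rL2 (F n)) -> (forall n, rL2 (G n)) -> rL2 f -> rL2 g ->
  cvL2 F f -> cvL2 G g -> cvL2 (fun n r => F n r + G n r) (fun r => f r + g r).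
Proof.
move=> F2 G2 f2 g2 Ff Gg.
apply: (@cv_le _ _ (fun n => 2 * sqnrm (fun r => F n r - f r) +
                             2 * sqnrm (fun r => G n r - g r))).
  apply: nearW => n; rewrite -(@eq_nrm (fun r => (F n r - f r) + (G n r - g r))).
    by apply: nrmD_le; exact: rL2B.
  by move=> r _; ring.
rewrite -[X in _ --> X]addr0 -[X in _ --> X + _](mulr0 2) -[X in _ --> _ + X](mulr0 2).
by apply: cvgD; apply: cvgM => //; exact: cvg_cst.
Qed.

Lemma cv_bounded (M : R) (b : R -> R) (F : nat -> R -> R) f : measurable_fun H b ->
  (forall r : R, 0 < r -> `|b r| <= M) -> (forall n, rL2 (F n)) -> rL2 f ->
  cvL2 F f -> cvL2 (fun n r => b r * F n r) (fun r => b r * f r).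
Proof.
move=> mb bM F2 f2 Ff.
apply: (@cv_le _ _ (fun n => M ^+ 2 * sqnrm (fun r => F n r - f r))).
  apply: nearW => n.
  rewrite -nrmZ; last exact: rL2B.
  rewrite -(@eq_nrm (fun r => b r * (F n r - f r))); last first.
    by move=> r _; rewrite mulrBr.
  have Fi : rL2 (fun r => F n r - f r) by exact: rL2B.
  apply: nrm_le; [exact: rL2_bounded bM Fi|exact: rL2Z|move=> r r0].
  rewrite !normrM ler_wpM2r// (le_trans (bM _ r0))// ler_norm//.
rewrite -[X in _ --> X](mulr0 (M ^+ 2)).
by apply: cvgM => //; exact: cvg_cst.
Qed.

Lemma cvZ (c : R) (F : nat -> R -> R) f : (forall n, rL2 (F n)) -> rL2 f ->
  cvL2 F f -> cvL2 (fun n r => c * F n r) (fun r => c * f r).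
Proof. by apply: (@cv_bounded `|c|). Qed.

(** Strong convergence of both factors gives convergence of the integral of
    the product: apply the Cauchy-Schwarz inequality to
    [F G - f g = (F - f) (G - g) + (F - f) g + f (G - g)]. *)
Lemma cv_rint (F G : nat -> R -> R) f g :
  (forall n, rL2 (F n)) -> (forall n, rL2 (G n)) -> rL2 f -> rL2 g ->
  cvL2 F f -> cvL2 G g ->
  rint (fun r => F n r * G n r) @[n --> \oo] --> rint (fun r => f r * g r).
Proof.
move=> F2 G2 f2 g2 Ff Gg.
pose a n := Num.sqrt (sqnrm (fun r => F n r - f r)).
pose b n := Num.sqrt (sqnrm (fun r => G n r - g r)).
have sq0 (u : nat -> R) : u @ \oo --> (0 : R) -> Num.sqrt (u n) @[n --> \oo] --> (0 : R).
  move=> u0; rewrite -[X in _ --> X]sqrtr0.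
  by apply: continuous_cvg => //; exact: sqrt_continuous.
have a0 : a @ \oo --> (0 : R) by exact: sq0.
have b0 : b @ \oo --> (0 : R) by exact: sq0.
apply/subr_cvg0.
apply/norm_cvg0P.
have e0 : (fun n => a n * b n + a n * Num.sqrt (sqnrm g) + Num.sqrt (sqnrm f) * b n)
    @ \oo --> (0 : R).
  rewrite (_ : 0 = 0 * 0 + 0 * Num.sqrt (sqnrm g) + Num.sqrt (sqnrm f) * 0); last by ring.
  by apply: cvgD; [apply: cvgD|]; apply: cvgM => //; exact: cvg_cst.
apply: (squeeze_cvgr _ _ e0); last exact: cvg_cst.
apply: nearW => n; rewrite normr_ge0/=.
have Fi := rL2B (F2 n) f2; have Gi := rL2B (G2 n) g2.
rewrite -rintB; [|exact: rL2_mul|exact: rL2_mul].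
rewrite (@eq_rint _ (fun r => (F n r - f r) * (G n r - g r) + (F n r - f r) * g r + f r * (G n r - g r))); last first.
  by move=> r _; ring.
rewrite rintD; [|apply: integD; exact: rL2_mul|exact: rL2_mul].
rewrite rintD; [|exact: rL2_mul|exact: rL2_mul].
rewrite (le_trans (ler_normD _ _))// lerD//; last exact: norm_rint_mul.
by rewrite (le_trans (ler_normD _ _))// lerD//; exact: norm_rint_mul.
Qed.

Lemma cv_dominated (X : nat -> R -> R) h :
  (forall n, measurable_fun H (X n)) -> rL2 h ->
  (forall n (r : R), 0 < r -> `|X n r| <= h r) ->
  (forall r : R, 0 < r -> X n r @[n --> \oo] --> (0 : R)) ->
  sqnrm (X n) @[n --> \oo] --> (0 : R).
Proof.
move=> mX [mh hi] Xh X0.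
have [] := @dominated_convergence _ _ R mu H measurable_half_line
  (fun n => EFin \o (fun r => X n r ^+ 2)) (fun=> 0%E)
  (EFin \o (fun r => h r ^+ 2)).
- by move=> n; apply/measurable_EFinP; apply: measurable_funX; exact: mX.
- by [].
- apply: aeW => r; rewrite half_lineP => r0 /=.
  apply: cvg_EFin; first exact: nearW.
  rewrite (_ : 0 = 0 ^+ 2); last by rewrite expr0n.
  by apply: cvgM; exact: X0.
- exact: hi.
- apply: aeW => r n; rewrite half_lineP => r0 /=.
  rewrite lee_fin ger0_norm ?sqr_ge0//; apply: sqr_le_norm.
  by rewrite (le_trans (Xh n r r0))// ler_norm.
move=> _ _; rewrite integral0 => lim0.
exact: (@fine_cvg _ _ _ _ _ 0 lim0).
Qed.

Lemma cv_dominated_fun (F : nat -> R -> R) f h :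
  (forall n, measurable_fun H (F n)) -> measurable_fun H f -> rL2 h ->
  (forall n (r : R), 0 < r -> `|F n r - f r| <= h r) ->
  (forall r : R, 0 < r -> F n r @[n --> \oo] --> f r) -> cvL2 F f.
Proof.
move=> mF mf h2 Fh Ff; apply: cv_dominated h2 Fh _ => [n|r r0].
  by apply: measurable_funB => //; exact: mF.
by apply/subr_cvg0; exact: Ff.
Qed.

End RealL2.

(** * One-variable calculus *)

Section Calculus.
Context {R : realType}.
Implicit Types (f g : R -> R) (x y : R).

(** Differentiation as a relation: the rules below then compute a derivative
    along with the proof that it exists. *)
Definition isd x f (d : R) : Prop := is_derive x (1 : R) f d.

Lemma isd_eq x f d d' : isd x f d -> d = d' -> isd x f d'.
Proof. by move=> fd <-. Qed.

Lemma isd_cst x (c : R) : isd x (fun=> c) 0.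
Proof. exact: is_derive_cst. Qed.

Lemma isd_id x : isd x (fun y => y) 1.
Proof. exact: is_derive_id. Qed.

Lemma isdD x f g d e : isd x f d -> isd x g e -> isd x (fun y => f y + g y) (d + e).
Proof. exact: is_deriveD. Qed.

Lemma isdB x f g d e : isd x f d -> isd x g e -> isd x (fun y => f y - g y) (d - e).
Proof. exact: is_deriveB. Qed.

Lemma isdN x f d : isd x f d -> isd x (fun y => - f y) (- d).
Proof. exact: is_deriveN. Qed.

Lemma isdM x f g d e : isd x f d -> isd x g e ->
  isd x (fun y => f y * g y) (d * g x + f x * e).
Proof.
move=> fd ge; apply: (@isd_eq _ _ _ _ (is_deriveM fd ge)).
by rewrite /GRing.scale /= addrC (mulrC (g x)).
Qed.

Lemma isdZ x (c : R) f d : isd x f d -> isd x (fun y => c * f y) (c * d).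
Proof.
move=> fd; apply: (isd_eq (isdM (isd_cst x c) fd)); by rewrite mul0r add0r.
Qed.

Lemma isdV x f d : f x != 0 -> isd x f d -> isd x (fun y => (f y)^-1) (- d / f x ^+ 2).
Proof.
move=> fx fd; apply: (isd_eq (is_deriveV fx fd)).
by rewrite /GRing.scale /= mulrC mulrN mulNr.
Qed.

Lemma isdX (n : nat) x f d : isd x f d ->
  isd x (fun y => f y ^+ n.+1) (n.+1%:R * f x ^+ n * d).
Proof.
move=> fd; elim: n => [|n ih].
  by apply: (isd_eq fd); rewrite expr0 mulr1 mul1r.
rewrite (_ : (fun y => f y ^+ n.+2) = (fun y => f y * f y ^+ n.+1)); last first.
  by apply/funext => y; rewrite exprS.
apply: (isd_eq (isdM fd ih)).
by rewrite -[in RHS](natr1 n.+1) exprS; ring.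
Qed.

Lemma isd_comp x f g d e : isd (f x) g e -> isd x f d ->
  isd x (fun y => g (f y)) (e * d).
Proof. exact: is_derive1_comp. Qed.

Lemma isd_near x f g d : (\forall y \near x, f y = g y) -> isd x f d -> isd x g d.
Proof. by move=> fg; exact: (near_eq_is_derive fg). Qed.

Lemma isd_continuous x f d : isd x f d -> {for x, continuous f}.
Proof.
move=> fd; apply/differentiable_continuous/derivable1_diffP.
by case: fd.
Qed.

Lemma isd_derive1 x f d : isd x f d -> (derive1 f) x = d.
Proof. by case=> _ fd; rewrite derive1E. Qed.

Lemma isd_of_derivable x f : derivable f x 1 -> isd x f ((derive1 f) x).
Proof. by move=> fd; split=> //; rewrite derive1E. Qed.

Lemma isd_derivable x f d : isd x f d -> derivable f x 1.
Proof. by case. Qed.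

Lemma derive1_ext f f' : (forall x, isd x f (f' x)) -> (derive1 f) = f'.
Proof. by move=> fd; apply/funext => x; exact: isd_derive1. Qed.

Lemma isd_continuousT f f' : (forall x, isd x f (f' x)) -> continuous f.
Proof. by move=> fd x; exact: isd_continuous. Qed.

Lemma isd_mean f f' a b : a < b -> (forall x, isd x f (f' x)) ->
  exists2 c, a < c < b & f b - f a = f' c * (b - a).
Proof.
move=> ab fd; have [||c cab e] := @MVT R f f' a b ab.
- by move=> x _; exact: fd.
- exact/continuous_subspaceT/isd_continuousT.
by exists c => //; move: cab; rewrite in_itv.
Qed.

Lemma isd_homo f f' : (forall x, isd x f (f' x)) -> (forall x, 0 <= f' x) ->
  {homo f : x y / x <= y}.
Proof.
move=> fd f0 x y; rewrite le_eqVlt => /predU1P[->//|xy].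
have [c _ e] := isd_mean xy fd.
by rewrite -subr_ge0 e mulr_ge0// subr_ge0 ltW.
Qed.

Lemma near_lt x (c : R) : x < c -> \forall y \near x, y < c.
Proof. by exact: lt_nbhsl. Qed.

Lemma near_gt x (c : R) : c < x -> \forall y \near x, c < y.
Proof. by exact: lt_nbhsr. Qed.

(** This is how the functions that are flat at the origin are differentiated
    there. *)
Lemma isd_sqr_bound (K : R) f : (forall h, `|f h| <= K * h ^+ 2) -> isd 0 f 0.
Proof.
move=> fK.
have K0 : 0 <= K by have := fK 1; rewrite expr1n mulr1; exact: le_trans.
have f0 : f 0 = 0.
  by apply/eqP; rewrite -normr_le0 (le_trans (fK 0))// expr0n mulr0.
have lim0 : h^-1 *: ((f \o shift 0) (h *: (1 : R)) - f 0) @[h --> 0^'] --> (0 : R).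
  apply/cvgrPdist_le => /= e e0.
  near=> h; rewrite sub0r normrN f0 subr0 addr0 /GRing.scale /= mulr1.
  have h0 : h != 0 by near: h; exact: nbhs_dnbhs_neq.
  rewrite normrM normfV ler_pdivrMl ?normr_gt0//.
  rewrite (le_trans (fK h))// -real_normK ?num_real// expr2 mulrCA ler_wpM2l//.
  have he : `|h| <= e / (K + 1).
    near: h; exact: (dnbhs0_le (divr_gt0 e0 (ltr_wpDl K0 ltr01))).
  have := ler_wpM2l K0 he => /le_trans; apply.
  by rewrite mulrCA ler_piMr ?(ltW e0)// ler_pdivrMr ?ltr_wpDl// mul1r lerDl.
split; first by apply/cvg_ex; exists 0.
exact: (cvg_lim _ lim0).
Unshelve. all: by end_near. Qed.

(** Smoothness by coinduction: the iterated derivatives of an element of a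
    class that is stable under differentiation stay in the class. *)
Lemma smooth_class (C : (R -> R) -> Prop) :
  (forall f, C f -> exists2 f', C f' & forall x, isd x f (f' x)) ->
  forall f, C f -> smooth f.
Proof.
move=> CD f Cf n; elim: n f Cf => [|n ih] f /CD[f' Cf' ff'] x.
  exact: isd_derivable.
by rewrite derive1Sn (derive1_ext ff'); exact: ih.
Qed.

Lemma smooth_derive f : smooth f -> smooth (derive1 f).
Proof. by move=> sf n x; rewrite -derive1Sn; exact: sf. Qed.

Lemma smooth_isd f x : smooth f -> isd x f ((derive1 f) x).
Proof. by move=> sf; apply: isd_of_derivable; exact: (sf 0%N). Qed.

(** The class to which [smooth_class] is applied for sums and products; by the
    Leibniz rule it is stable under differentiation. *)
Inductive smooth_alg : (R -> R) -> Prop :=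
| smooth_alg_in f of smooth f : smooth_alg f
| smooth_algD f g of smooth_alg f & smooth_alg g : smooth_alg (fun x => f x + g x)
| smooth_algM f g of smooth_alg f & smooth_alg g : smooth_alg (fun x => f x * g x).

Lemma smooth_alg_smooth f : smooth_alg f -> smooth f.
Proof.
apply: smooth_class f => f; elim => {f}.
- move=> f sf; exists (derive1 f); first exact/smooth_alg_in/smooth_derive.
  by move=> x; exact: smooth_isd.
- move=> f g _ [f' sf' ff'] _ [g' sg' gg'].
  exists (fun x => f' x + g' x); first exact: smooth_algD.
  by move=> x; exact: isdD.
- move=> f g sf [f' sf' ff'] sg [g' sg' gg'].
  exists (fun x => f' x * g x + f x * g' x).
    by apply: smooth_algD; exact: smooth_algM.
  by move=> x; exact: isdM.
Qed.

Lemma smoothD f g : smooth f -> smooth g -> smooth (fun x => f x + g x).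
Proof. by move=> *; apply/smooth_alg_smooth/smooth_algD; exact: smooth_alg_in. Qed.

Lemma smoothM f g : smooth f -> smooth g -> smooth (fun x => f x * g x).
Proof. by move=> *; apply/smooth_alg_smooth/smooth_algM; exact: smooth_alg_in. Qed.

Lemma smooth_cst (c : R) : smooth (fun=> c).
Proof.
apply: (@smooth_class (fun f => exists d, f = (fun=> d))); last by exists c.
move=> _ [d ->]; exists (fun=> 0); first by exists 0.
by move=> x; exact: isd_cst.
Qed.

Lemma smoothZ (c : R) f : smooth f -> smooth (fun x => c * f x).
Proof. by move=> sf; apply: smoothM => //; exact: smooth_cst. Qed.

Lemma smooth_affine (a b : R) f : smooth f -> smooth (fun x => f (a * x + b)).
Proof.
move=> sf.
apply: (@smooth_class (fun g => exists c f0, smooth f0 /\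
  g = (fun x => c * f0 (a * x + b)))); last first.
  by exists 1, f; split => //; apply/funext => x; rewrite mul1r.
move=> _ [c [f0 [sf0 ->]]]; exists (fun x => c * a * (derive1 f0) (a * x + b)).
  by exists (c * a), (derive1 f0); split; [exact: smooth_derive|].
move=> x; rewrite -mulrA; apply: isdZ; rewrite mulrC.
apply: isd_comp; first exact: smooth_isd.
apply: (isd_eq (isdD (isdZ a (isd_id x)) (isd_cst x b))).
by rewrite addr0 mulr1.
Qed.

(** * A smooth step *)

(** The powers of [x^-1] are there to make the linear span of these functions
    stable under differentiation. *)
Definition flat (n : nat) x : R := if 0 < x then x ^- n * expR (- x^-1) else 0.

Lemma flat_le0 n x : x <= 0 -> flat n x = 0.
Proof. by rewrite /flat leNgt => /negbTE ->. Qed.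

Lemma flat_gt0 n x : 0 < x -> 0 < flat n x.
Proof.
by move=> x0; rewrite /flat x0 mulr_gt0// ?expR_gt0// invr_gt0 exprn_gt0.
Qed.

Lemma flat_ge0 n x : 0 <= flat n x.
Proof. by have [/flat_le0->//|/flat_gt0-/(_ n)/ltW] := leP x 0. Qed.

Lemma flat0_le1 x : flat 0 x <= 1.
Proof.
rewrite /flat; case: ifP => // x0.
by rewrite expr0 invr1 mul1r -expR0 ler_expR oppr_le0 invr_ge0 ltW.
Qed.

(** The exponential of [x^-1] dominates the term of order [n + 2] of its
    series. *)
Lemma flat_sqr_bound n x : `|flat n x| <= n.+2`!%:R * x ^+ 2.
Proof.
rewrite ger0_norm ?flat_ge0//; have [x0|x0] := leP x 0.
  by rewrite flat_le0// mulr_ge0 ?sqr_ge0// ler0n.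
rewrite /flat x0 expRN ler_pdivrMr ?expR_gt0//.
have := @expR_ge1Dxn R x^-1 n.+1 _; rewrite invr_ge0 ltW// => /(_ isT) h.
have {}h : x^-1 ^+ n.+2 / n.+2`!%:R <= expR x^-1 by apply: le_trans h; rewrite lerDr.
have f0 : (0 : R) < n.+2`!%:R by rewrite ltr0n fact_gt0.
move: h; rewrite ler_pdivrMr// => h.
rewrite -ler_pdivrMl; last by rewrite mulr_gt0 ?exprn_gt0.
apply: (@le_trans _ _ (x^-1 ^+ n.+2 / n.+2`!%:R)); last by rewrite ler_pdivrMr.
rewrite exprVn -!invfM -mulrA -exprD add2n mulrC lexx//.
Qed.

Lemma flat_isd n x : isd x (flat n) (- n%:R * flat n.+1 x + flat n.+2 x).
Proof.
have [x0|x0|->] := ltgtP x 0.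
- apply: (@isd_near _ (fun=> 0)).
    by near=> y; rewrite flat_le0//; apply: ltW; near: y; exact: near_lt.
  apply: (isd_eq (isd_cst x 0)); rewrite !flat_le0 ?mulr0 ?addr0//; exact: ltW.
- apply: (@isd_near _ (fun y => y^-1 ^+ n * expR (- y^-1))).
    near=> y; rewrite /flat ifT ?exprVn//; near: y; exact: near_gt.
  have xn0 : x != 0 by rewrite gt_eqF.
  have dV := isdV xn0 (isd_id x).
  have dX : isd x (fun y => y^-1 ^+ n) (- n%:R * x ^- n.+1).
    case: (n) => [|k].
      rewrite oppr0 mul0r (_ : (fun y => _) = fun=> 1); first exact: isd_cst.
      by apply/funext => y; rewrite expr0.
    apply: (isd_eq (isdX k dV)).
    by rewrite exprVn (exprD x 2 k) !invfM; ring.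
  have dE : isd x (fun y => expR (- y^-1)) (expR (- x^-1) * - (- 1 / x ^+ 2)).
    by apply: isd_comp (isdN dV); exact: is_derive_expR.
  apply: (isd_eq (isdM dX dE)); rewrite /flat x0 exprVn.
  by rewrite (exprD x 1 n) (exprD x 2 n) !invfM; ring.
- rewrite !flat_le0// mulr0 addr0; apply: isd_sqr_bound.
  exact: flat_sqr_bound.
Unshelve. all: by end_near. Qed.

Lemma flat_smooth n : smooth (flat n).
Proof.
apply: (@smooth_class (fun f => exists s : seq (R * nat),
  f = (fun x => \sum_(i <- s) i.1 * flat i.2 x))); last first.
  by exists [:: (1, n)]; apply/funext => x; rewrite big_seq1 mul1r.
move=> _ [s ->]; elim: s => [|[c k] s [g [t ->] ih]].
  exists (fun=> 0); first by exists [::]; apply/funext => x; rewrite big_nil.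
  move=> x; rewrite (_ : (fun _ => _) = fun=> 0); first exact: isd_cst.
  by apply/funext => y; rewrite big_nil.
exists (fun x => \sum_(i <- [:: (- (c * k%:R), k.+1), (c, k.+2) & t]) i.1 * flat i.2 x).
  by eexists.
move=> x; rewrite (_ : (fun y => \sum_(i <- (c, k) :: s) i.1 * flat i.2 y) =
    (fun y => c * flat k y + \sum_(i <- s) i.1 * flat i.2 y)); last first.
  by apply/funext => y; rewrite big_cons.
apply: (isd_eq (isdD (isdZ c (flat_isd k x)) (ih x))).
by rewrite !big_cons /=; ring.
Qed.

Definition bump x : R := flat 0 x * flat 0 (1 - x).

Lemma bump_smooth : smooth bump.
Proof.
apply: smoothM; first exact: flat_smooth.
have := @smooth_affine (-1) 1 _ (@flat_smooth 0).
rewrite (_ : (fun x => flat 0 (-1 * x + 1)) = (fun x => flat 0 (1 - x)))//.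
by apply/funext => x; rewrite mulN1r addrC.
Qed.

Lemma bump_ge0 x : 0 <= bump x.
Proof. by rewrite mulr_ge0// flat_ge0. Qed.

Lemma bump_le1 x : bump x <= 1.
Proof. by rewrite mulr_ile1// ?flat_ge0// flat0_le1. Qed.

Lemma bump_gt0 x : 0 < x < 1 -> 0 < bump x.
Proof. by case/andP=> x0 x1; rewrite mulr_gt0// flat_gt0// subr_gt0. Qed.

Lemma bump_out x : x <= 0 \/ 1 <= x -> bump x = 0.
Proof.
case=> h; rewrite /bump; first by rewrite flat_le0// mul0r.
by rewrite (@flat_le0 _ (1 - x)) ?mulr0// subr_le0.
Qed.

Lemma primitive_continuous (a : R) g : continuous g -> (forall x, x <= a -> g x = 0) ->
  exists2 G, (forall x, isd x G (g x)) & (forall x, x <= a -> G x = 0).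
Proof.
move=> cg g0.
(* The base point is strictly below [a], where [g] vanishes, so that the
   points beyond [a] are interior to the interval of integration. *)
pose G x := Rintegral (@lebesgue_measure R) `[a - 1, x] g.
have Ga x : x <= a -> G x = 0.
  move=> xa; rewrite /G (@eq_Rintegral _ _ _ _ _ (fun=> 0)).
    by rewrite /Rintegral integral0.
  move=> y; rewrite inE /= in_itv /= => /andP[_ yx]; apply: g0.
  exact: le_trans yx xa.
exists G => // x; have [xa|ax] := ltP x a.
  apply: (@isd_near _ (fun=> 0)).
    near=> y; rewrite Ga//; apply: ltW; near: y; exact: near_lt.
  by rewrite g0 ?ltW//; exact: isd_cst.
have [||||dG eG] := @continuous_FTC1_closed R g (a - 1) x (x + 1).
- by rewrite ltrDl.
- apply: continuous_compact_integrable; first exact: segment_compact.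
  exact: continuous_subspaceT.
- by rewrite ltrBlDr ltr_pwDr.
- exact: cg.
by rewrite -eG; exact: isd_of_derivable.
Unshelve. all: by end_near. Qed.

Lemma smooth_primitive g G : smooth g -> (forall x, isd x G (g x)) -> smooth G.
Proof.
move=> sg dG [|n] x; first exact: isd_derivable (dG x).
by rewrite derive1Sn (derive1_ext dG); exact: sg.
Qed.

Lemma smooth_continuous f : smooth f -> continuous f.
Proof. by move=> sf x; exact: (isd_continuous (@smooth_isd _ x sf)). Qed.

(** The primitive of a nonnegative bump supported in [0, 1], normalised to take
    the value 1 at 1. *)
Lemma smooth_step_exists : exists (theta : R -> R) (K : R),
  [/\ smooth theta, forall x, x <= 0 -> theta x = 0,
      forall x, 1 <= x -> theta x = 1, forall x, 0 <= theta x <= 1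
    & forall x, `|(derive1 theta) x| <= K].
Proof.
have cb := smooth_continuous bump_smooth.
have b0 x : x <= 0 -> bump x = 0 by move=> x0; apply: bump_out; left.
have [B dB B0] := primitive_continuous cb b0.
have [c /andP[c0 c1] eB] := isd_mean (@ltr01 R) dB.
have B1 : 0 < B 1.
  by move: eB; rewrite (B0 0)// !subr0 mulr1 => ->; rewrite bump_gt0// c0.
have sB := smooth_primitive bump_smooth dB.
have Bge1 x : 1 <= x -> B x = B 1.
  rewrite le_eqVlt => /predU1P[->//|x1]; have [y /andP[y1 _] e] := isd_mean x1 dB.
  by apply/eqP; rewrite -subr_eq0 e bump_out ?mul0r//; right; exact: ltW.
have hB := isd_homo dB bump_ge0.
exists (fun x => (B 1)^-1 * B x), (B 1)^-1; split.
- exact: smoothZ.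
- by move=> x x0; rewrite (B0 x)// mulr0.
- by move=> x x1; rewrite (Bge1 x)// mulVf// gt_eqF.
- move=> x; apply/andP; split.
    have [x0|x0] := leP x 0; first by rewrite (B0 x)// mulr0.
    apply: mulr_ge0; first by rewrite invr_ge0 ltW.
    by have := hB _ _ (ltW x0); rewrite (B0 0).
  rewrite ler_pdivrMl// mulr1; have [x1|x1] := leP x 1; first exact: hB.
  by rewrite (Bge1 x)// ltW.
- move=> x; rewrite (isd_derive1 (isdZ _ (dB x))) normrM.
  have i0 : 0 <= (B 1)^-1 by rewrite invr_ge0 ltW.
  by rewrite (ger0_norm i0) (ger0_norm (bump_ge0 x)) ler_piMr ?bump_le1.
Qed.

End Calculus.

(** * Test functions *)

Import HBNNSimple.

Section TestFunctions.
Context {R : realType}.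
Notation mu := (@lebesgue_measure R).
Notation H := (@half_line R).
Implicit Types (f g phi : R -> R) (a b c d x : R).

Definition supp_in f a b : Prop := forall x, f x != 0 -> a <= x <= b.
Definition compact_supp f : Prop := exists a b, 0 < a /\ supp_in f a b.
Definition rtest phi : Prop := smooth phi /\ compact_supp phi.
(** Weights and cutoffs built from logarithms enter through their first
    derivative only, and the continuity of that derivative suffices to test weak
    derivatives against them. *)
Definition C1c phi : Prop :=
  [/\ forall x, derivable phi x 1, continuous (derive1 phi) & compact_supp phi].

Lemma supp_out f a b x : supp_in f a b -> (x < a) || (b < x) -> f x = 0.
Proof.
move=> fab; apply: contraTeq => /fab /andP[ax xb].
by rewrite negb_or -!leNgt ax.
Qed.

Lemma supp_derive f a b : supp_in f a b -> supp_in (derive1 f) a b.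
Proof.
move=> fab x; apply: contraNT; rewrite negb_and -!ltNge => xab.
apply/eqP/isd_derive1; apply: (@isd_near _ _ (fun=> 0)); last exact: isd_cst.
case/orP: xab => [xa|bx].
- by near=> y; rewrite (supp_out fab)//; apply/orP; left; near: y; exact: near_lt.
- by near=> y; rewrite (supp_out fab)//; apply/orP; right; near: y; exact: near_gt.
Unshelve. all: by end_near. Qed.

Lemma compact_suppM f g : compact_supp f -> compact_supp (fun x => g x * f x).
Proof.
move=> [a [b [a0 fab]]]; exists a, b; split => // x.
by rewrite mulf_eq0 negb_or => /andP[_ /fab].
Qed.

Lemma compact_supp_derive f : compact_supp f -> compact_supp (derive1 f).
Proof. by move=> [a [b [a0 fab]]]; exists a, b; split => //; exact: supp_derive. Qed.

Lemma compact_suppD f g : compact_supp f -> compact_supp g ->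
  compact_supp (fun x => f x + g x).
Proof.
move=> [a [b [a0 fab]]] [c [d [c0 gcd]]].
exists (Num.min a c), (Num.max b d); split; first by rewrite lt_min a0.
move=> x fg; have [fx|/fab/andP[ax xb]] := eqVneq (f x) 0; last first.
  by rewrite ge_min ax/= le_max xb.
move: fg; rewrite fx add0r => /gcd/andP[cx xd].
by rewrite ge_min cx orbT/= le_max xd orbT.
Qed.

Lemma continuous_bounded f a b : continuous f -> supp_in f a b ->
  exists2 M, 0 <= M & forall x, `|f x| <= M.
Proof.
move=> cf fab; have [ab|ba] := leP a b; last first.
  exists 0 => // x; rewrite (supp_out fab) ?normr0//.
  by have [//|ax] := ltP x a; rewrite (lt_le_trans ba).
have cn : {within `[a, b], continuous (fun x => `|f x|)}.
  apply: continuous_subspaceT => x.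
  exact: (continuous_comp (cf x) (@norm_continuous _ _ _)).
have [c _ fc] := EVT_max ab cn.
exists `|f c| => // x; have [->|fx] := eqVneq (f x) 0; first by rewrite normr0.
by apply: fc; rewrite in_itv /= fab.
Qed.

Lemma continuous_measurable_half f : continuous f -> measurable_fun H f.
Proof.
by move=> cf; apply: measurable_funTS; exact: continuous_measurable_fun.
Qed.

Lemma rL2_indic a b : rL2 (\1_(`]a, b]%classic) : R -> R).
Proof.
split; first by apply: measurable_funTS; exact: measurable_indic.
apply: (@eq_integ _ (\1_(`]a, b]%classic))) => [r _|].
  by rewrite indicE; case: (_ \in _); rewrite ?expr1n ?expr0n.
apply: (integrableS _ _ _ (integrable_indic_itv a b false false)) => //.
exact: measurable_half_line.
Qed.

Lemma rL2_bounded_supp (M : R) f a b : measurable_fun H f ->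
  (forall x, `|f x| <= M) -> supp_in f a b -> rL2 f.
Proof.
move=> mf fM fab.
apply: (rL2_le mf (rL2Z M (rL2_indic (a - 1) b))) => r _.
have [->|/fab/andP[ar rb]] := eqVneq (f r) 0; first by rewrite normr0.
rewrite indicE mem_set/= ?in_itv/= ?mulr1.
  by rewrite (le_trans (fM r))// ler_norm.
by rewrite rb andbT (lt_le_trans _ ar)// ltrBlDr ltrDl.
Qed.

Lemma rL2_continuous_supp f : continuous f -> compact_supp f -> rL2 f.
Proof.
move=> cf [a [b [a0 fab]]]; have [M _ fM] := continuous_bounded cf fab.
exact: rL2_bounded_supp (continuous_measurable_half cf) fM fab.
Qed.

Lemma C1c_isd phi x : C1c phi -> isd x phi (derive1 phi x).
Proof. by move=> [dp _ _]; exact: isd_of_derivable. Qed.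

Lemma C1c_continuous phi : C1c phi -> continuous phi.
Proof. by move=> p x; exact: isd_continuous (C1c_isd x p). Qed.

Lemma C1c_rL2 phi : C1c phi -> rL2 phi.
Proof.
by move=> p; apply: rL2_continuous_supp; [exact: C1c_continuous|case: p].
Qed.

Lemma C1c_derive_rL2 phi : C1c phi -> rL2 (derive1 phi).
Proof.
by move=> [_ cp sp]; apply: rL2_continuous_supp => //; exact: compact_supp_derive.
Qed.

Lemma C1c_intro f f' : (forall x, isd x f (f' x)) -> continuous f' ->
  compact_supp f -> C1c f.
Proof.
move=> df cf sf; split=> // [x|]; first exact: isd_derivable (df x).
by rewrite (derive1_ext df).
Qed.

Lemma C1cM f g : C1c f -> C1c g -> C1c (fun x => f x * g x).
Proof.
move=> fc gc; have [_ cf sf] := fc; have [_ cg sg] := gc.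
apply: (@C1c_intro _ (fun x => derive1 f x * g x + f x * derive1 g x)).
- by move=> x; apply: isdM; exact: C1c_isd.
- move=> x; apply: cvgD; apply: cvgM.
  + exact: cf.
  + exact: (C1c_continuous gc).
  + exact: (C1c_continuous fc).
  + exact: cg.
- exact: compact_suppM.
Qed.

Lemma derive1_mulC1c f g x : C1c f -> C1c g ->
  derive1 (fun x => f x * g x) x = derive1 f x * g x + f x * derive1 g x.
Proof. by move=> fc gc; apply: isd_derive1; apply: isdM; exact: C1c_isd. Qed.

Lemma rtest_C1c phi : rtest phi -> C1c phi.
Proof.
move=> [sp cp]; split=> //; first exact: (sp 0%N).
exact/smooth_continuous/smooth_derive.
Qed.

Lemma rtest_derive phi : rtest phi -> rtest (derive1 phi).
Proof. by move=> [sp cp]; split; [exact: smooth_derive|exact: compact_supp_derive]. Qed.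

Lemma rtest_rL2 phi : rtest phi -> rL2 phi.
Proof. by move=> /rtest_C1c/C1c_rL2. Qed.

Lemma rtestD f g : rtest f -> rtest g -> rtest (fun x => f x + g x).
Proof. by move=> [sf cf] [sg cg]; split; [exact: smoothD|exact: compact_suppD]. Qed.

Lemma rtestM f g : smooth f -> rtest g -> rtest (fun x => f x * g x).
Proof. by move=> sf [sg cg]; split; [exact: smoothM|exact: compact_suppM]. Qed.

Lemma rtestZ c f : rtest f -> rtest (fun x => c * f x).
Proof. by apply: rtestM; exact: smooth_cst. Qed.

Lemma rtestB f g : rtest f -> rtest g -> rtest (fun x => f x - g x).
Proof.
move=> ft /(rtestZ (-1)) gt; have := rtestD ft gt.
by rewrite (_ : (fun x => f x + -1 * g x) = (fun x => f x - g x))//; apply/funext => x; rewrite mulN1r.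
Qed.

Lemma rtest0 : rtest (fun=> 0).
Proof.
split; first exact: smooth_cst.
by exists 1, 1; split => // x; rewrite eqxx.
Qed.

Lemma rint_supp f a b : 0 < a -> supp_in f a b -> rint f = Rintegral mu `[a, b] f.
Proof.
move=> a0 fab; rewrite /rint Rintegral_mkcond [RHS]Rintegral_mkcond.
apply: eq_Rintegral => x _; rewrite /patch.
have [xab|xab] := boolP (x \in `[a, b]%classic).
  rewrite ifT//; move: xab; rewrite !inE half_lineP /= in_itv /= => /andP[ax _].
  exact: lt_le_trans ax.
rewrite (_ : f x = 0) ?if_same//; apply/eqP; apply: contraNT xab => /fab.
by rewrite inE /= in_itv.
Qed.

Lemma rint_derive0 phi : C1c phi -> rint (derive1 phi) = 0.
Proof.
move=> p; have [_ cp [a [b [a0 pab]]]] := p.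
have [ab|ba] := leP a b; last first.
  rewrite (_ : derive1 phi = fun=> 0) ?rint0//; apply/funext => x.
  apply: (supp_out (supp_derive pab)).
  by have [//|ax] := ltP x a; rewrite (lt_le_trans ba).
have a20 : 0 < a / 2 by rewrite divr_gt0.
have aa : a / 2 < a by rewrite ltr_pdivrMr// ltr_pMr// ltr1n.
have pab' : supp_in phi (a / 2) (b + 1).
  by move=> x /pab /andP[ax xb]; rewrite (le_trans (ltW aa) ax) (le_trans xb)// lerDl.
rewrite (rint_supp a20 (supp_derive pab')) /Rintegral.
have ab' : a / 2 < b + 1 by rewrite (lt_le_trans aa)// (le_trans ab)// lerDl.
rewrite (@continuous_FTC2 R (derive1 phi) phi _ _ ab').
- rewrite (supp_out pab (x := a / 2)) ?aa// (supp_out pab (x := b + 1)).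
    by rewrite /= subrr.
  by rewrite ltrDl ltr01 orbT.
- exact: continuous_subspaceT.
- have cphi := C1c_continuous p.
  split => [x _||]; first by case: p.
  + by apply: cvg_at_right_filter; exact: cphi.
  + by apply: cvg_at_left_filter; exact: cphi.
- by [].
Qed.

Lemma rint_by_parts f g : C1c f -> C1c g ->
  rint (fun x => f x * derive1 g x) = - rint (fun x => derive1 f x * g x).
Proof.
move=> fc gc; apply/eqP; rewrite -addr_eq0 addrC; apply/eqP.
rewrite -[RHS](rint_derive0 (C1cM fc gc)) -rintD.
- by apply: eq_rint => r _; rewrite derive1_mulC1c.
- by apply: rL2_mul; [exact: C1c_derive_rL2|exact: C1c_rL2].
- by apply: rL2_mul; [exact: C1c_rL2|exact: C1c_derive_rL2].
Qed.

(** Multiplication by such a function turns a local statement into one about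
    compactly supported functions, without changing anything on [[a, b]]. *)
Lemma window_exists a b : 0 < a -> exists zeta : R -> R,
  [/\ rtest zeta, supp_in zeta (a / 4) (b + 2), forall x, 0 <= zeta x <= 1,
      forall x, a <= x <= b -> zeta x = 1
    & forall x, a <= x <= b -> derive1 zeta x = 0].
Proof.
move=> a0; have [th [K [sth th0 th1 th01 _]]] := @smooth_step_exists R.
pose zeta x := th (4 / a * x + -1) * th (-1 * x + (b + 2)).
have z1 x : a / 2 < x < b + 1 -> zeta x = 1.
  move=> /andP[ax xb]; rewrite /zeta !th1 ?mulr1//; first by lra.
  rewrite lerBrDr mulrAC ler_pdivlMr//; move: ax; rewrite ltr_pdivrMr//; lra.
have zs : supp_in zeta (a / 4) (b + 2).
  move=> x; rewrite mulf_eq0 negb_or => /andP[h1 h2]; apply/andP; split.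
    rewrite leNgt; apply: contra_neqN h1 => xa; apply: th0.
    rewrite subr_le0 mulrAC ler_pdivrMr// mul1r mulrC -ler_pdivlMr//; exact: ltW.
  rewrite leNgt; apply: contra_neqN h2 => xb; apply: th0; lra.
exists zeta; split => //.
- split; first by apply: smoothM; exact: smooth_affine.
  by exists (a / 4), (b + 2); split; first by rewrite divr_gt0.
- move=> x; have /andP[p0 p1] := th01 (4 / a * x + -1).
  have /andP[q0 q1] := th01 (-1 * x + (b + 2)).
  by rewrite mulr_ge0// mulr_ile1.
- move=> x /andP[ax xb]; apply: z1; apply/andP; split; lra.
- move=> x /andP[ax xb]; apply: isd_derive1.
  apply: (@isd_near _ _ (fun=> 1)); last exact: isd_cst.
  have xa2 : a / 2 < x by lra.
  have xb1 : x < b + 1 by lra.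
  near=> y; rewrite z1//; apply/andP; split; near: y; [exact: near_gt|exact: near_lt].
Unshelve. all: by end_near. Qed.

(** * Density of the test functions in L2 *)

Definition approximable f : Prop :=
  forall e : R, 0 < e -> exists2 phi, rtest phi & sqnrm (fun r => phi r - f r) < e.

Lemma dens_lim f : rL2 f ->
  (forall e : R, 0 < e -> exists g, [/\ rL2 g, approximable g & sqnrm (fun r => g r - f r) < e]) ->
  approximable f.
Proof.
move=> f2 fd e e0; have e40 : 0 < e / 4 by rewrite divr_gt0.
have [g [g2 gd gf]] := fd _ e40; have [phi pt pg] := gd _ e40.
exists phi => //; rewrite (@eq_nrm _ _ (fun r => (phi r - g r) + (g r - f r))); last first.
  by move=> r _; ring.
apply: le_lt_trans (nrmD_le (rL2B (rtest_rL2 pt) g2) (rL2B g2 f2)) _.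
lra.
Qed.

Lemma dens_cv (F : nat -> R -> R) f : rL2 f -> (forall n, rL2 (F n)) ->
  (forall n, approximable (F n)) -> cvL2 F f -> approximable f.
Proof.
move=> f2 F2 Fd Ff; apply: dens_lim => // e e0.
have [n _ /(_ n (leqnn n))Fn] := cvP Ff e0.
by exists (F n).
Qed.

Lemma dens_rtest phi : rtest phi -> approximable phi.
Proof.
move=> pt e e0; exists phi => //; rewrite (@eq_nrm _ _ (fun=> 0)).
  by rewrite /sqnrm (@eq_rint _ _ (fun=> 0)) ?rint0// => r _; rewrite expr0n.
by move=> r _; rewrite subrr.
Qed.

Lemma densD f g : rL2 f -> rL2 g -> approximable f -> approximable g -> approximable (fun r => f r + g r).
Proof.
move=> f2 g2 fd gd e e0; have e40 : 0 < e / 4 by rewrite divr_gt0.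
have [p pt pf] := fd _ e40; have [q qt qg] := gd _ e40.
exists (fun r => p r + q r); first exact: rtestD.
rewrite (@eq_nrm _ _ (fun r => (p r - f r) + (q r - g r))); last by move=> r _; ring.
apply: le_lt_trans (nrmD_le (rL2B (rtest_rL2 pt) f2) (rL2B (rtest_rL2 qt) g2)) _.
lra.
Qed.

Lemma densZ c f : rL2 f -> approximable f -> approximable (fun r => c * f r).
Proof.
move=> f2 fd e e0; have e10 : 0 < e / (c ^+ 2 + 1).
  by rewrite divr_gt0// ltr_wpDl ?sqr_ge0.
have [p pt pf] := fd _ e10; exists (fun r => c * p r); first exact: rtestZ.
rewrite (@eq_nrm _ _ (fun r => c * (p r - f r))); last by move=> r _; ring.
rewrite nrmZ; last exact: (rL2B (rtest_rL2 pt) f2).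
move: pf; rewrite ltr_pdivlMr ?ltr_wpDl ?sqr_ge0//.
have := nrm_ge0 (fun r => p r - f r); have := sqr_ge0 c; nra.
Qed.

Lemma eq_dens f g : (forall r, f r = g r) -> approximable f -> approximable g.
Proof. by move=> /funext ->. Qed.

(** Products of two smooth steps that become steeper and steeper tend to the
    indicator pointwise, under a fixed dominating function.  As [0 < c], their
    supports stay away from the origin. *)
Lemma dens_itv c d : 0 < c -> approximable (\1_(`]c, d]%classic) : R -> R).
Proof.
move=> c0; have [dc|cd] := leP d c.
  apply: eq_dens (dens_rtest rtest0) => r.
  by rewrite set_itv_ge ?indic0// bnd_simp -leNgt.
have [th [K [sth th0 th1 th01 _]]] := @smooth_step_exists R.
pose F (n : nat) r := th (n%:R * r + (- n%:R * c)) * th (- n.+1%:R * r + (1 + n.+1%:R * d)).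
have F01 n r : 0 <= F n r <= 1.
  have /andP[p0 p1] := th01 (n%:R * r + (- n%:R * c)).
  have /andP[q0 q1] := th01 (- n.+1%:R * r + (1 + n.+1%:R * d)).
  by rewrite mulr_ge0// mulr_ile1.
have Fin n r : F n r != 0 -> c < r <= d + 1.
  rewrite mulf_eq0 negb_or => /andP[h1 h2]; apply/andP; split.
    rewrite ltNge; apply: contra_neqN h1 => rc; apply: th0.
    by rewrite mulNr -mulrBr mulr_ge0_le0// subr_le0.
  rewrite leNgt; apply: contra_neqN h2 => dr; apply: th0.
  rewrite mulNr addrC -addrA -mulrBr -lerBrDl sub0r.
  rewrite -subr_ge0 -opprD oppr_ge0 -lerBrDr sub0r.
  have : (1 : R) <= n.+1%:R by rewrite ler1n.
  move: (n.+1%:R) => k k1; nra.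
have Ft n : rtest (F n).
  split; first by apply: smoothM; exact: smooth_affine.
  by exists c, (d + 1); split => // r /Fin/andP[/ltW -> ->].
apply: (@dens_cv F) => [|n|n|]; [exact: rL2_indic|exact: rtest_rL2|exact: dens_rtest|].
apply: (@cv_dominated_fun _ _ _ (\1_(`]c, (d + 1)]%classic))).
- by move=> n; case: (rtest_rL2 (Ft n)).
- by case: (rL2_indic c d).
- exact: rL2_indic.
- move=> n r _; have /andP[f0 f1] := F01 n r.
  rewrite (_ : F n r = F n r * \1_(`]c, (d + 1)]%classic) r); last first.
    have [->|/Fin h] := eqVneq (F n r) 0; first by rewrite mul0r.
    by rewrite indicE mem_set ?mulr1//= in_itv.
  rewrite (_ : \1_(`]c, d]%classic) r = \1_(`]c, d]%classic) r * \1_(`]c, (d + 1)]%classic) r); last first.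
    rewrite !indicE; have [|_] := boolP (_ \in `]c, d]%classic); last by rewrite mul0r.
    rewrite inE /= in_itv /= => /andP[cr rd].
    by rewrite mem_set ?mulr1//= in_itv/= cr (le_trans rd)// lerDl.
  rewrite -mulrBl normrM [X in _ * X]ger0_norm; last by rewrite indicE ler0n.
  rewrite ler_piMl ?indicE ?ler0n// ler_norml.
  by case: (_ \in _) => /=; apply/andP; split; lra.
- move=> r r0; rewrite indicE; have [|] := boolP (_ \in _).
    rewrite inE /= in_itv /= => /andP[cr rd].
    apply: (@cvg_trans _ ((fun n => 1%:R : R) @ \oo)); last exact: cvg_cst.
    apply: near_eq_cvg; near=> n; rewrite /F th1 ?th1 ?mulr1//.
      rewrite mulNr addrC -addrA lerDl -mulrBr mulr_ge0// subr_ge0//.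
    rewrite mulNr -mulrBr -ler_pdivrMr ?subr_gt0//.
    near: n; exact: nbhs_infty_ger.
  rewrite notin_setE /= in_itv /= => /negP; rewrite negb_and -!ltNge -leNgt => h.
  apply: (@cvg_trans _ ((fun n => 0 : R) @ \oo)); last exact: cvg_cst.
  apply: near_eq_cvg; near=> n.
  rewrite /F; case/orP: h => [rc|dr].
    rewrite th0 ?mul0r// mulNr -mulrBr mulr_ge0_le0// subr_le0//.
  rewrite mulrC th0 ?mul0r//.
  rewrite mulNr addrC -addrA -mulrBr -lerBrDl sub0r -opprB mulrN lerN2.
  rewrite -ler_pdivrMr ?subr_gt0//.
  have : 1 / (r - d) <= n%:R by near: n; exact: nbhs_infty_ger.
  by move=> /le_trans; apply; rewrite ler_nat.
Unshelve. all: by end_near. Qed.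

Lemma rL2_indic_le (A : set R) (h : R -> R) : measurable A -> rL2 h ->
  (forall r, A r -> 1 <= h r) -> rL2 (\1_A : R -> R).
Proof.
move=> mA h2 Ah; apply: (rL2_le _ h2).
  by apply: measurable_funTS; exact: measurable_indic.
move=> r _; rewrite indicE; have [|_] := boolP (r \in A); last by rewrite normr0.
by rewrite inE => /Ah hr; rewrite normr1 (le_trans hr)// ler_norm.
Qed.

Lemma rL2_indicI (A : set R) a b : measurable A ->
  rL2 (\1_(A `&` `]a, b]%classic) : R -> R).
Proof.
move=> mA; apply: (rL2_indic_le _ (rL2_indic a b)); first exact: measurableI.
by move=> r [_ rab]; rewrite indicE mem_set.
Qed.

(** The Borel sets whose trace on [`]a, b]] is approximable form a Dynkin system
    that contains the half-open intervals: complements correspond to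
    differences, and disjoint unions to dominated limits of finite sums. *)
Lemma dens_indic (A : set R) a b : 0 < a -> measurable A ->
  approximable (\1_(A `&` `]a, b]%classic) : R -> R).
Proof.
move=> a0; set I := `]a, b]%classic.
have mI : measurable I by exact: measurable_itv.
have GI : setI_closed (@ocitv R) by exact: ocitvI.
suff : forall S, <<s (@ocitv R) >> S -> approximable (\1_(S `&` I) : R -> R) by exact.
apply: (@dynkin_induction _ (measurableTypeR R) (@ocitv R)
  (fun S => approximable (\1_(S `&` I) : R -> R)) erefl GI).
- by rewrite setTI; exact: dens_itv.
- move=> _ [[c d] _ <-] /=.
  rewrite (_ : _ `&` _ = `](Num.max c a), (Num.min d b)]%classic).
    by apply: dens_itv; rewrite lt_max a0 orbT.
  apply/seteqP; split => r; rewrite /I /= !in_itv /= gt_max le_min.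
    by move=> [/andP[-> ->] /andP[-> ->]].
  by move=> /andP[/andP[-> ->] /andP[-> ->]].
- move=> S mS Sd.
  apply: (@eq_dens (fun r => \1_I r + -1 * \1_(S `&` I) r)).
    move=> r; rewrite !indicE !in_setI in_setC.
    by case: (r \in S); case: (r \in I); rewrite /= ?mulr0 ?addr0 ?mulr1 ?subrr.
  apply: densD; [exact: rL2_indic|exact/rL2Z/rL2_indicI|exact: dens_itv|].
  by apply: densZ => //; exact: rL2_indicI.
- move=> F mF tF Fd.
  pose G (n : nat) (r : R) : R := \sum_(k < n) \1_(F k `&` I) r.
  have FI n : rL2 (\1_(F n `&` I) : R -> R) := rL2_indicI a b (mF n).
  have G2 n : rL2 (G n).
    elim: n => [|n ih].
      by apply: eq_rL2 (@rL20 R) => r _; rewrite /G big_ord0.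
    apply: (@eq_rL2 _ (fun r => G n r + \1_(F n `&` I) r)).
      by move=> r _; rewrite /G big_ord_recr.
    exact: rL2D ih (FI n).
  have Gd n : approximable (G n).
    elim: n => [|n ih].
      by apply: eq_dens (dens_rtest rtest0) => r; rewrite /G big_ord0.
    apply: (@eq_dens (fun r => G n r + \1_(F n `&` I) r)).
      by move=> r; rewrite /G big_ord_recr.
    exact: densD (G2 n) (FI n) ih (Fd n).
  have mU : measurable (\bigcup_k F k) by exact: bigcupT_measurable.
  have Gin k n r : F k r -> I r -> G n r = (k < n)%:R.
    move=> Fk Ir; rewrite /G; have [kn|nk] := ltnP k n.
      rewrite (bigD1 (Ordinal kn))//= big1 ?addr0.
        by rewrite indicE mem_set.
      move=> i ik; rewrite indicE memNset// => -[Fi _].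
      have : (F i `&` F k) r by split.
      rewrite (trivIsetP.1 tF)//.
    rewrite big1// => i _; rewrite indicE memNset// => -[Fi _].
    have : (F i `&` F k) r by split.
    rewrite (trivIsetP.1 tF)//.
    by apply: contraTneq (ltn_ord i) => ->; rewrite -leqNgt.
  have Gout n r : ~ (\bigcup_k F k `&` I) r -> G n r = 0.
    move=> nUI; rewrite /G big1// => i _; rewrite indicE memNset// => -[Fi Ir].
    by apply: nUI; split => //; exists i.
  apply: (@dens_cv G) => //; first exact: rL2_indicI.
  apply: (@cv_dominated_fun _ _ _ (\1_I)).
  + by move=> n; case: (G2 n).
  + by case: (rL2_indicI a b mU).
  + exact: rL2_indic.
  + move=> n r _; rewrite [X in `|_ - X|]indicE.
    have [|/negP] := boolP (r \in _); rewrite inE => UI.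
      have [[k _ Fk] Ir] := UI.
      rewrite (Gin k n r Fk Ir) indicE mem_set//.
      by case: (k < n)%N; rewrite /= ?subrr ?normr0 ?ler01// sub0r normrN1.
    by rewrite Gout// subrr normr0 indicE ler0n.
  + move=> r _; rewrite [X in _ --> X]indicE.
    have [|/negP] := boolP (r \in _); rewrite inE => UI.
      have [[k _ Fk] Ir] := UI.
      apply: (@cvg_trans _ ((fun=> 1%:R : R) @ \oo)); last exact: cvg_cst.
      apply: near_eq_cvg; near=> n; rewrite (Gin k n r Fk Ir).
      suff -> : (k < n)%N by [].
      by near: n; exists k.+1.
    rewrite (_ : G ^~ r = fun=> 0); first exact: cvg_cst.
    by apply/funext => n; rewrite Gout.
Unshelve. all: by end_near. Qed.

Lemma rL2_restrict f (A : set R) : measurable A -> rL2 f ->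
  rL2 (fun r => \1_A r * f r).
Proof.
move=> mA f2; apply: (@rL2_bounded _ 1 _ _ _ _ f2).
  by apply: measurable_funTS; exact: measurable_indic.
by move=> r _; rewrite indicE ger0_norm ?ler0n//; case: (_ \in _).
Qed.

(** Simple functions increase to [f]; cutting them off to [`]1 / n, n]] keeps
    the support away from 0 and infinity, and [f] dominates. *)
Lemma dens_ge0 f : rL2 f -> (forall r : R, 0 < r -> 0 <= f r) -> approximable f.
Proof.
move=> f2 f0; have [mf _] := f2.
pose g n := @nnsfun_approx _ R R H measurable_half_line _ ((measurable_EFinP _ _).2 mf) n.
have gf n (r : R) : 0 < r -> 0 <= g n r <= f r.
  move=> r0; apply/andP; split; first exact: fun_ge0.
  rewrite -lee_fin /g nnsfun_approxE; apply: le_approx => [x|].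
    by rewrite half_lineP lee_fin; exact: f0.
  by rewrite half_lineP.
have glim (r : R) : 0 < r -> g ^~ r @ \oo --> f r.
  move=> r0.
  rewrite (_ : g ^~ r = fun n => approx H (EFin \o f) n r); last first.
    by apply/funext => n; rewrite /g nnsfun_approxE.
  apply: (@cvg_approx _ _ R H (EFin \o f) r) => [x||].
  - by rewrite half_lineP lee_fin; exact: f0.
  - by rewrite half_lineP.
  - exact: ltry.
pose I n := `](n.+1%:R^-1), n.+1%:R]%classic : set R.
have I0 n : 0 < n.+1%:R^-1 :> R by rewrite invr_gt0 ltr0n.
have mI n : measurable (I n) by exact: measurable_itv.
have mg n : measurable_fun H (fun r => \1_(I n) r * g n r).
  apply: measurable_funM; first by apply: measurable_funTS; exact: measurable_indic.
  by apply: measurable_funTS; exact: measurable_funP.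
have gI2 n : rL2 (fun r => \1_(I n) r * g n r).
  apply: rL2_le f2 _ => // r r0; have /andP[g0 gfr] := gf n r r0.
  rewrite normrM !ger0_norm ?indicE ?ler0n ?f0//.
  by case: (_ \in _); rewrite ?mul1r ?mul0r ?f0.
apply: (@dens_cv (fun n r => \1_(I n) r * g n r)) => //.
- move=> n.
  have [s gs] : exists s : seq R, forall r, g n r = \sum_(y <- s) y * \1_(g n @^-1` [set y]) r.
    exists (finmap.enum_fset (fset_set (range (g n)))) => r.
    by rewrite (fimfunE (g n) r) fsbig_finite.
  have mP y : measurable (g n @^-1` [set y]) by exact: measurable_sfunP.
  pose S (t : seq R) r : R := \sum_(y <- t) y * \1_(g n @^-1` [set y] `&` I n) r.
  apply: (@eq_dens (S s)).
    move=> r; rewrite gs mulr_sumr; apply: eq_bigr => y _.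
    by rewrite indicI /=; ring.
  suff : rL2 (S s) /\ approximable (S s) by case.
  elim: s {gs} => [|y t [ih2 ihd]].
    split; first by apply: eq_rL2 (@rL20 R) => r _; rewrite /S big_nil.
    by apply: eq_dens (dens_rtest rtest0) => r; rewrite /S big_nil.
  have i2 := rL2_indicI n.+1%:R^-1 n.+1%:R (mP y).
  have t2 := rL2Z y i2.
  have Scons r : y * \1_(g n @^-1` [set y] `&` I n) r + S t r = S (y :: t) r.
    by rewrite /S big_cons.
  split; first by apply: eq_rL2 (rL2D t2 ih2) => r _; exact: Scons.
  apply: eq_dens Scons _; apply: densD => //; apply: densZ => //.
  exact: dens_indic.
apply: (cv_dominated_fun mg mf f2) => [n r r0|r r0].
  have /andP[g0 gfr] := gf n r r0; rewrite indicE ler_norml.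
  by case: (_ \in _); rewrite ?mul1r ?mul0r; apply/andP; split; lra.
rewrite -[X in _ --> X]mul1r; apply: cvgM (glim r r0).
apply: (@cvg_trans _ ((fun=> 1%:R : R) @ \oo)); last exact: cvg_cst.
apply: near_eq_cvg; near=> n; rewrite indicE mem_set// /I /= in_itv /=; apply/andP; split.
  rewrite invf_plt ?posrE ?ltr0n//.
  rewrite (@lt_le_trans _ _ n%:R) ?ler_nat//; near: n; exact: nbhs_infty_gtr.
rewrite (@le_trans _ _ n%:R) ?ler_nat//; near: n; exact: nbhs_infty_ger.
Unshelve. all: by end_near. Qed.

Lemma dens_rL2 f : rL2 f -> approximable f.
Proof.
move=> f2; have [mf _] := f2.
have p2 : rL2 (fun r => Num.max (f r) 0).
  apply: rL2_le f2 _ => [|r _]; first exact: measurable_maxr.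
  rewrite ger0_norm ?le_max ?lexx ?orbT// ge_max normr_ge0 andbT ler_norm//.
have n2 : rL2 (fun r => Num.max (- f r) 0).
  apply: rL2_le f2 _ => [|r _]; first by apply: measurable_maxr => //; exact: measurableT_comp.
  by rewrite ger0_norm ?le_max ?lexx ?orbT// ge_max normr_ge0 andbT -normrN ler_norm.
apply: (@eq_dens (fun r => Num.max (f r) 0 + -1 * Num.max (- f r) 0)).
  move=> r; rewrite mulN1r; case: (leP (f r) 0) => fr.
    by rewrite max_l ?oppr_ge0// add0r opprK.
  by rewrite max_r ?subr0// oppr_le0 ltW.
apply: densD => //; first exact: rL2Z.
- by apply: dens_ge0 => // r _; rewrite le_max lexx orbT.
- by apply: densZ => //; apply: dens_ge0 => // r _; rewrite le_max lexx orbT.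
Qed.

End TestFunctions.

(** * Weak derivatives *)

Section WeakDerivative.
Context {R : realType}.
Notation mu := (@lebesgue_measure R).
Implicit Types (f g u v phi zeta : R -> R) (a b c d x : R).

(** Square integrability on compact subsets of the open half-line, the class
    to which the Coulomb terms [c / r * f] of an L2 function belong. *)
Definition locL2 f : Prop :=
  forall zeta, continuous zeta -> compact_supp zeta -> rL2 (fun r => zeta r * f r).

Definition weak_deriv u v : Prop :=
  forall phi, rtest phi -> rint (fun r => u r * derive1 phi r) = - rint (fun r => v r * phi r).

Lemma supp_in_le f a b c d : c <= a -> b <= d -> supp_in f a b -> supp_in f c d.
Proof. by move=> ca bd fab x /fab/andP[ax xb]; rewrite (le_trans ca) ?(le_trans xb). Qed.

Lemma locL2_rL2 f : rL2 f -> locL2 f.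
Proof.
move=> f2 z cz [a [b [_ zab]]]; have [M _ zM] := continuous_bounded cz zab.
apply: rL2_bounded f2 => [|r _]; last exact: zM.
exact: continuous_measurable_half.
Qed.

Lemma eq_locL2 f g : (forall r : R, 0 < r -> f r = g r) -> locL2 f -> locL2 g.
Proof.
by move=> fg fl z cz sz; apply: eq_rL2 (fl z cz sz) => r r0; rewrite fg.
Qed.

Lemma locL2D f g : locL2 f -> locL2 g -> locL2 (fun r => f r + g r).
Proof.
move=> fl gl z cz sz; apply: eq_rL2 (rL2D (fl z cz sz) (gl z cz sz)) => r _.
by rewrite mulrDr.
Qed.

Lemma locL2Z c f : locL2 f -> locL2 (fun r => c * f r).
Proof.
move=> fl z cz sz; apply: eq_rL2 (rL2Z c (fl z cz sz)) => r _; by rewrite mulrCA.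
Qed.

Lemma continuous_supp_mul f zeta : (forall x, 0 < x -> {for x, continuous f}) ->
  continuous zeta -> compact_supp zeta -> continuous (fun r => f r * zeta r).
Proof.
move=> cf cz [a [b [a0 zab]]] x; have [xa|ax] := ltP x a.
  apply: (@isd_continuous _ x _ 0); apply: (@isd_near _ _ (fun=> 0)); last exact: isd_cst.
  near=> y; rewrite (supp_out zab) ?mulr0//; apply/orP; left.
  near: y; exact: near_lt.
by apply: cvgM; [exact: cf (lt_le_trans a0 ax)|exact: cz].
Unshelve. all: by end_near. Qed.

Lemma continuous_inv_pos x : 0 < x -> {for x, continuous (fun y : R => y^-1)}.
Proof. by move=> x0; apply: inv_continuous; rewrite gt_eqF. Qed.

Lemma locL2_div c f : locL2 f -> locL2 (fun r => c / r * f r).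
Proof.
move=> fl z cz sz.
have cz' : continuous (fun r : R => c / r * z r : R).
  apply: continuous_supp_mul => // x x0; apply: cvgM; first exact: cvg_cst.
  exact: continuous_inv_pos.
have := fl _ cz' (compact_suppM (fun r => c / r) sz).
by apply: eq_rL2 => r _; ring.
Qed.

Lemma supp_window f a b : 0 < a -> supp_in f a b -> exists zeta,
  [/\ rtest zeta, forall r, zeta r * f r = f r & forall r, derive1 zeta r * f r = 0].
Proof.
move=> a0 fab; have [z [zt zs z01 z1 z'0]] := @window_exists _ a b a0.
exists z; split=> // r; have [->|fr] := eqVneq (f r) 0; rewrite ?mulr0//.
  by rewrite z1 ?mul1r//; exact: fab.
by rewrite z'0 ?mul0r//; exact: fab.
Qed.

Lemma locL2_integ f g : locL2 f -> continuous g -> compact_supp g ->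
  integ (fun r => f r * g r).
Proof.
move=> fl cg sg; have [a [b [a0 gab]]] := sg.
have [z [zt zg _]] := supp_window a0 gab.
have z2 := fl z (C1c_continuous (rtest_C1c zt)) (zt.2).
apply: eq_integ (rL2_mul z2 (rL2_continuous_supp cg sg)) => r _.
by rewrite (mulrC (z r)) -mulrA zg.
Qed.

Lemma locL2_integC f phi : locL2 f -> C1c phi -> integ (fun r => f r * phi r).
Proof.
move=> fl p; apply: locL2_integ => //; first exact: C1c_continuous.
by case: p.
Qed.

Lemma locL2_integC' f phi : locL2 f -> C1c phi -> integ (fun r => f r * derive1 phi r).
Proof.
move=> fl p; apply: locL2_integ => //; first by case: p.
by apply: compact_supp_derive; case: p.
Qed.

Lemma eq_wd u v u' v' : (forall r : R, 0 < r -> u r = u' r) ->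
  (forall r : R, 0 < r -> v r = v' r) -> weak_deriv u v -> weak_deriv u' v'.
Proof.
move=> uu vv w phi pt.
rewrite -(@eq_rint _ (fun r => u r * derive1 phi r)); last by move=> r /uu ->.
by rewrite w// (@eq_rint _ _ (fun r => v' r * phi r))// => r /vv ->.
Qed.

Lemma wdD u v u' v' : locL2 u -> locL2 v -> locL2 u' -> locL2 v' ->
  weak_deriv u v -> weak_deriv u' v' -> weak_deriv (fun r => u r + u' r) (fun r => v r + v' r).
Proof.
move=> ul vl ul' vl' w w' phi pt; have pc := rtest_C1c pt.
rewrite (@eq_rint _ _ (fun r => u r * derive1 phi r + u' r * derive1 phi r)); last first.
  by move=> r _; rewrite mulrDl.
rewrite rintD; [|exact: locL2_integC'|exact: locL2_integC'].
rewrite w// w'// -opprD; congr (- _); rewrite -rintD; [|exact: locL2_integC|exact: locL2_integC].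
by apply: eq_rint => r _; rewrite mulrDl.
Qed.

Lemma wdZ c u v : locL2 u -> locL2 v -> weak_deriv u v -> weak_deriv (fun r => c * u r) (fun r => c * v r).
Proof.
move=> ul vl w phi pt; have pc := rtest_C1c pt.
rewrite (@eq_rint _ _ (fun r => c * (u r * derive1 phi r))); last first.
  by move=> r _; rewrite mulrA.
rewrite rintZ; last exact: locL2_integC'.
rewrite w// mulrN -rintZ; last exact: locL2_integC.
by congr (- _); apply: eq_rint => r _; rewrite mulrA.
Qed.

Lemma wd_C1c phi : C1c phi -> weak_deriv phi (derive1 phi).
Proof. by move=> pc psi pt; apply: rint_by_parts => //; exact: rtest_C1c. Qed.

Lemma wd_window zeta u v : rtest zeta -> locL2 u -> locL2 v -> weak_deriv u v ->
  weak_deriv (fun r => zeta r * u r) (fun r => derive1 zeta r * u r + zeta r * v r).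
Proof.
move=> zt ul vl w phi pt.
have zc := rtest_C1c zt; have pc := rtest_C1c pt.
have zpt : rtest (fun r => zeta r * phi r) by apply: rtestM => //; case: zt.
have zpt' : rtest (fun r => derive1 zeta r * phi r).
  by apply: rtestM => //; apply: smooth_derive; case: zt.
have := w _ zpt.
rewrite (@eq_rint _ (fun r => u r * derive1 (fun r => zeta r * phi r) r)
  (fun r => u r * (derive1 zeta r * phi r) + (zeta r * u r) * derive1 phi r)); last first.
  by move=> r _; rewrite derive1_mulC1c//; ring.
have i1 : integ (fun r => u r * (derive1 zeta r * phi r)).
  exact: locL2_integC (rtest_C1c zpt').
rewrite rintD//; last first.
  apply: (@eq_integ _ (fun r => u r * (zeta r * derive1 phi r))) => [r _|]; first by ring.
  apply: locL2_integC => //; apply: rtest_C1c; apply: rtestM; first by case: zt.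
  exact: rtest_derive.
move=> /(canRL (addKr _)) ->; rewrite -opprD; congr (- _).
rewrite -rintD//; last exact: locL2_integC (rtest_C1c zpt).
by apply: eq_rint => r _; ring.
Qed.

(** * Approximation of weak derivatives *)

Lemma rint_primitive h G a b : 0 < a -> a <= b -> continuous h ->
  (forall x, isd x G (h x)) ->
  rint (fun r => \1_(`[a, b]%classic) r * h r) = G b - G a.
Proof.
move=> a0 ab ch dG.
rewrite (@rint_supp _ _ a b a0); last first.
  move=> x; rewrite indicE; have [|_] := boolP (x \in _); last by rewrite mul0r eqxx.
  by rewrite inE /= in_itv.
move: ab; rewrite le_eqVlt => /predU1P[<-|ab].
  by rewrite set_itv1 Rintegral_set1 subrr.
rewrite (@eq_Rintegral _ _ _ mu _ h); last first.
  by move=> x xab; rewrite indicE xab mul1r.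
rewrite /Rintegral (@continuous_FTC2 R h G _ _ ab)//.
- exact: continuous_subspaceT.
- have cG := isd_continuousT dG.
  split => [x _||]; first exact: isd_derivable (dG x).
  + by apply: cvg_at_right_filter; exact: cG.
  + by apply: cvg_at_left_filter; exact: cG.
- by move=> x _; rewrite (derive1_ext dG).
Qed.

Lemma rint_primitive_supp h G a b : 0 < a -> a <= b -> continuous h -> supp_in h a b ->
  (forall x, isd x G (h x)) -> rint h = G b - G a.
Proof.
move=> a0 ab ch hab dG; rewrite -(rint_primitive a0 ab ch dG).
apply: eq_rint => r _; rewrite indicE.
have [->|/hab rab] := eqVneq (h r) 0; first by rewrite mulr0.
by rewrite mem_set ?mul1r//= in_itv.
Qed.

(** The Cauchy-Schwarz inequality on [[a, x]]; as [h] vanishes beyond [b], only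
    the part of this interval below [b] counts, whence a constant independent of
    [x]. *)
Lemma primitive_bound a b : 0 < a -> exists2 C : R, 0 <= C &
  forall h G, continuous h -> supp_in h a b -> (forall x, isd x G (h x)) ->
  G a = 0 -> forall x, a <= x -> G x ^+ 2 <= C * sqnrm h.
Proof.
move=> a0; pose I := `](a / 2), b]%classic : set R.
have a2 : a / 2 < a by lra.
exists (sqnrm (\1_I : R -> R)); first exact: nrm_ge0.
move=> h G ch hab dG Ga x ax.
rewrite -(subr0 (G x)) -Ga -(rint_primitive a0 ax ch dG).
pose J := `[a, x]%classic : set R.
rewrite (@eq_rint _ _ (fun r => \1_(J `&` I) r * h r)); last first.
  move=> r _; rewrite indicI /= -mulrA; congr (_ * _).
  have [->|/hab/andP[ar rb]] := eqVneq (h r) 0; first by rewrite mulr0.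
  by rewrite indicE mem_set ?mul1r// /I /= in_itv /= rb andbT (lt_le_trans a2).
have h2 : rL2 h by apply: rL2_continuous_supp => //; exists a, b.
have JI2 : rL2 (\1_(J `&` I) : R -> R) by apply: rL2_indicI; exact: measurable_itv.
apply: le_trans (cauchy_schwarz JI2 h2) _; apply: ler_wpM2r; first exact: nrm_ge0.
apply: nrm_le => //; first exact: rL2_indic.
move=> r _; rewrite indicI /= normrM [leLHS]mulrC ler_piMr//.
by rewrite indicE; case: (_ \in _); rewrite ?normr1 ?normr0.
Qed.

Lemma dens_seq f : rL2 f -> exists2 F : nat -> R -> R, (forall n, rtest (F n)) & cvL2 F f.
Proof.
move=> f2.
have /choice[F h] : forall n, exists phi, rtest phi /\ sqnrm (fun r => phi r - f r) <= n.+1%:R^-1.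
  move=> n; have [|phi pt /ltW pn] := dens_rL2 f2 (_ : 0 < n.+1%:R^-1); last by exists phi.
  by rewrite invr_gt0 ltr0n.
exists F => [n|]; first by case: (h n).
by apply: cv_inv => n; case: (h n).
Qed.

(** The proof is by duality.  For a test function [psi], let [G] be a primitive
    of a localisation of [psi]; testing the equation against [G] bounds the
    integral of [u psi] by the norms of [v] and [psi].  Then let [psi] tend to
    [u].  No pointwise representative of [u] enters. *)
Lemma weak_poincare a b : 0 < a -> exists2 C : R, 0 <= C &
  forall u v, rL2 u -> rL2 v -> supp_in u a b -> weak_deriv u v -> sqnrm u <= C * sqnrm v.
Proof.
move=> a0; have [z [zt zs z01 z1 z'0]] := @window_exists _ a b a0.
have a80 : 0 < a / 8 by rewrite divr_gt0.
have a84 : a / 8 < a / 4 by lra.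
have [C0 C00 HC] := primitive_bound (b + 2) a80.
have z2 := rtest_rL2 zt.
exists (C0 * sqnrm z) => [|u v u2 v2 uab w]; first by rewrite mulr_ge0// nrm_ge0.
have dual psi : rtest psi ->
    rint (fun r => u r * psi r) ^+ 2 <= C0 * sqnrm z * sqnrm v * sqnrm psi.
  move=> pt; pose h r := z r * psi r.
  have ht : rtest h by apply: rtestM => //; case: zt.
  have hs : supp_in h (a / 4) (b + 2).
    by move=> x; rewrite mulf_eq0 negb_or => /andP[/zs].
  have hs8 := supp_in_le (ltW a84) (lexx _) hs.
  have ch := C1c_continuous (rtest_C1c ht).
  have h0 x : x <= a / 8 -> h x = 0.
    by move=> xa; rewrite (supp_out hs)// (le_lt_trans xa).
  have [G dG G0] := primitive_continuous ch h0.
  have sG := smooth_primitive ht.1 dG.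
  have zGt : rtest (fun r => z r * G r).
    have := rtestM sG zt.
    by rewrite (_ : (fun x => G x * z x) = (fun r => z r * G r))//; apply/funext => r; rewrite mulrC.
  have -> : rint (fun r => u r * psi r) = - rint (fun r => v r * (z r * G r)).
    rewrite -(w _ zGt); apply: eq_rint => r _.
    rewrite (isd_derive1 (isdM (smooth_isd r zt.1) (dG r))).
    have [->|/uab rab] := eqVneq (u r) 0; first by rewrite !mul0r.
    by rewrite /h z1// z'0// !mul1r mul0r add0r.
  have zG2 := rtest_rL2 zGt.
  rewrite sqrrN; apply: le_trans (cauchy_schwarz v2 zG2) _.
  rewrite -[leRHS]mulrAC mulrC; apply: ler_wpM2r; first exact: nrm_ge0.
  have h2 := rtest_rL2 ht.
  apply: (@le_trans _ _ (C0 * sqnrm h * sqnrm z)).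
    rewrite -[leRHS]rintZ; last by case: z2.
    apply: rint_le; [by case: zG2|by apply: integZ; case: z2|move=> r _].
    rewrite exprMn mulrC; apply: ler_wpM2r; first exact: sqr_ge0.
    have [ra|ar] := ltP r (a / 8).
      by rewrite (G0 r (ltW ra)) expr0n mulr_ge0// nrm_ge0.
    exact: (HC h G ch hs8 dG (G0 _ (lexx _)) r ar).
  rewrite mulrAC; apply: ler_wpM2l; first by rewrite mulr_ge0// nrm_ge0.
  apply: nrm_le => //; first exact: rtest_rL2.
  move=> r _; rewrite normrM ler_piMl//; have /andP[p q] := z01 r.
  by rewrite ger0_norm.
have [psi pt pcv] := dens_seq u2.
have psi2 n := rtest_rL2 (pt n).
(* In the limit [psi n --> u], [dual] reads
   [sqnrm u ^+ 2 <= C0 * sqnrm z * sqnrm v * sqnrm u]. *)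
have lim1 : rint (fun r => u r * psi n r) ^+ 2 @[n --> \oo] --> sqnrm u ^+ 2.
  have l := cv_rint (fun=> u2) psi2 u2 u2 (cv_cst u) pcv.
  by apply: cvgM; exact: l.
have lim2 : C0 * sqnrm z * sqnrm v * sqnrm (psi n) @[n --> \oo] --> C0 * sqnrm z * sqnrm v * sqnrm u.
  apply: cvgM; first exact: cvg_cst.
  exact: (cv_rint psi2 psi2 u2 u2 pcv pcv).
have le2 : sqnrm u ^+ 2 <= C0 * sqnrm z * sqnrm v * sqnrm u.
  apply: (ler_cvg_to lim1 lim2); apply: nearW => n; exact: dual.
have [->|u0] := eqVneq (sqnrm u) 0; first by rewrite !mulr_ge0// nrm_ge0.
have up : 0 < sqnrm u by rewrite lt_neqAle eq_sym u0 nrm_ge0.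
by move: le2; rewrite expr2 ler_pM2r.
Qed.

(** The vanishing of the integral is what makes the primitive that starts at 0
    vanish beyond the support as well. *)
Lemma rtest_primitive h a b : 0 < a -> a <= b -> rtest h -> supp_in h a b -> rint h = 0 ->
  exists G, [/\ rtest G, supp_in G (a / 2) b & forall x, isd x G (h x)].
Proof.
move=> a0 ab ht hs h0; have ch := C1c_continuous (rtest_C1c ht).
have a2 : a / 2 < a by lra.
have a20 : 0 < a / 2 by rewrite divr_gt0.
have [G dG G0] : exists2 G, forall x, isd x G (h x) & forall x, x <= a / 2 -> G x = 0.
  apply: primitive_continuous => // x xa.
  by rewrite (supp_out hs)// (le_lt_trans xa).
have Gb x : b <= x -> G x = 0.
  move=> bx; have hs' := supp_in_le (ltW a2) bx hs.
  have := rint_primitive_supp a20 (ltW (lt_le_trans a2 (le_trans ab bx))) ch hs' dG.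
  by rewrite h0 (G0 (a / 2))// subr0.
have sG : supp_in G (a / 2) b.
  move=> x; apply: contraNT; rewrite negb_and -!ltNge => /orP[/ltW/G0->|/ltW/Gb->] //.
exists G; split => //; split; first exact: (smooth_primitive ht.1 dG).
by exists (a / 2), b.
Qed.

(** Multiples of this function correct the integral of a test function to 0, as
    [rtest_primitive] requires. *)
Lemma unit_mass a : 0 < a -> exists rho,
  [/\ rtest rho, supp_in rho a (a + 1) & rint rho = 1].
Proof.
move=> a0; have [th [K [sth th0 th1 th01 _]]] := @smooth_step_exists R.
pose G x := th (1 * x + (- a)).
have sG : smooth G by exact: smooth_affine.
have dG x := smooth_isd x sG.
have ss : supp_in (derive1 G) a (a + 1).
  move=> x; apply: contraNT; rewrite negb_and -!ltNge => xa; apply/eqP/isd_derive1.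
  case/orP: xa => [xa|ax].
  - apply: (@isd_near _ _ (fun=> 0)); last exact: isd_cst.
    near=> y; rewrite /G th0// mul1r subr_le0; apply: ltW; near: y; exact: near_lt.
  - apply: (@isd_near _ _ (fun=> 1)); last exact: isd_cst.
    near=> y; rewrite /G th1// mul1r lerBrDr addrC; apply: ltW; near: y; exact: near_gt.
have st : rtest (derive1 G).
  by split; [exact: smooth_derive|exists a, (a + 1)].
exists (derive1 G); split => //.
rewrite (rint_primitive_supp a0 _ (C1c_continuous (rtest_C1c st)) ss dG) ?lerDl//.
by rewrite /G th1 ?th0 ?subr0//; lra.
Unshelve. all: by end_near. Qed.

Lemma cv_rint_supp (F : nat -> R -> R) f zeta : (forall n, rL2 (F n)) -> rL2 f -> rL2 zeta ->
  cvL2 F f -> rint (fun r => F n r * zeta r) @[n --> \oo] --> rint (fun r => f r * zeta r).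
Proof. by move=> F2 f2 z2 Ff; apply: cv_rint => //; exact: cv_cst. Qed.

Lemma cv_scale (c : nat -> R) f : rL2 f -> c @ \oo --> (0 : R) ->
  cvL2 (fun n r => c n * f r) (fun=> 0).
Proof.
move=> f2 c0; rewrite /cvL2 (_ : (fun n => _) = (fun n => c n ^+ 2 * sqnrm f)).
  rewrite (_ : 0 = 0 ^+ 2 * sqnrm f); last by rewrite expr0n mul0r.
  by apply: cvgM; [apply: cvgM|exact: cvg_cst].
by apply/funext => n; rewrite -nrmZ//; apply: eq_nrm => r _; rewrite subr0.
Qed.

(** A Meyers-Serrin theorem.  Approximate [v] by test functions, correct them
    to have integral 0 (the integral of [v] is 0, by testing against a function
    equal to 1 on the supports), and take primitives: these converge to [u] by
    the Poincare inequality. *)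
Lemma wd_approx u v a b : 0 < a -> a <= b -> rL2 u -> rL2 v ->
  supp_in u a b -> supp_in v a b -> weak_deriv u v ->
  exists U : nat -> R -> R,
    [/\ forall n, rtest (U n), exists2 c, 0 < c & exists d, forall n, supp_in (U n) c d,
        cvL2 U u & cvL2 (fun n => derive1 (U n)) v].
Proof.
move=> a0 ab u2 v2 us vs w.
have [z [zt zs z01 z1 z'0]] := @window_exists _ a b a0.
have z2 := rtest_rL2 zt.
pose a1 := a / 4; pose b1 := b + 2.
have a10 : 0 < a1 by rewrite divr_gt0.
have aa1 : a1 <= a by rewrite /a1; lra.
have bb1 : b <= b1 by rewrite /b1; lra.
have [y [yt ys y01 y1 y'0]] := @window_exists _ a1 b1 a10.
have y2 := rtest_rL2 yt.
have [g0 gt0 gcv] := dens_seq v2.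
pose g n r := z r * g0 n r.
have gt n : rtest (g n) by apply: rtestM => //; case: zt.
have gs n : supp_in (g n) a1 b1.
  by move=> x; rewrite mulf_eq0 negb_or => /andP[/zs].
have g2 n := rtest_rL2 (gt n).
have gcv' : cvL2 g v.
  apply: (@eq_cv _ g _ (fun r => z r * v r)) => //.
    move=> r _; have [->|/vs h] := eqVneq (v r) 0; first by rewrite mulr0.
    by rewrite z1 ?mul1r.
  apply: (@cv_bounded _ 1) => //; first by case: z2.
    by move=> r _; have /andP[p q] := z01 r; rewrite ger0_norm.
  by move=> n; exact: rtest_rL2.
have [rho [rt rs r1]] := unit_mass a10.
have rs1 : supp_in rho a1 b1 by apply: supp_in_le rs => //; rewrite /a1 /b1; lra.
have rho2 := rtest_rL2 rt.
pose c n := rint (g n).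
have c0 : c @ \oo --> (0 : R).
  have l := cv_rint_supp g2 v2 y2 gcv'.
  have e0 : rint (fun r => v r * y r) = 0.
    apply/eqP; rewrite -oppr_eq0 -(w _ yt) -[X in _ == X](@rint0 R); apply/eqP.
    apply: eq_rint => r _; have [->|/us/andP[ar rb]] := eqVneq (u r) 0; first by rewrite mul0r.
    by rewrite y'0 ?mulr0// (le_trans aa1 ar) (le_trans rb bb1).
  rewrite e0 in l; apply: cvg_trans l; apply: near_eq_cvg; apply: nearW => n.
  apply: eq_rint => r _; have [->|/gs h] := eqVneq (g n r) 0; first by rewrite mul0r.
  by rewrite y1 ?mulr1.
pose h n r := g n r - c n * rho r.
have ht n : rtest (h n) by apply: rtestB => //; exact: rtestZ.
have hs n : supp_in (h n) a1 b1.
  move=> x hx; have [e|/gs//] := eqVneq (g n x) 0; apply: rs1.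
  by move: hx; rewrite /h e sub0r oppr_eq0 mulf_eq0 negb_or => /andP[].
have h0 n : rint (h n) = 0.
  have ir : integ rho.
    by apply: eq_integ (rL2_mul rho2 y2) => r _; have [->|/rs1 p] := eqVneq (rho r) 0; rewrite ?mul0r// y1 ?mulr1.
  have ig : integ (g n).
    by apply: eq_integ (rL2_mul (g2 n) y2) => r _; have [->|/gs p] := eqVneq (g n r) 0; rewrite ?mul0r// y1 ?mulr1.
  rewrite rintB//; last exact: integZ.
  by rewrite rintZ// r1 mulr1 subrr.
have h2 n := rtest_rL2 (ht n).
have hcv : cvL2 h v.
  have c0' : (fun n => - c n) @ \oo --> (0 : R) by rewrite -oppr0; exact: cvgN.
  have := cvD2 g2 (fun n => rL2Z (- c n) rho2) v2 (@rL20 R) gcv' (cv_scale rho2 c0').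
  apply: eq_cv => [n r _|r _]; last by rewrite addr0.
  by rewrite mulNr.
have /choice[U HU] : forall n, exists G,
    [/\ rtest G, supp_in G (a1 / 2) b1 & forall x, isd x G (h n x)].
  by move=> n; apply: rtest_primitive => //; rewrite (le_trans aa1)// (le_trans ab).
have a120 : 0 < a1 / 2 by rewrite divr_gt0.
have [C C0 HC] := @weak_poincare (a1 / 2) b1 a120.
exists U; split=> [n|||]; first by case: (HU n).
- by exists (a1 / 2) => //; exists b1 => n; case: (HU n).
- apply: (@cv_le _ _ _ (fun n => C * sqnrm (fun r => h n r - v r))); last first.
    by rewrite -[X in _ --> X](mulr0 C); apply: cvgM => //; exact: cvg_cst.
  apply: nearW => n; have [Ut Us dU] := HU n.
  have U2 := rtest_rL2 Ut.
  apply: HC; [exact: rL2B|exact: rL2B| |].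
    move=> x Ux; have [e|/Us//] := eqVneq (U n x) 0.
    have : u x != 0 by move: Ux; rewrite e sub0r oppr_eq0.
    by move=> /us/andP[ax xb]; rewrite (le_trans _ ax) ?(le_trans xb)//; lra.
  have wU := wd_C1c (rtest_C1c Ut); rewrite (derive1_ext dU) in wU.
  have := wdD (locL2_rL2 U2) (locL2_rL2 (h2 n)) (locL2Z (-1) (locL2_rL2 u2))
    (locL2Z (-1) (locL2_rL2 v2)) wU (wdZ (-1) (locL2_rL2 u2) (locL2_rL2 v2) w).
  by apply: eq_wd => r _; rewrite mulN1r.
- rewrite (_ : (fun n => derive1 (U n)) = h)//.
  by apply/funext => n; apply: derive1_ext; case: (HU n).
Qed.

(** The situation of [wd_approx] is reached by multiplying with a window equal
    to 1 on the support of [phi]; the extra term in the derivative of the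
    product is invisible to [phi]. *)
Lemma locL2_window u v phi : C1c phi -> locL2 u -> locL2 v -> weak_deriv u v ->
  exists U : nat -> R -> R, exists2 zeta, (forall r, zeta r * phi r = phi r) /\
     (forall r, zeta r * derive1 phi r = derive1 phi r) &
    [/\ forall n, rtest (U n), rL2 (fun r => zeta r * u r),
       cvL2 U (fun r => zeta r * u r) & exists2 w, rL2 w /\
         cvL2 (fun n => derive1 (U n)) w & forall r, w r * phi r = v r * phi r ].
Proof.
move=> pc ul vl w; have [_ _ [a [b [a0 pab]]]] := pc.
pose b' := Num.max a b.
have ab' : a <= b' by rewrite le_max lexx.
have bb' : b <= b' by rewrite le_max lexx orbT.
have pab' := supp_in_le (lexx a) bb' pab.
have [z [zt zs z01 z1 z'0]] := @window_exists _ a b' a0.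
have zc := rtest_C1c zt.
have zu2 : rL2 (fun r => z r * u r) by apply: ul; [exact: C1c_continuous|case: zt].
have wz := wd_window zt ul vl w.
set v' := (fun r => derive1 z r * u r + z r * v r) in wz.
have v'2 : rL2 v'.
  apply: rL2D; [apply: ul|apply: vl]; rewrite //; [by case: zc| |exact: C1c_continuous|by case: zt].
  by apply: compact_supp_derive; case: zt.
have a40 : 0 < a / 4 by rewrite divr_gt0.
have ab2 : a / 4 <= b' + 2 by lra.
have us : supp_in (fun r => z r * u r) (a / 4) (b' + 2).
  by move=> x; rewrite mulf_eq0 negb_or => /andP[/zs].
have vs : supp_in v' (a / 4) (b' + 2).
  move=> x; rewrite /v'; have [zx|/zs//] := eqVneq (z x) 0.
  rewrite zx mul0r addr0 mulf_eq0 negb_or => /andP[z'x _].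
  exact: (supp_derive zs).
have [U [Ut _ Ucv Ucv']] := wd_approx a40 ab2 zu2 v'2 us vs wz.
exists U, z; first split.
- by move=> r; have [->|/pab' h] := eqVneq (phi r) 0; rewrite ?mulr0// z1 ?mul1r.
- move=> r; have [->|h] := eqVneq (derive1 phi r) 0; rewrite ?mulr0//.
  by rewrite z1 ?mul1r//; exact: (supp_derive pab').
split=> //; exists v' => // r.
have [->|/pab' h] := eqVneq (phi r) 0; first by rewrite !mulr0.
by rewrite /v' z1// z'0// mul0r add0r mul1r.
Qed.

(** The approximants of [locL2_window] are smooth, and for them this is
    integration by parts. *)
Lemma wd_C1 u v phi : C1c phi -> locL2 u -> locL2 v -> weak_deriv u v ->
  rint (fun r => u r * derive1 phi r) = - rint (fun r => v r * phi r).
Proof.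
move=> pc ul vl w.
have [U [z [zp zp'] [Ut zu2 Ucv [w' [w2 wcv] wp]]]] := locL2_window pc ul vl w.
have U2 n := rtest_rL2 (Ut n); have U'2 n := rtest_rL2 (rtest_derive (Ut n)).
have p2 := C1c_rL2 pc; have p'2 := C1c_derive_rL2 pc.
have l1 := cv_rint_supp U2 zu2 p'2 Ucv.
have l2 : (fun n => - rint (fun r => derive1 (U n) r * phi r)) @ \oo -->
    - rint (fun r => w' r * phi r).
  by apply: cvgN; exact: (cv_rint_supp U'2 w2 p2 wcv).
rewrite (_ : rint (fun r => u r * derive1 phi r) = rint (fun r => z r * u r * derive1 phi r)); last first.
  by apply: eq_rint => r _; rewrite -[in LHS]zp'; ring.
rewrite (_ : rint (fun r => v r * phi r) = rint (fun r => w' r * phi r)); last first.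
  by apply: eq_rint => r _; rewrite wp.
have e : (fun n => rint (fun r => U n r * derive1 phi r)) =
         (fun n => - rint (fun r => derive1 (U n) r * phi r)).
  by apply/funext => n; apply: rint_by_parts => //; exact: rtest_C1c.
rewrite e in l1.
by rewrite -(cvg_lim (@Rhausdorff R) l1) -(cvg_lim (@Rhausdorff R) l2).
Qed.

(** The chain rule [(u ^+ 2)' = 2 u v], obtained as a limit of its smooth
    case. *)
Lemma wd_sqr u v phi : C1c phi -> locL2 u -> locL2 v -> weak_deriv u v ->
  rint (fun r => u r ^+ 2 * derive1 phi r) = - (2 * rint (fun r => u r * v r * phi r)).
Proof.
move=> pc ul vl w.
have [U [z [zp zp'] [Ut zu2 Ucv [w' [w2 wcv] wp]]]] := locL2_window pc ul vl w.
have U2 n := rtest_rL2 (Ut n); have U'2 n := rtest_rL2 (rtest_derive (Ut n)).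
have bphi (f g : R -> R) : continuous f -> compact_supp f -> rL2 g -> rL2 (fun r => f r * g r).
  by move=> cf cs g2; exact: (locL2_rL2 g2).
have bcv (f : R -> R) (G : nat -> R -> R) g : continuous f -> compact_supp f ->
    (forall n, rL2 (G n)) -> rL2 g -> cvL2 G g -> cvL2 (fun n r => f r * G n r) (fun r => f r * g r).
  move=> cf [a [b [_ fab]]] G2 g2; have [M _ fM] := continuous_bounded cf fab.
  by apply: cv_bounded => //; exact: continuous_measurable_half.
have cp := C1c_continuous pc; have [_ cp' sp] := pc.
have sp' := compact_supp_derive sp.
have l1 := cv_rint U2 (fun n => bphi _ _ cp' sp' (U2 n)) zu2 (bphi _ _ cp' sp' zu2) Ucv
  (bcv _ _ _ cp' sp' U2 zu2 Ucv).
have l2 := cv_rint U2 (fun n => bphi _ _ cp sp (U'2 n)) zu2 (bphi _ _ cp sp w2) Ucv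
  (bcv _ _ _ cp sp U'2 w2 wcv).
rewrite (_ : rint (fun r => u r ^+ 2 * derive1 phi r) =
  rint (fun r => z r * u r * (derive1 phi r * (z r * u r)))); last first.
  apply: eq_rint => r _.
  transitivity (u r ^+ 2 * (z r * (z r * derive1 phi r))); [by rewrite !zp'|by ring].
rewrite (_ : rint (fun r => u r * v r * phi r) =
  rint (fun r => z r * u r * (phi r * w' r))); last first.
  apply: eq_rint => r _; rewrite (mulrC (phi r)) wp.
  by rewrite -[in LHS]zp; ring.
have e : (fun n => rint (fun r => U n r * (derive1 phi r * U n r))) =
         (fun n => - (2 * rint (fun r => U n r * (phi r * derive1 (U n) r)))).
  apply/funext => n; have Uc := rtest_C1c (Ut n).
  have UUc := C1cM Uc Uc.
  rewrite (@eq_rint _ _ (fun r => U n r * U n r * derive1 phi r)); last by move=> r _; ring.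
  rewrite rint_by_parts// -rintZ; last first.
    by apply: rL2_mul => //; exact: bphi.
  by congr (- _); apply: eq_rint => r _; rewrite derive1_mulC1c//; ring.
rewrite e in l1.
rewrite -(cvg_lim (@Rhausdorff R) l1); apply: cvg_lim; first exact: Rhausdorff.
apply: cvgN; apply: cvgM => //; exact: cvg_cst.
Qed.

Lemma wd_mulC1 chi u v : C1c chi -> locL2 u -> locL2 v -> weak_deriv u v ->
  weak_deriv (fun r => chi r * u r) (fun r => derive1 chi r * u r + chi r * v r).
Proof.
move=> cc ul vl w phi pt; have pc := rtest_C1c pt.
have cpc := C1cM cc pc.
have := wd_C1 cpc ul vl w.
have [_ cc' sc] := cc; have [_ cp' sp] := pc.
rewrite (@eq_rint _ _ (fun r => u r * (derive1 chi r * phi r) + (chi r * u r) * derive1 phi r)); last first.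
  by move=> r _; rewrite derive1_mulC1c//; ring.
have i1 : integ (fun r => u r * (derive1 chi r * phi r)).
  apply: locL2_integ => //; last exact: compact_suppM.
  by move=> x; apply: cvgM; [exact: cc'|exact: C1c_continuous].
rewrite rintD//; last first.
  apply: (@eq_integ _ (fun r => u r * (chi r * derive1 phi r))) => [r _|]; first by ring.
  apply: locL2_integ => //; last by apply: compact_suppM; exact: compact_supp_derive.
  by move=> x; apply: cvgM; [exact: C1c_continuous|exact: cp'].
move=> /(canRL (addKr _)) ->; rewrite -opprD; congr (- _).
rewrite -rintD//; last exact: locL2_integC cpc.
by apply: eq_rint => r _; ring.
Qed.

End WeakDerivative.

(** * The energy estimate *)

Section Energy.
Context {R : realType}.
Notation mu := (@lebesgue_measure R).
Notation H := (@half_line R).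
Implicit Types (f g u v w phi psi V : R -> R) (a b c d r : R).

Notation ind A := (\1_(A%classic) : R -> R).

Lemma measurable_ind (A : set R) : measurable A -> measurable_fun H (\1_A : R -> R).
Proof. by move=> mA; apply: measurable_funTS; exact: measurable_indic. Qed.

Lemma indic01 (A : set R) r : 0 <= (\1_A r : R) <= 1.
Proof. by rewrite indicE; case: (_ \in _); rewrite lexx ler01. Qed.

(** Absolute continuity of the integral; it absorbs the contribution of the
    cutoff near the origin to the energy estimate. *)
Lemma small_mass w (e : R) : rL2 w -> 0 < e ->
  exists2 d, 0 < d & forall d', 0 < d' -> d' <= d -> sqnrm (fun r => ind `]0, d'] r * w r) < e.
Proof.
move=> w2 e0; have [mw _] := w2.
pose X (n : nat) r : R := ind `]0, n.+1%:R^-1] r * w r.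
have X0 : sqnrm (X n) @[n --> \oo] --> (0 : R).
  apply: (@cv_dominated _ X (fun r => `|w r|)).
  - move=> n; apply: measurable_funM; last exact: mw.
    exact: (measurable_ind (measurable_itv _)).
  - apply: (rL2_le _ w2); last by move=> r _; rewrite normr_id.
    by apply: measurableT_comp.
  - move=> n r _; rewrite normrM ler_piMl// ger0_norm; by have /andP[] := indic01 `]0, n.+1%:R^-1]%classic r.
  - move=> r r0; apply: (@cvg_trans _ ((fun=> 0 : R) @ \oo)); last exact: cvg_cst.
    apply: near_eq_cvg; near=> n; rewrite /X indicE memNset ?mul0r//= in_itv /= r0 /=.
    apply/negP; rewrite -ltNge invf_plt ?posrE ?ltr0n//.
    rewrite (@lt_le_trans _ _ n%:R) ?ler_nat//; near: n; exact: nbhs_infty_gtr.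
move/cvgrPdist_lt : X0 => /(_ e e0)[N _ /(_ N (leqnn N))].
rewrite sub0r normrN ger0_norm ?nrm_ge0// => XN.
exists N.+1%:R^-1; first by rewrite invr_gt0 ltr0n.
move=> d' d0 dN; apply: le_lt_trans XN; apply: nrm_le.
- by apply: rL2_restrict => //; exact: measurable_itv.
- by apply: rL2_restrict => //; exact: measurable_itv.
move=> r _; rewrite !normrM ler_wpM2r// !indicE.
have [|_] := boolP (r \in `]0, d']%classic); last by rewrite normr0.
rewrite inE /= in_itv /= => /andP[r0 rd].
by rewrite mem_set//= in_itv /= r0 (le_trans rd).
Unshelve. all: by end_near. Qed.

(** Monotone convergence as [d] tends to 0; the point is that the bound does
    not depend on [d]. *)
Lemma integ_limit f (C : R) : measurable_fun H f -> (forall r, 0 < r -> 0 <= f r) ->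
  (forall d, 0 < d -> d < 1 -> integ (fun r => ind `]d, 1] r * f r) /\
     rint (fun r => ind `]d, 1] r * f r) <= C) ->
  integ (fun r => ind `]0, 1] r * f r).
Proof.
move=> mf f0 h.
have m0 : measurable_fun H (fun r => ind `]0, 1] r * f r).
  by apply: measurable_funM => //; apply: measurable_ind; exact: measurable_itv.
apply/integrableP; split; first exact/measurable_EFinP.
pose F (n : nat) r : \bar R := (ind `](n.+2%:R^-1), 1] r * f r)%:E.
have n0 (n : nat) : 0 < n.+2%:R^-1 :> R by rewrite invr_gt0 ltr0n.
have n1 (n : nat) : n.+2%:R^-1 < 1 :> R by rewrite invf_lt1 ?ltr0n// ltr1n.
have F0 n r : H r -> (0 <= F n r)%E.
  rewrite half_lineP => r0; rewrite lee_fin mulr_ge0 ?f0//.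
have mF n : measurable_fun H (F n).
  apply/measurable_EFinP; apply: measurable_funM => //; apply: measurable_ind; exact: measurable_itv.
have ndF r : H r -> nondecreasing_seq (F ^~ r).
  rewrite half_lineP => r0 n p np; rewrite lee_fin ler_wpM2r ?f0// !indicE.
  have [|_] := boolP (r \in `]n.+2%:R^-1, 1]%classic); last by rewrite ler0n.
  rewrite inE /= in_itv /= => /andP[nr r1].
  rewrite mem_set//= in_itv /= r1 andbT (le_lt_trans _ nr)//.
  by rewrite lef_pV2 ?posrE ?ltr0n// ler_nat !ltnS.
have cF := @cvg_monotone_convergence _ _ R mu H (@measurable_half_line R) _ mF F0 ndF.
rewrite (@eq_integral _ _ _ mu _ (fun r => limn (F ^~ r))); last first.
  move=> r; rewrite inE half_lineP => r0 /=.
  have [i0 _] := andP (indic01 `]0, 1]%classic r).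
  rewrite ger0_norm ?mulr_ge0 ?f0//; apply/esym/cvg_lim => //.
  apply: cvg_EFin; first exact: nearW.
  apply: (@cvg_trans _ ((fun=> ind `]0, 1] r * f r) @ \oo)); last exact: cvg_cst.
  apply: near_eq_cvg; near=> n => /=; congr (_ * _); rewrite !indicE.
  congr (_%:R); congr (nat_of_bool _); apply/idP/idP; rewrite !inE /= !in_itv /= => /andP[nr ->]; rewrite andbT.
    rewrite invf_plt ?posrE ?ltr0n//.
    rewrite (@lt_le_trans _ _ n%:R) ?ler_nat//; first by near: n; exact: nbhs_infty_gtr.
    by rewrite (leq_trans (leqnSn n)).
  exact: lt_trans nr.
apply: (@le_lt_trans _ _ C%:E); last exact: ltry.
have lim_le := @cvg_lim _ (@ereal_hausdorff R) _ _ _ _ _ cF.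
rewrite -lim_le; apply: lime_le; first by apply/cvg_ex; eexists; exact: cF.
apply: nearW => n; have [ni nC] := h _ (n0 n) (n1 n).
rewrite [X in (X <= _)%E](EFin_rint ni).
by rewrite lee_fin.
Unshelve. all: by end_near. Qed.

(** The weights are singular at the origin, so nothing is asked there. *)
Definition C1pos psi psi' : Prop :=
  forall r, 0 < r -> isd r psi (psi' r) /\ {for r, continuous psi'}.

Lemma C1pos_cutoff psi psi' chi : C1pos psi psi' -> C1c chi -> C1c (fun r => psi r * chi r).
Proof.
move=> pp cc; have [_ cc' sc] := cc; have [a [b [a0 cab]]] := sc.
have ccc := C1c_continuous cc.
apply: (@C1c_intro _ _ (fun r => psi' r * chi r + psi r * derive1 chi r)).
- move=> x; have [x0|x0] := leP x 0.
    have xa := le_lt_trans x0 a0.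
    rewrite (supp_out cab) ?xa// (supp_out (supp_derive cab)) ?xa// !mulr0 addr0.
    apply: (@isd_near _ _ (fun=> 0)); last exact: isd_cst.
    near=> y; rewrite (supp_out cab) ?mulr0//; apply/orP; left.
    near: y; exact: near_lt.
  by apply: isdM; [exact: (pp x x0).1|exact: C1c_isd].
- move=> x; apply: cvgD.
    by apply: (continuous_supp_mul _ ccc sc) => y y0; exact: (pp y y0).2.
  apply: (continuous_supp_mul _ cc' (compact_supp_derive sc)) => y y0.
  exact: isd_continuous (pp y y0).1.
- exact: compact_suppM.
Unshelve. all: by end_near. Qed.

Lemma C1pos_cutoff_derive psi psi' chi r : 0 < r -> C1pos psi psi' -> C1c chi ->
  derive1 (fun r => psi r * chi r) r = psi' r * chi r + psi r * derive1 chi r.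
Proof.
by move=> r0 pp cc; apply: isd_derive1; apply: isdM; [exact: (pp r r0).1|exact: C1c_isd].
Qed.

(** The constant must be independent of [e]: only the growth [K / e] of the
    derivative near the origin is allowed. *)
Lemma cutoff_exists : exists2 K : R, 0 < K & forall e : R, 0 < e -> 2 * e <= 1 ->
  exists chi : R -> R, [/\ rtest chi, supp_in chi e 2, forall r, 0 <= chi r <= 1,
    forall r, 2 * e <= r <= 1 -> chi r = 1 &
    forall r, `|derive1 chi r| <= K / e * ind `]0, (2 * e)] r + K * ind `[1, +oo[ r].
Proof.
have [th [K0 [sth th0 th1 th01 thK]]] := @smooth_step_exists R.
pose K := `|K0| + 1.
have K_gt0 : 0 < K by rewrite ltr_wpDl.
have thK' x : `|derive1 th x| <= K.
  by rewrite (le_trans (thK x))// (le_trans (ler_norm _))// lerDl.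
have dth x : isd x th (derive1 th x) := smooth_isd x sth.
have th'1 x : 1 < x -> derive1 th x = 0.
  move=> x1; apply: isd_derive1; apply: (@isd_near _ _ (fun=> 1)); last exact: isd_cst.
  near=> y; rewrite th1//; apply: ltW; near: y; exact: near_gt.
exists K => // e e0 e1.
pose chi r := th (e^-1 * r + -1) * th (-1 * r + 2).
have dchi r : isd r chi (derive1 th (e^-1 * r + -1) * e^-1 * th (-1 * r + 2) +
    th (e^-1 * r + -1) * (derive1 th (-1 * r + 2) * -1)).
  apply: isdM; apply: isd_comp => //.
    by apply: (isd_eq (isdD (isdZ e^-1 (isd_id r)) (isd_cst r (-1)))); rewrite mulr1 addr0.
  by apply: (isd_eq (isdD (isdZ (-1) (isd_id r)) (isd_cst r 2))); rewrite mulr1 addr0.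
have chis : supp_in chi e 2.
  move=> x; rewrite mulf_eq0 negb_or => /andP[h1 h2]; apply/andP; split.
    rewrite leNgt; apply: contra_neqN h1 => xa; apply: th0.
    by rewrite subr_le0 mulrC ler_pdivrMr// mul1r ltW.
  rewrite leNgt; apply: contra_neqN h2 => xb; apply: th0; lra.
exists chi; split; [|exact: chis| | |].
- split; last by exists e, 2.
  by apply: smoothM; exact: smooth_affine.
- move=> r; have /andP[p0 p1] := th01 (e^-1 * r + -1).
  have /andP[q0 q1] := th01 (-1 * r + 2).
  by rewrite mulr_ge0// mulr_ile1.
- move=> r /andP[er r1]; rewrite /chi !th1 ?mulr1//; first by lra.
  by rewrite lerBrDr mulrC ler_pdivlMr//; lra.
- move=> r; rewrite (isd_derive1 (dchi r)).
  have /andP[p0 p1] := th01 (e^-1 * r + -1).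
  have /andP[q0 q1] := th01 (-1 * r + 2).
  apply: le_trans (ler_normD _ _) _; apply: lerD; last first.
    rewrite normrM (ger0_norm p0) normrM normrN1 mulr1.
    apply: (@le_trans _ _ (`|derive1 th (-1 * r + 2)|)); first by rewrite ler_piMl.
    rewrite indicE; have [_|] := boolP (r \in _); first by rewrite mulr1.
    rewrite notin_setE /= in_itv /= andbT => /negP; rewrite -ltNge => r1.
    by rewrite th'1 ?normr0 ?mulr0//; lra.
  rewrite !normrM (ger0_norm q0) (ger0_norm (_ : 0 <= e^-1)) ?invr_ge0 ?(ltW e0)//.
  apply: (@le_trans _ _ (`|derive1 th (e^-1 * r + -1)| / e)).
    by rewrite ler_piMr// mulr_ge0// invr_ge0 ltW.
  rewrite indicE; have [_|] := boolP (r \in _).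
    by rewrite mulr1 ler_wpM2r// invr_ge0 ltW.
  rewrite notin_setE /= in_itv /= => /negP; rewrite negb_and -leNgt -ltNge mulr0 => /orP[r0|r2].
    rewrite (_ : derive1 th (e^-1 * r + -1) = 0) ?normr0 ?mul0r//.
    apply: isd_derive1; apply: (@isd_near _ _ (fun=> 0)); last exact: isd_cst.
    have r1 : e^-1 * r + -1 < 0.
      rewrite subr_lt0 (@le_lt_trans _ _ 0)// mulr_ge0_le0// invr_ge0 ltW//.
    near=> y; rewrite th0//; apply: ltW; near: y; exact: near_lt.
  rewrite th'1 ?normr0 ?mul0r// ltrBrDr mulrC ltr_pdivlMr//; lra.
Unshelve. all: by end_near. Qed.

Lemma integ_continuous_mul f phi : locL2 f -> continuous phi -> compact_supp phi ->
  integ (fun r => f r ^+ 2 * phi r).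
Proof.
move=> fl cp sp; have [a [b [a0 pab]]] := sp.
have [z [zt zp _]] := supp_window a0 pab.
have z2 : rL2 (fun r => z r * f r) by apply: fl; [exact: C1c_continuous (rtest_C1c zt)|case: zt].
apply: (@eq_integ _ (fun r => (z r * f r) * (phi r * (z r * f r)))) => [r _|].
  transitivity (f r ^+ 2 * (z r * (z r * phi r))); [by ring|by rewrite !zp].
apply: rL2_mul => //; exact: (locL2_rL2 z2).
Qed.

(** Test [w ^+ 2] against [psi chi] with a cutoff [chi]; as
    [(w ^+ 2)' = 2 (a / r) w ^+ 2 + 2 w g], the integral of
    [s (w ^+ 2 (psi chi)' + 2 w (a / r * w + g) psi chi)] is 0.  Where [chi = 1]
    the factor of [w ^+ 2] is at least [V].  The remaining terms are controlled
    as follows.  Near the origin [|psi chi'| <= 2 E M], and the mass of [w ^+ 2]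
    on the support of [chi'] is as small as one wishes.  Beyond 1, both [psi] and
    [chi'] are bounded.  The product [w g psi] is absorbed by Young's inequality,
    thanks to [psi ^+ 2 <= K V].  The constant [E] of the regularised weight
    does not enter the result, which makes the passage to the limit possible. *)
Lemma energy_estimate (K : R) : 0 < K -> exists2 C : R, 0 < C &
  forall w g psi psi' V (E a s d : R), rL2 w -> rL2 g -> 0 < d -> d < 1 -> 0 < E -> s ^+ 2 = 1 ->
    weak_deriv w (fun r => a / r * w r + g r) -> C1pos psi psi' -> measurable_fun H V ->
    (forall r, 0 < r -> 0 <= psi r <= E * r) -> (forall r, 1 <= r -> psi r <= 1) ->
    (forall r, 0 < r -> V r <= s * (psi' r + 2 * (a / r) * psi r)) ->
    (forall r, 0 < r -> 0 <= V r) ->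
    (forall r, 0 < r -> r <= 2 -> psi r ^+ 2 <= K * V r) ->
    integ (fun r => ind `]d, 1] r * (V r * w r ^+ 2)) /\
    rint (fun r => ind `]d, 1] r * (V r * w r ^+ 2)) <= C * (1 + sqnrm w + sqnrm g).
Proof.
move=> K0; have [M M0 HM] := cutoff_exists.
exists (2 * (M + 2 * K + 1)); first by lra.
move=> w g psi psi' V E a s d w2 g2 d0 d1 E0 s2 ww pp mV psiE psi1 HV V0 psiV.
have EM0 : 0 < 2 * E * M by rewrite !mulr_gt0.
have iEM : 0 < (2 * E * M)^-1 by rewrite invr_gt0.
have [e1 e10 he1] := small_mass w2 iEM.
(* The cutoff equals 1 on [[2 e, 1]], which contains [`]d, 1]], and its
   derivative near the origin lives on [`]0, 2 e]], where [w] has little mass. *)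
pose e := Num.min (e1 / 2) (d / 2).
have e0 : 0 < e by rewrite lt_min !divr_gt0.
have ee1 : 2 * e <= e1 by rewrite mulrC -ler_pdivlMr// /e ge_min lexx.
have ed : 2 * e <= d by rewrite mulrC -ler_pdivlMr// /e ge_min lexx orbT.
have e21 : 2 * e <= 1 by rewrite (le_trans ed)// ltW.
have {}he1 := he1 (2 * e) (mulr_gt0 (ltr0Sn _ 1) e0) ee1.
have [chi [ct cs c01 c1 c']] := HM e e0 e21.
have cc := rtest_C1c ct.
have pc := C1pos_cutoff pp cc.
have [_ cp' sp] := pc; have cp := C1c_continuous pc.
have wl := locL2_rL2 w2; have gl := locL2_rL2 g2.
have vl : locL2 (fun r => a / r * w r + g r) by apply: locL2D => //; exact: locL2_div.
have sq := wd_sqr pc wl vl ww.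
pose phi r := psi r * chi r.
(* [Q] is the integrand of the identity [rint Q = 0]; [B] bounds the error
   terms of [main]. *)
pose Q r := s * (w r ^+ 2 * derive1 phi r + 2 * (w r * (a / r * w r + g r) * phi r)).
have iw : integ (fun r => w r ^+ 2 * derive1 phi r).
  by apply: integ_continuous_mul => //; exact: compact_supp_derive.
have iv : integ (fun r => w r * (a / r * w r + g r) * phi r).
  have cq : continuous (fun r : R => a / r * phi r : R).
    apply: continuous_supp_mul => // x x0; apply: cvgM; first exact: cvg_cst.
    exact: continuous_inv_pos.
  have i1 := integ_continuous_mul wl cq (compact_suppM (fun r => a / r) sp).
  have i2 : integ (fun r => w r * (phi r * g r)) by apply: rL2_mul => //; exact: gl.
  by apply: eq_integ (integD i1 i2) => r _; ring.
have iQ : integ Q by apply: integZ; apply: integD => //; exact: integZ.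
have rQ : rint Q = 0.
  rewrite /Q rintZ; last by apply: integD => //; exact: integZ.
  by rewrite rintD//; [rewrite sq rintZ// addNr mulr0|exact: integZ].
pose B r := 2 * E * M * (ind `]0, (2 * e)] r * w r) ^+ 2 + (M * w r ^+ 2 + 2 * K * g r ^+ 2).
have [mw iw2] := w2; have [mg ig2] := g2.
have iI2 : rL2 (fun r => ind `]0, (2 * e)] r * w r) by apply: rL2_restrict => //; exact: measurable_itv.
have iB : integ B.
  apply: integD; first by apply: integZ; case: iI2.
  by apply: integD; exact: integZ.
have rB : rint B <= 1 + M * sqnrm w + 2 * K * sqnrm g.
  rewrite rintD; [|by apply: integZ; case: iI2|by apply: integD; exact: integZ].
  rewrite rintZ; last by case: iI2.
  rewrite rintD; [|exact: integZ|exact: integZ]; rewrite !rintZ// -addrA lerD2r.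
  by rewrite mulrC -ler_pdivlMr// mul1r ltW.
have s1 : `|s| = 1.
  by apply/eqP; rewrite -(@eqrXn2 _ 2)// real_normK ?num_real// s2 expr1n.
have main r : 0 < r -> 2^-1 * (ind `]d, 1] r * (V r * w r ^+ 2)) <= Q r + B r.
  move=> r0; have /andP[ch0 ch1] := c01 r; have /andP[ps0 psE] := psiE r r0.
  have V0r := V0 r r0.
  rewrite /Q /B /phi (C1pos_cutoff_derive r0 pp cc).
  set W := w r; set G := g r; set P := psi r; set P' := psi' r; set X := chi r.
  set X' := derive1 chi r; set J := ind `]0, (2 * e)] r; set I := ind `]d, 1] r.
  have J2 : J ^+ 2 = J by rewrite /J indicE; case: (_ \in _); rewrite ?expr1n ?expr0n.
  have -> : s * (W ^+ 2 * (P' * X + P * X') + 2 * (W * (a / r * W + G) * (P * X))) =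
    (s * (P' + 2 * (a / r) * P)) * (X * W ^+ 2) + (s * X' * P * W ^+ 2) + 2 * s * W * G * (P * X).
    by ring.
  rewrite exprMn J2.
  have IX : I * (V r * W ^+ 2) <= X * (V r * W ^+ 2).
    have VW : 0 <= V r * W ^+ 2 by rewrite mulr_ge0 ?sqr_ge0.
    rewrite /I indicE; have [|_] := boolP (r \in _); last by rewrite mul0r mulr_ge0.
    rewrite inE /= in_itv /= => /andP[dr r1]; rewrite /X c1// (le_trans ed (ltW dr))//.
  have h1 : V r * (X * W ^+ 2) <= (s * (P' + 2 * (a / r) * P)) * (X * W ^+ 2).
    by apply: ler_wpM2r (HV r r0); rewrite mulr_ge0 ?sqr_ge0.
  have h2 : - (2 * E * M * (J * W ^+ 2) + M * W ^+ 2) <= s * X' * P * W ^+ 2.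
    have : `|s * X' * P| <= 2 * E * M * J + M.
      rewrite !normrM s1 mul1r (ger0_norm ps0).
      have JP : J * P <= J * (2 * e * E).
        rewrite /J indicE; have [|_] := boolP (r \in _); last by rewrite !mul0r.
        rewrite inE /= in_itv /= => /andP[_ r2e]; rewrite !mul1r (le_trans psE)//.
        by rewrite mulrC ler_wpM2r// ltW.
      have IP : ind `[1, +oo[ r * P <= 1.
        rewrite indicE; have [|_] := boolP (r \in _); last by rewrite mul0r ler01.
        by rewrite inE /= in_itv /= andbT => r1; rewrite mul1r; exact: psi1.
      apply: le_trans (ler_wpM2r ps0 (c' r)) _.
      rewrite mulrDl; apply: lerD; last first.
        by rewrite -mulrA ler_piMr// ltW.
      have Me : 0 <= M / e by rewrite divr_ge0// ltW.
      apply: (@le_trans _ _ (M / e * (J * (2 * e * E)))).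
        by rewrite -[leLHS]mulrA; exact: (ler_wpM2l Me JP).
      by rewrite le_eqVlt; apply/orP; left; apply/eqP; field; rewrite gt_eqF.
    rewrite ler_norml => /andP[+ _] => /(ler_wpM2r (sqr_ge0 W)).
    by rewrite mulNr mulrDl mulrA.
  have h3 : - (2^-1 * (X * (V r * W ^+ 2)) + 2 * K * G ^+ 2) <= 2 * s * W * G * (P * X).
    have PK : X * P ^+ 2 <= X * (K * V r).
      rewrite /X; have [->|/cs/andP[_ r2]] := eqVneq (chi r) 0; first by rewrite !mul0r.
      by apply: ler_wpM2l => //; exact: psiV.
    (* Young: 2 |W G P| <= (P W)^2 / (2 K) + 2 K G^2 *)
    have yg : 0 <= (s * P * W + 2 * K * G) ^+ 2 by exact: sqr_ge0.
    have K2 : 0 < 2 * K by rewrite mulr_gt0.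
    rewrite -subr_ge0 -(pmulr_rge0 _ K2).
    have -> : 2 * K * (2 * s * W * G * (P * X) - - (2^-1 * (X * (V r * W ^+ 2)) + 2 * K * G ^+ 2)) =
      X * (s * P * W + 2 * K * G) ^+ 2 + (X * (K * V r) - s ^+ 2 * (X * P ^+ 2)) * W ^+ 2
      + (1 - X) * (2 * K * G) ^+ 2 by field.
    rewrite s2 mul1r; apply: addr_ge0; [apply: addr_ge0|].
    - exact: mulr_ge0.
    - by rewrite mulr_ge0 ?sqr_ge0// subr_ge0.
    - by rewrite mulr_ge0 ?sqr_ge0// subr_ge0.
  lra.
have i0 r : 0 < r -> 0 <= ind `]d, 1] r * (V r * w r ^+ 2).
  by move=> r0; rewrite mulr_ge0//; rewrite mulr_ge0 ?sqr_ge0// V0.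
have int : integ (fun r => ind `]d, 1] r * (V r * w r ^+ 2)).
  apply: (@integ_le _ _ (fun r => 2 * (Q r + B r))).
  - apply: measurable_funM.
      by apply: measurable_funTS; exact: measurable_indic.
    by apply: measurable_funM => //; exact: measurable_funX.
  - by apply: integZ; exact: integD.
  - by move=> r r0; rewrite ger0_norm ?i0//; have := main r r0; lra.
split => //.
have := rint_le (integZ 2^-1 int) (integD iQ iB) main.
rewrite rintZ// rintD// rQ add0r => /le_trans/(_ rB).
have := nrm_ge0 w; have := nrm_ge0 g; nra.
Qed.

End Energy.

(** * Hardy's inequality and its borderline form *)

Section Weights.
Context {R : realType}.
Notation H := (@half_line R).
Notation ind A := (\1_(A%classic) : R -> R).
Implicit Types (w g V : R -> R) (a s c d r : R).

(** The weights of interest blow up at the origin, where the energy estimate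
    requires [psi r <= E * r].  They are replaced by shifted ones, whose [V]
    dominates [V0], up to a constant, on [`]d, 1]]. *)
Lemma energy_limit (K c : R) w g V0 a s : 0 < K -> 0 <= c -> rL2 w -> rL2 g -> s ^+ 2 = 1 ->
  weak_deriv w (fun r => a / r * w r + g r) -> measurable_fun H V0 -> (forall r, 0 < r -> 0 <= V0 r) ->
  (forall d, 0 < d -> d < 1 -> exists psi psi' V (E : R), [/\ 0 < E, C1pos psi psi' /\ measurable_fun H V,
    (forall r, 0 < r -> 0 <= psi r <= E * r) /\ (forall r, 1 <= r -> psi r <= 1),
    (forall r, 0 < r -> 0 <= V r) /\ (forall r, 0 < r -> r <= 2 -> psi r ^+ 2 <= K * V r) &
    (forall r, 0 < r -> V r <= s * (psi' r + 2 * (a / r) * psi r)) /\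
    (forall r, d < r -> r <= 1 -> V0 r <= c * V r)]) ->
  integ (fun r => ind `]0, 1] r * (V0 r * w r ^+ 2)).
Proof.
move=> K0 c0 w2 g2 s2 ww mV0 V00 Hd; have [C C0 HC] := @energy_estimate R K K0.
have [mw iw2] := w2.
apply: (@integ_limit _ _ (c * (C * (1 + sqnrm w + sqnrm g)))).
- by apply: measurable_funM => //; exact: measurable_funX.
- by move=> r r0; rewrite mulr_ge0 ?sqr_ge0// V00.
move=> d d0 d1; have [psi [psi' [V [E [E0 [pp mV] [pE p1] [Vp pV] [HV VV]]]]]] := Hd d d0 d1.
have [iV rV] := HC w g psi psi' V E a s d w2 g2 d0 d1 E0 s2 ww pp mV pE p1 HV Vp pV.
have le r : 0 < r -> ind `]d, 1] r * (V0 r * w r ^+ 2) <= c * (ind `]d, 1] r * (V r * w r ^+ 2)).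
  move=> r0; rewrite indicE; have [|_] := boolP (r \in _); last by rewrite !mul0r mulr0.
  rewrite inE /= in_itv /= => /andP[dr r1]; rewrite !mul1r mulrA ler_wpM2r ?sqr_ge0//.
  exact: VV.
have icV := integZ c iV.
have i0 : integ (fun r => ind `]d, 1] r * (V0 r * w r ^+ 2)).
  apply: (integ_le _ icV).
    apply: measurable_funM; first by apply: measurable_ind; exact: measurable_itv.
    by apply: measurable_funM => //; exact: measurable_funX.
  move=> r r0; rewrite ger0_norm; first exact: le.
  by rewrite mulr_ge0// mulr_ge0 ?sqr_ge0// V00.
split => //; apply: le_trans (rint_le i0 icV le) _.
by rewrite rintZ// ler_wpM2l.
Qed.

Lemma measurable_inv : measurable_fun H (fun r : R => r^-1).
Proof.
apply: open_continuous_measurable_fun; first exact: interval_open.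
by move=> x; rewrite inE half_lineP; exact: continuous_inv_pos.
Qed.

Lemma C1pos_measurable (f : R -> R) : (forall r : R, 0 < r -> {for r, continuous f}) -> measurable_fun H f.
Proof.
move=> cf; apply: open_continuous_measurable_fun; first exact: interval_open.
by move=> x; rewrite inE half_lineP; exact: cf.
Qed.

Lemma isd_addr d r : isd r (fun x => x + d) 1.
Proof. by apply: (isd_eq (isdD (isd_id r) (isd_cst r d))); rewrite addr0. Qed.

Lemma shift_bound d r : 0 < d -> 0 < r -> r / (r + d) ^+ 2 <= (d ^+ 2)^-1 * r.
Proof.
move=> d0 r0; have rp : 0 < r + d by exact: addr_gt0.
rewrite mulrC; apply: ler_wpM2r; first exact: ltW.
rewrite lef_pV2 ?posrE ?exprn_gt0// ler_pXn2r ?nnegrE ?(ltW d0) ?(ltW rp)//.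
by rewrite lerDr ltW.
Qed.

(** Up to the regularisation by the shift [d], the weight is [psi = 1 / r], for
    which [s (psi' + 2 (a / r) psi) >= (2 s a - 1) / r ^+ 2]. *)
Lemma hardy w g a s : rL2 w -> rL2 g -> s ^+ 2 = 1 -> 2^-1 < s * a ->
  weak_deriv w (fun r => a / r * w r + g r) -> rL2 (fun r => w r / r).
Proof.
move=> w2 g2 s2 sa ww; have [mw iw2] := w2.
pose c := 2 * (s * a) - 1; have c0 : 0 < c by rewrite /c; lra.
have i01 : integ (fun r => ind `]0, 1] r * (r^-1 ^+ 2 * w r ^+ 2)).
  apply: (@energy_limit c^-1 (4 / c) _ _ _ _ _ _ _ w2 g2 s2 ww).
  - by rewrite invr_gt0.
  - by rewrite divr_ge0// ltW.
  - by apply: measurable_funX; exact: measurable_inv.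
  - by move=> r _; rewrite sqr_ge0.
  move=> d d0 d1.
  pose psi r := r * ((r + d) ^+ 2)^-1.
  pose psi' r := ((r + d) ^+ 2)^-1 - 2 * r * ((r + d) ^+ 3)^-1.
  pose V r := c * ((r + d) ^+ 2)^-1.
  have rd0 r : 0 < r -> 0 < r + d by move=> r0; exact: addr_gt0.
  have rdn r : 0 < r -> r + d != 0 by move=> /rd0/gt_eqF ->.
  have dinv2 r : 0 < r -> isd r (fun x => ((x + d) ^+ 2)^-1) (- 2 * ((r + d) ^+ 3)^-1).
    move=> r0; have rn := rdn r r0.
    apply: (isd_eq (isdV _ (isdX 1 (isd_addr d r)))); first by rewrite expf_neq0.
    by field.
  have dinv3 r : 0 < r -> isd r (fun x => ((x + d) ^+ 3)^-1) (- 3 * ((r + d) ^+ 4)^-1).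
    move=> r0; have rn := rdn r r0.
    apply: (isd_eq (isdV _ (isdX 2 (isd_addr d r)))); first by rewrite expf_neq0.
    by field.
  have c2 r : 0 < r -> {for r, continuous (fun x => ((x + d) ^+ 2)^-1)}.
    by move=> r0; exact: isd_continuous (dinv2 r r0).
  exists psi, psi', V, (d ^+ 2)^-1; split.
  - by rewrite invr_gt0 exprn_gt0.
  - split; last first.
      by apply: C1pos_measurable => r r0; apply: cvgM; [exact: cvg_cst|exact: c2].
    move=> r r0; have rn := rdn r r0; split.
      apply: (isd_eq (isdM (isd_id r) (dinv2 r r0))); rewrite /psi'; by ring.
    have := isdB (dinv2 r r0) (isdM (isdZ 2 (isd_id r)) (dinv3 r r0)).
    exact: isd_continuous.
  - split=> r r0; rewrite /psi.
      have rp := rd0 r r0; apply/andP; split; last exact: shift_bound.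
      by rewrite divr_ge0 ?sqr_ge0// ltW.
    have rp : 0 < r + d by lra.
    by rewrite ler_pdivrMr ?exprn_gt0// mul1r; nra.
  - split=> r r0; first by rewrite mulr_ge0 ?invr_ge0 ?sqr_ge0// ltW.
    move=> _; rewrite /V mulrA mulVf ?gt_eqF// mul1r /psi exprMn.
    have rp := rd0 r r0.
    rewrite expr2 [X in _ * X]expr2 mulrA ler_piMl ?invr_ge0 ?sqr_ge0//.
    by rewrite ler_pdivrMr ?exprn_gt0// mul1r; nra.
  - split=> r.
      move=> r0; have rn := rdn r r0; have rp := rd0 r r0.
      rewrite /V /psi /psi' /c -subr_ge0.
      have rn0 : r != 0 by rewrite gt_eqF.
      have -> : s * (((r + d) ^+ 2)^-1 - 2 * r * ((r + d) ^+ 3)^-1 + 2 * (a / r) * (r * ((r + d) ^+ 2)^-1)) -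
        (2 * (s * a) - 1) * ((r + d) ^+ 2)^-1 = ((r + d) + s * (d - r)) / (r + d) ^+ 3.
        by field; rewrite rn0 rn.
      rewrite divr_ge0 ?exprn_ge0 ?(ltW rp)//.
      have : (s - 1) * (s + 1) = 0 by rewrite -subr_sqr s2 expr1n subrr.
      move/eqP; rewrite mulf_eq0 subr_eq0 addr_eq0 => /orP[/eqP->|/eqP->]; lra.
    move=> dr r1; have r0 : 0 < r by lra.
    rewrite /V mulrA mulfVK ?gt_eqF// exprVn ler_pdivlMr ?exprn_gt0 ?rd0//.
    rewrite mulrC ler_pdivrMr ?exprn_gt0//; nra.
have mwr : measurable_fun H (fun r => w r / r) by apply: measurable_funM => //; exact: measurable_inv.
split => //; apply: (integ_le _ (integD i01 iw2)); first exact: measurable_funX.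
move=> r r0; rewrite ger0_norm ?sqr_ge0// exprMn mulrC indicE.
have [_|] := boolP (r \in _); first by rewrite mul1r lerDl sqr_ge0.
rewrite notin_setE /= in_itv /= r0 => /negP; rewrite -ltNge => r1.
rewrite mul0r add0r ler_piMl ?sqr_ge0// exprVn invf_le1 ?exprn_gt0//.
by rewrite expr_ge1// ltW.
Qed.

(** A version of [- ln r] near the origin that is monotone and at least 1 on the
    whole half-line, so that it can be divided by. *)
Definition lg r : R := 1 + ln (1 + r^-1).

Lemma lg_ge1 r : 0 < r -> 1 <= lg r.
Proof. by move=> r0; rewrite /lg lerDl ln_ge0// lerDl invr_ge0 ltW. Qed.

Lemma lg_isd r : 0 < r -> isd r lg (- (r * (1 + r))^-1).
Proof.
move=> r0; have rn : r != 0 by rewrite gt_eqF.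
have p : 0 < 1 + r^-1 by rewrite addr_gt0// invr_gt0.
have d1 : isd r (fun x => 1 + x^-1) (- r ^- 2).
  by apply: (isd_eq (isdD (isd_cst r 1) (isdV rn (isd_id r)))); rewrite add0r mulN1r.
have d2 : isd (1 + r^-1) (@ln R) (1 + r^-1)^-1 by exact: is_derive1_ln.
apply: (isd_eq (isdD (isd_cst r 1) (@isd_comp R r (fun x => 1 + x^-1) (@ln R) _ _ d2 d1))).
have sn : 1 + r != 0 by rewrite gt_eqF// addr_gt0.
have sn' : r + 1 != 0 by rewrite addrC.
by field; rewrite rn ?sn ?sn'.
Qed.

Lemma lg_shift_isd r d : 0 < r + d ->
  isd r (fun x => lg (x + d)) (- ((r + d) * (1 + (r + d)))^-1).
Proof.
move=> rd; have := @isd_comp R r (fun x => x + d) lg _ _ (lg_isd rd) (isd_addr d r).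
by rewrite mulr1.
Qed.

Lemma lg_le r d : 0 < r -> r <= d -> lg d <= lg r.
Proof.
move=> r0 rd; have d0 := lt_le_trans r0 rd.
rewrite /lg lerD2l ler_ln ?posrE ?addr_gt0 ?invr_gt0//.
by rewrite lerD2l lef_pV2 ?posrE.
Qed.

(** At the critical exponent the weight [1 / r] gives nothing: for [s = 1] the
    terms [psi'] and [2 (a / r) psi] cancel.  Dividing it by [lg] leaves the
    derivative of [1 / lg], which has the right sign and is of order
    [1 / (r * lg r) ^+ 2]. *)
Lemma log_hardy w g a s : rL2 w -> rL2 g -> s ^+ 2 = 1 -> 2^-1 <= s * a ->
  weak_deriv w (fun r => a / r * w r + g r) ->
  rL2 (fun r => ind `]0, 1] r * ((r * lg r)^-1 * w r)).
Proof.
move=> w2 g2 s2 sa ww; have [mw iw2] := w2.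
have L0 r : 0 < r -> 0 < lg r by move=> /lg_ge1; exact: lt_le_trans.
have rL r : 0 < r -> 0 < r * lg r by move=> r0; rewrite mulr_gt0// L0.
have mrho : measurable_fun H (fun r : R => (r * lg r)^-1).
  apply: C1pos_measurable => r r0.
  apply: isd_continuous (isdV _ (isdM (isd_id r) (lg_isd r0))).
  by rewrite gt_eqF// rL.
have i01 : integ (fun r => ind `]0, 1] r * ((r * lg r)^-1 ^+ 2 * w r ^+ 2)).
  apply: (@energy_limit 4 24 _ _ _ _ _ _ _ w2 g2 s2 ww) => //.
  - exact: measurable_funX.
  - by move=> r _; rewrite sqr_ge0.
  move=> d d0 d1.
  pose q r := (r + d) ^+ 2 * lg (r + d).
  pose q' r := 2 * (r + d) * lg (r + d) - (r + d) / (1 + (r + d)).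
  pose psi r := r / q r.
  pose psi' r := (q r)^-1 - r * (q' r / q r ^+ 2).
  pose V r := r / ((r + d) ^+ 3 * (1 + (r + d)) * lg (r + d) ^+ 2).
  have rd0 r : 0 < r -> 0 < r + d by move=> r0; exact: addr_gt0.
  have q0 r : 0 < r -> 0 < q r.
    by move=> r0; rewrite mulr_gt0 ?exprn_gt0 ?L0 ?rd0.
  have dq r : 0 < r -> isd r q (q' r).
    move=> r0; have rp := rd0 r r0.
    have dl := lg_shift_isd rp.
    apply: (isd_eq (isdM (isdX 1 (isd_addr d r)) dl)).
    rewrite /q'; field; rewrite !gt_eqF//; lra.
  have qn r : 0 < r -> q r != 0 by move=> /q0/gt_eqF ->.
  have dqi r : 0 < r -> isd r (fun x => (q x)^-1) (- q' r / q r ^+ 2).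
    by move=> r0; apply: isdV (dq r r0); exact: qn.
  have cq r : 0 < r -> {for r, continuous q}.
    by move=> r0; exact: isd_continuous (dq r r0).
  have cqi r : 0 < r -> {for r, continuous (fun x => (q x)^-1)}.
    by move=> r0; exact: isd_continuous (dqi r r0).
  have cid r : {for r, continuous (fun x : R => x)} by exact: isd_continuous (isd_id r).
  have cadd r : {for r, continuous (fun x : R => x + d)} by exact: isd_continuous (isd_addr d r).
  have clg r : 0 < r -> {for r, continuous (fun x => lg (x + d))}.
    move=> r0; have rp := rd0 r r0.
    exact: (isd_continuous (lg_shift_isd rp)).
  have c1i r : 0 < r -> {for r, continuous (fun x => (1 + (x + d))^-1)}.
    move=> r0; have rp := rd0 r r0.
    apply: isd_continuous (isdV _ (isdD (isd_cst r 1) (isd_addr d r))).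
    by rewrite gt_eqF//; lra.
  have cq' r : 0 < r -> {for r, continuous q'}.
    move=> r0; apply: cvgB; apply: cvgM; [|exact: clg|exact: cadd|exact: c1i].
    by apply: cvgM; [exact: cvg_cst|exact: cadd].
  exists psi, psi', V, (d ^+ 2)^-1; split.
  - by rewrite invr_gt0 exprn_gt0.
  - split.
      move=> r r0; split.
        apply: (isd_eq (isdM (isd_id r) (dqi r r0))); rewrite /psi'; by ring.
      apply: cvgB; first exact: cqi.
      apply: cvgM; first exact: cid; apply: cvgM; first exact: cq'.
      apply: isd_continuous (isdV _ (isdX 1 (dq r r0))).
      by rewrite expf_neq0// qn.
    apply: C1pos_measurable => r r0; apply: cvgM; first exact: cid.
    have rp := rd0 r r0; have lp := L0 _ rp.
    have dl := lg_shift_isd rp.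
    apply: isd_continuous (isdV _ (isdM (isdM (isdX 2 (isd_addr d r))
      (isdD (isd_cst r 1) (isd_addr d r))) (isdX 1 dl))).
    rewrite !mulf_neq0 ?expf_neq0// gt_eqF//; lra.
  - have psile r : 0 < r -> psi r <= r / (r + d) ^+ 2.
      move=> r0; have rp := rd0 r r0; rewrite /psi ler_wpM2l ?(ltW r0)//.
      rewrite lef_pV2 ?posrE ?q0 ?exprn_gt0// /q ler_peMr ?sqr_ge0//.
      exact: lg_ge1.
    split=> r r0.
      have rp := rd0 r r0; apply/andP; split; first by rewrite divr_ge0 ?ltW// q0.
      by rewrite (le_trans (psile r r0))// shift_bound.
    have r1 : 0 < r by lra.
    have rp := rd0 r r1.
    rewrite (le_trans (psile r r1))// ler_pdivrMr ?exprn_gt0// mul1r; nra.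
  - split=> r r0; have rp := rd0 r r0; have lp := L0 _ rp.
      rewrite divr_ge0 ?(ltW r0)// !mulr_ge0 ?exprn_ge0 ?ltW//; lra.
    move=> r2; rewrite /psi /V /q -subr_ge0.
    have rn : r + d != 0 by rewrite gt_eqF.
    have ln : lg (r + d) != 0 by rewrite gt_eqF.
    have sn : 1 + (r + d) != 0 by rewrite gt_eqF//; lra.
    have -> : 4 * (r / ((r + d) ^+ 3 * (1 + (r + d)) * lg (r + d) ^+ 2)) -
        (r / ((r + d) ^+ 2 * lg (r + d))) ^+ 2 =
      r * (4 * (r + d) - r * (1 + (r + d))) / ((r + d) ^+ 4 * (1 + (r + d)) * lg (r + d) ^+ 2).
      by field; rewrite rn ln sn.
    apply: divr_ge0; last by rewrite !mulr_ge0 ?exprn_ge0 ?ltW//; lra.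
    by apply: mulr_ge0; [lra|nra].
  - split=> r.
      move=> r0; have rp := rd0 r r0; have lp := L0 _ rp; have l1 := lg_ge1 rp.
      have rn0 : r != 0 by rewrite gt_eqF.
      have rn : r + d != 0 by rewrite gt_eqF.
      have ln : lg (r + d) != 0 by rewrite gt_eqF.
      have sn : 1 + (r + d) != 0 by rewrite gt_eqF//; lra.
      set l := lg (r + d) in l1 lp ln *.
      apply: (@le_trans _ _ (s * psi' r + (q r)^-1)); last first.
        rewrite [leRHS]mulrDr lerD2l /psi.
        rewrite (_ : s * _ = 2 * (s * a) / q r); last by field; rewrite rn0 qn.
        by rewrite ler_peMl ?invr_ge0 ?(ltW (q0 r r0))//; lra.
      rewrite -subr_ge0.
      have : (s - 1) * (s + 1) = 0 by rewrite -subr_sqr s2 expr1n subrr.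
      move/eqP; rewrite mulf_eq0 subr_eq0 addr_eq0 => /orP[/eqP->|/eqP->].
        have -> : 1 * psi' r + (q r)^-1 - V r = 2 * d / ((r + d) ^+ 3 * l).
          by rewrite /psi' /V /q' /q -/l; field; rewrite rn ln sn.
        by rewrite divr_ge0 ?mulr_ge0 ?exprn_ge0 ?ltW.
      have -> : -1 * psi' r + (q r)^-1 - V r =
          2 * r * (l * (1 + (r + d)) - 1) / ((r + d) ^+ 3 * (1 + (r + d)) * l ^+ 2).
        by rewrite /psi' /V /q' /q -/l; field; rewrite rn ln sn.
      apply: divr_ge0; last by rewrite !mulr_ge0 ?exprn_ge0 ?ltW//; lra.
      by apply: mulr_ge0; [lra|nra].
    move=> dr r1; have r0 : 0 < r by lra.
    have rp := rd0 r r0; have lp := L0 _ rp.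
    have ll : lg (r + d) <= lg r by apply: lg_le => //; lra.
    have lr := L0 _ r0.
    rewrite /V exprVn exprMn mulrA ler_pdivlMr; last by rewrite !mulr_gt0 ?exprn_gt0//; lra.
    rewrite mulrC ler_pdivrMr ?mulr_gt0 ?exprn_gt0//.
    apply: (@le_trans _ _ ((2 * r) ^+ 3 * 3 * lg r ^+ 2)).
      apply: ler_pM; [by rewrite mulr_ge0 ?exprn_ge0 ?ltW//; lra|by rewrite exprn_ge0// ltW| |].
        apply: ler_pM; [by rewrite exprn_ge0// ltW|lra| |lra].
        by rewrite ler_pXn2r// ?nnegrE; lra.
      by rewrite ler_pXn2r// ?nnegrE; lra.
    by rewrite le_eqVlt; apply/orP; left; apply/eqP; ring.
have mI : measurable_fun H (ind `]0, 1]) by apply: measurable_ind; exact: measurable_itv.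
split; first by apply: measurable_funM => //; exact: measurable_funM.
apply: eq_integ i01 => r _; rewrite [RHS]exprMn [in RHS]exprMn; congr (_ * _).
by rewrite indicE; case: (_ \in _); rewrite ?expr1n ?expr0n.
Qed.

End Weights.

(** * Cutoffs adapted to the logarithmic weight *)

Section System.
Context {R : realType}.
Notation H := (@half_line R).
Notation ind A := (\1_(A%classic) : R -> R).
Implicit Types (f g w : R -> R) (a s c d r : R).

(** These are [theta (n + 2 - ln (lg r)) * theta (n + 2 - r)] for a smooth step
    [theta].  The derivative of [ln (lg r)] is [- 1 / (r (1 + r) lg r)], hence
    the uniform bound; and the derivatives live where [ln (lg r)] or [r] is at
    least [n + 1], a region that leaves every point. *)
Lemma cutoff_seq : exists2 K : R, 0 < K & exists chi : nat -> R -> R,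
  [/\ forall n, C1c (chi n), forall n r, 0 < r -> 0 <= chi n r <= 1,
      forall n r, 0 < r -> `|derive1 (chi n) r| <= K * (ind `]0, 1] r * (r * lg r)^-1 + 1),
      forall r, 0 < r -> chi n r @[n --> \oo] --> (1 : R) &
      forall r, 0 < r -> derive1 (chi n) r @[n --> \oo] --> (0 : R)].
Proof.
have [th [K0 [sth th0 th1 th01 thK]]] := @smooth_step_exists R.
pose K := `|K0| + 1.
have K_gt0 : 0 < K by rewrite ltr_wpDl.
have thK' x : `|derive1 th x| <= K.
  by rewrite (le_trans (thK x))// (le_trans (ler_norm _))// lerDl.
have dth x : isd x th (derive1 th x) := smooth_isd x sth.
have cdth : continuous (derive1 th) by apply: smooth_continuous; exact: smooth_derive.
have cth := smooth_continuous sth.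
have th'1 x : 1 < x -> derive1 th x = 0.
  move=> x1; apply: isd_derive1; apply: (@isd_near _ _ (fun=> 1)); last exact: isd_cst.
  near=> y; rewrite th1//; apply: ltW; near: y; exact: near_gt.
have L0 r : 0 < r -> 0 < lg r by move=> /lg_ge1; exact: lt_le_trans.
pose N n : R := n.+2%:R.
pose A n r := N n - ln (lg r).
pose A' r := (r * (1 + r) * lg r)^-1.
pose B n r := N n - r.
have dA n r : 0 < r -> isd r (A n) (A' r).
  move=> r0; have lp := L0 r r0.
  have dl : isd (lg r) (@ln R) (lg r)^-1 by exact: is_derive1_ln.
  apply: (isd_eq (isdB (isd_cst r (N n)) (@isd_comp R r lg (@ln R) _ _ dl (lg_isd r0)))).
  rewrite /A'; field; rewrite !gt_eqF//; lra.
have dB n r : isd r (B n) (-1).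
  by apply: (isd_eq (isdB (isd_cst r (N n)) (isd_id r))); rewrite sub0r.
pose X n r := th (A n r) * th (B n r).
pose X' n r := derive1 th (A n r) * A' r * th (B n r) + th (A n r) * (derive1 th (B n r) * -1).
have cA' r : 0 < r -> {for r, continuous A'}.
  move=> r0; have lp := L0 r r0.
  apply: isd_continuous (isdV _ (isdM (isdM (isd_id r) (isdD (isd_cst r 1) (isd_id r))) (lg_isd r0))).
  by rewrite gt_eqF// !mulr_gt0// addr_gt0.
have XC n : C1pos (X n) (X' n).
  move=> r r0; have cA := isd_continuous (dA n r r0); have cB := isd_continuous (dB n r).
  have c1 (f : R -> R) : continuous f -> {for r, continuous (fun x => f (A n x))}.
    move=> cf; exact: (continuous_comp cA (cf _)).
  have c2 (f : R -> R) : continuous f -> {for r, continuous (fun x => f (B n x))}.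
    move=> cf; exact: (continuous_comp cB (cf _)).
  split.
    apply: (isdM (@isd_comp R r (A n) th _ _ (dth _) (dA n r r0))
      (@isd_comp R r (B n) th _ _ (dth _) (dB n r))).
  apply: cvgD.
    apply: cvgM; last exact: c2.
    by apply: cvgM; [exact: c1|exact: cA'].
  apply: cvgM; first exact: c1.
  by apply: cvgM; [exact: c2|exact: cvg_cst].
(* Below [e n], [ln (lg r)] exceeds [N n] and the first factor vanishes. *)
pose e n : R := expR (- expR (N n)).
have e0 n : 0 < e n by exact: expR_gt0.
have Xs n r : 0 < r -> X n r != 0 -> e n <= r <= N n.
  move=> r0; rewrite mulf_eq0 negb_or => /andP[h1 h2]; apply/andP; split; last first.
    rewrite leNgt; apply: contra_neqN h2 => rN; apply: th0.
    by rewrite subr_le0 ltW.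
  rewrite leNgt; apply: contra_neqN h1 => re; apply: th0.
  rewrite subr_le0 -ler_expR lnK ?posrE ?L0//.
  have h : expR (N n) <= ln (r^-1).
    rewrite lnV ?posrE// lerNr -(expRK (- expR (N n))) ler_ln ?posrE// ltW//.
  have h2' : ln r^-1 <= ln (1 + r^-1).
    by rewrite ler_ln ?posrE ?addr_gt0 ?invr_gt0// lerDr.
  rewrite /lg; lra.
(* The formula is meaningful for positive [r] only; a window equal to 1 on
   the support makes it a function on the whole line. *)
have /choice[z Hz] : forall n, exists z : R -> R, C1c z /\ forall x, e n <= x <= N n -> z x = 1.
  by move=> n; have [z [zt _ _ z1 _]] := @window_exists _ (e n) (N n) (e0 n); exists z; split; [exact: rtest_C1c|exact: z1].
pose chi n r := X n r * z n r.
have chiE n r : 0 < r -> chi n r = X n r.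
  move=> r0; rewrite /chi; have [->|/(Xs n r r0) h] := eqVneq (X n r) 0; first by rewrite mul0r.
  by rewrite (Hz n).2// mulr1.
have chi'E n r : 0 < r -> derive1 (chi n) r = X' n r.
  move=> r0; apply: isd_derive1; apply: isd_near (XC n r r0).1.
  by near=> y; rewrite chiE//; near: y; exact: near_gt.
have N1 r : \forall n \near \oo, 1 < N n - r.
  near=> n; rewrite ltrBrDl.
  have : r <= n%:R by near: n; exact: nbhs_infty_ger.
  by rewrite /N -(natr1 n.+1) -(natr1 n); lra.
exists (2 * K); [by rewrite mulr_gt0|exists chi; split].
- by move=> n; apply: C1pos_cutoff (XC n) (Hz n).1.
- move=> n r r0; rewrite chiE//.
  have /andP[p0 p1] := th01 (A n r); have /andP[q0 q1] := th01 (B n r).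
  by rewrite mulr_ge0// mulr_ile1.
- move=> n r r0; rewrite chi'E//.
  have /andP[p0 p1] := th01 (A n r); have /andP[q0 q1] := th01 (B n r).
  have lp := L0 r r0; have l1 := lg_ge1 r0.
  have d0 : 0 < r * (1 + r) * lg r by rewrite !mulr_gt0// addr_gt0.
  have A'0 : 0 <= A' r by rewrite invr_ge0 ltW.
  rewrite (le_trans (ler_normD _ _))//.
  have h2 : `|th (A n r) * (derive1 th (B n r) * -1)| <= K.
    rewrite !normrM normrN1 mulr1 (ger0_norm p0).
    by rewrite (le_trans _ (thK' (B n r)))// ler_piMl.
  have h1 : `|derive1 th (A n r) * A' r * th (B n r)| <= K * A' r.
    rewrite !normrM (ger0_norm q0) (ger0_norm A'0).
    apply: (@le_trans _ _ (`|derive1 th (A n r)| * A' r)).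
      by rewrite ler_piMr// mulr_ge0.
    by rewrite ler_wpM2r.
  apply: le_trans (lerD h1 h2) _.
  rewrite -[X in _ + X](mulr1 K) -mulrDr -mulrA mulrCA ler_wpM2l ?(ltW K_gt0)//.
  have rl0 : 0 < r * lg r by rewrite mulr_gt0.
  have A'rho : A' r <= (r * lg r)^-1.
    rewrite lef_pV2 ?posrE// ?mulr_gt0// ?addr_gt0//.
    by rewrite mulrAC ler_peMr ?(ltW rl0)// lerDl ltW.
  rewrite indicE; have [_|] := boolP (r \in _).
    by rewrite mul1r; have := invr_ge0 (r * lg r); rewrite (ltW rl0); lra.
  rewrite notin_setE /= in_itv /= r0 => /negP; rewrite -ltNge => r1.
  have : (r * lg r)^-1 <= 1 by rewrite invf_le1//; nra.
  lra.
- move=> r r0; apply: (@cvg_trans _ ((fun=> 1 : R) @ \oo)); last exact: cvg_cst.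
  apply: near_eq_cvg; near=> n; rewrite chiE// /X !th1 ?mulr1//.
    by apply: ltW; near: n; exact: N1.
  by apply: ltW; near: n; exact: N1.
- move=> r r0; apply: (@cvg_trans _ ((fun=> 0 : R) @ \oo)); last exact: cvg_cst.
  apply: near_eq_cvg; near=> n; rewrite chi'E// /X' !th'1 ?mul0r ?mulr0 ?addr0//.
    by near: n; exact: N1.
  by near: n; exact: N1.
Unshelve. all: by end_near. Qed.

(** Dominated convergence; the hypothesis on [f] in the second part is the
    conclusion of [log_hardy]. *)
Lemma cutoff_cv (chi : nat -> R -> R) (K : R) f : 0 < K ->
  (forall n, C1c (chi n)) -> (forall n r, 0 < r -> 0 <= chi n r <= 1) ->
  (forall n r, 0 < r -> `|derive1 (chi n) r| <= K * (ind `]0, 1] r * (r * lg r)^-1 + 1)) ->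
  (forall r, 0 < r -> chi n r @[n --> \oo] --> (1 : R)) ->
  (forall r, 0 < r -> derive1 (chi n) r @[n --> \oo] --> (0 : R)) ->
  rL2 f ->
  cvL2 (fun n r => chi n r * f r) f /\
  (rL2 (fun r => ind `]0, 1] r * ((r * lg r)^-1 * f r)) ->
   (forall n, rL2 (fun r => derive1 (chi n) r * f r)) /\
   cvL2 (fun n r => derive1 (chi n) r * f r) (fun=> 0)).
Proof.
move=> K0 cc c01 c' c1 c0 f2; have [mf _] := f2.
have n2 g : rL2 g -> rL2 (fun r => `|g r|).
  move=> g2; apply: (rL2_le _ g2); last by move=> r _; rewrite normr_id.
  by apply: measurableT_comp => //; case: g2.
have mchi n : measurable_fun H (chi n).
  by apply: continuous_measurable_half; exact: C1c_continuous.
have mchi' n : measurable_fun H (derive1 (chi n)).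
  by apply: continuous_measurable_half; case: (cc n).
split.
  apply: (cv_dominated_fun _ mf (n2 _ f2)) => [n|n r r0|r r0].
  - exact: measurable_funM.
  - have /andP[p q] := c01 n r r0.
    rewrite -{2}(mul1r (f r)) -mulrBl normrM ler_piMl//.
    by rewrite ler_norml; apply/andP; split; lra.
  - by rewrite -[X in _ --> X]mul1r; apply: cvgM; [exact: c1|exact: cvg_cst].
move=> fl; split.
  by move=> n; apply: (locL2_rL2 f2); [case: (cc n)|apply: compact_supp_derive; case: (cc n)].
pose h r := K * (`|ind `]0, 1] r * ((r * lg r)^-1 * f r)| + `|f r|).
have h2 : rL2 h by apply: rL2Z; apply: rL2D; exact: n2.
apply: (cv_dominated_fun _ _ h2) => [n||n r r0|r r0].
- exact: measurable_funM.
- exact: measurable_cst.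
- rewrite subr0 normrM /h.
  apply: le_trans (ler_wpM2r (normr_ge0 _) (c' n r r0)) _.
  rewrite -mulrA ler_wpM2l ?(ltW K0)// mulrDl mul1r lerD2r mulrA normrM ler_wpM2r//.
  exact: ler_norm.
- by rewrite -[X in _ --> X](mul0r (f r)); apply: cvgM; [exact: c0|exact: cvg_cst].
Qed.

(** * The real Dirac system *)

Context (m p q kap : R).

(** The real form of the Dirac expression: [p] and [q] are the diagonal Coulomb
    couplings [nu + mu] and [nu - mu], and [kap] is [k + lambda]. *)
Definition dir1 (f1 f2 : R -> R) r : R :=
  (m + p / r) * f1 r + (- derive1 f2 r + kap / r * f2 r).
Definition dir2 (f1 f2 : R -> R) r : R :=
  (derive1 f1 r + kap / r * f1 r) + (- m + q / r) * f2 r.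

(** The first-order system [dir1 a1 a2 = b1], [dir2 a1 a2 = b2], solved for the
    derivatives of [a1] and [a2]. *)
Definition weak_dirac (a1 a2 b1 b2 : R -> R) : Prop :=
  [/\ rL2 a1 /\ rL2 a2, rL2 b1 /\ rL2 b2,
      weak_deriv a1 (fun r => b2 r - kap / r * a1 r - (- m + q / r) * a2 r) &
      weak_deriv a2 (fun r => (m + p / r) * a1 r + kap / r * a2 r - b1 r)].

Lemma locL2_coef c d f : rL2 f -> locL2 (fun r => (c + d / r) * f r).
Proof.
move=> f2; have fl := locL2_rL2 f2.
by apply: eq_locL2 (locL2D (locL2Z c fl) (locL2_div d fl)) => r _; rewrite mulrDl.
Qed.

Lemma weak_dirac_loc (a1 a2 b1 b2 : R -> R) : weak_dirac a1 a2 b1 b2 ->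
  locL2 (fun r => b2 r - kap / r * a1 r - (- m + q / r) * a2 r) /\
  locL2 (fun r => (m + p / r) * a1 r + kap / r * a2 r - b1 r).
Proof.
move=> [[a12 a22] [b12 b22] _ _]; split.
  apply: eq_locL2 (locL2D (locL2D (locL2_rL2 b22) (locL2_coef 0 (- kap) a12))
    (locL2_coef m (- q) a22)) => r _; by ring.
apply: eq_locL2 (locL2D (locL2D (locL2_coef m p a12) (locL2_coef 0 kap a22))
  (locL2_rL2 (rL2N b12))) => r _; by ring.
Qed.

(** The system reads [r a' = M a + r (...)] with [M = [[- kap, - q], [p, kap]]],
    and [M ^+ 2 = gam ^+ 2].  Hence [(M + s gam) a], whose components appear
    below, satisfies [r w' = s gam w + r (...)]. *)
Lemma weak_dirac_scalar (a1 a2 b1 b2 : R -> R) (gam s : R) : weak_dirac a1 a2 b1 b2 ->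
  gam ^+ 2 = kap ^+ 2 - p * q -> s ^+ 2 = 1 ->
  (exists2 g, rL2 g & weak_deriv (fun r => (s * gam - kap) * a1 r - q * a2 r)
     (fun r => (s * gam) / r * ((s * gam - kap) * a1 r - q * a2 r) + g r)) /\
  (exists2 g, rL2 g & weak_deriv (fun r => p * a1 r + (s * gam + kap) * a2 r)
     (fun r => (s * gam) / r * (p * a1 r + (s * gam + kap) * a2 r) + g r)).
Proof.
move=> S g2 s2; have [l1 l2] := weak_dirac_loc S.
have [[a12 a22] [b12 b22] w1 w2] := S.
have al1 := locL2_rL2 a12; have al2 := locL2_rL2 a22.
have sg : (s * gam) ^+ 2 = kap ^+ 2 - p * q by rewrite exprMn s2 mul1r.
have comb c d := wdD (locL2Z c al1) (locL2Z c l1) (locL2Z d al2) (locL2Z d l2)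
    (wdZ c al1 l1 w1) (wdZ d al2 l2 w2).
have key (x y z t : R) r : x ^+ 2 = y -> (x * x - y) / r * z + t = t.
  by move=> <-; rewrite -expr2 subrr !mul0r add0r.
split.
- exists (fun r => (s * gam - kap) * (b2 r + m * a2 r) - q * (m * a1 r - b1 r)).
    by apply: rL2B; apply: rL2Z; [apply: rL2D => //; exact: rL2Z|apply: rL2B => //; exact: rL2Z].
  apply: eq_wd (comb (s * gam - kap) (- q)) => r _; first by ring.
  by rewrite -[RHS](key _ _ (- a1 r) _ r sg); ring.
- exists (fun r => p * (b2 r + m * a2 r) + (s * gam + kap) * (m * a1 r - b1 r)).
    by apply: rL2D; apply: rL2Z; [apply: rL2D => //; exact: rL2Z|apply: rL2B => //; exact: rL2Z].
  apply: eq_wd (comb p (s * gam + kap)) => r _; first by ring.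
  by rewrite -[RHS](key _ _ (- a2 r) _ r sg); ring.
Qed.

(** The two choices of sign in [weak_dirac_scalar] recover [a], because
    [(M + gam) a - (M - gam) a = 2 gam a]. *)
Lemma weak_dirac_comb (T : (R -> R) -> Prop) (a1 a2 b1 b2 : R -> R) (gam : R) :
  weak_dirac a1 a2 b1 b2 -> gam ^+ 2 = kap ^+ 2 - p * q -> 0 < gam ->
  (forall f g c d, T f -> T g -> T (fun r => c * f r + d * g r)) ->
  (forall f g s, rL2 f -> rL2 g -> s ^+ 2 = 1 -> weak_deriv f (fun r => (s * gam) / r * f r + g r) -> T f) ->
  T a1 /\ T a2.
Proof.
move=> S g2 g0 Tlin Tsol; have [[a12 a22] _ _ _] := S.
have s1 : (1 : R) ^+ 2 = 1 by rewrite expr1n.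
have sN1 : (-1 : R) ^+ 2 = 1 by rewrite sqrrN expr1n.
have [[g1 g12 w1] [h1 h12 v1]] := weak_dirac_scalar S g2 s1.
have [[g1' g12' w1'] [h1' h12' v1']] := weak_dirac_scalar S g2 sN1.
have L1 s : rL2 (fun r => (s * gam - kap) * a1 r - q * a2 r) by apply: rL2B; exact: rL2Z.
have L2 s : rL2 (fun r => p * a1 r + (s * gam + kap) * a2 r) by apply: rL2D; exact: rL2Z.
have t1 := Tsol _ _ _ (L1 1) g12 s1 w1; have t1' := Tsol _ _ _ (L1 (-1)) g12' sN1 w1'.
have t2 := Tsol _ _ _ (L2 1) h12 s1 v1; have t2' := Tsol _ _ _ (L2 (-1)) h12' sN1 v1'.
have gn : gam != 0 by rewrite gt_eqF.
split.
  have := Tlin _ _ (2 * gam)^-1 (- (2 * gam)^-1) t1 t1'.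
  by congr T; apply/funext => r; field.
have := Tlin _ _ (2 * gam)^-1 (- (2 * gam)^-1) t2 t2'.
by congr T; apply/funext => r; field.
Qed.

Lemma weak_dirac_hardy (a1 a2 b1 b2 : R -> R) (gam : R) : weak_dirac a1 a2 b1 b2 ->
  gam ^+ 2 = kap ^+ 2 - p * q -> 2^-1 < gam ->
  rL2 (fun r => a1 r / r) /\ rL2 (fun r => a2 r / r).
Proof.
move=> S g2 g0.
apply: (@weak_dirac_comb (fun f => rL2 (fun r => f r / r)) _ _ _ _ _ S g2).
- by lra.
- move=> f g c d f2 g2'; apply: eq_rL2 (rL2D (rL2Z c f2) (rL2Z d g2')) => r _; by ring.
- move=> f g s f2 g2' s2; apply: (hardy f2 g2' s2).
  by rewrite mulrA -expr2 s2 mul1r.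
Qed.

Lemma weak_dirac_log_hardy (a1 a2 b1 b2 : R -> R) (gam : R) : weak_dirac a1 a2 b1 b2 ->
  gam ^+ 2 = kap ^+ 2 - p * q -> 2^-1 <= gam ->
  rL2 (fun r => ind `]0, 1] r * ((r * lg r)^-1 * a1 r)) /\
  rL2 (fun r => ind `]0, 1] r * ((r * lg r)^-1 * a2 r)).
Proof.
move=> S g2 g0.
apply: (@weak_dirac_comb (fun f => rL2 (fun r => ind `]0, 1] r * ((r * lg r)^-1 * f r))) _ _ _ _ _ S g2).
- by lra.
- move=> f g c d f2 g2'; apply: eq_rL2 (rL2D (rL2Z c f2) (rL2Z d g2')) => r _; by ring.
- move=> f g s f2 g2' s2; apply: (log_hardy f2 g2' s2).
  by rewrite mulrA -expr2 s2 mul1r.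
Qed.

(** * Approximation of weak solutions by test functions *)

(** The closure of the Dirac operator on real test functions, with the
    approximating sequence replaced by a tolerance. *)
Definition dirac_clos (a1 a2 b1 b2 : R -> R) : Prop := forall e : R, 0 < e ->
  exists f1 f2, [/\ rtest f1 /\ rtest f2,
    sqnrm (fun r => f1 r - a1 r) < e /\ sqnrm (fun r => f2 r - a2 r) < e,
    rL2 (dir1 f1 f2) /\ rL2 (dir2 f1 f2) &
    sqnrm (fun r => dir1 f1 f2 r - b1 r) < e /\ sqnrm (fun r => dir2 f1 f2 r - b2 r) < e].

Lemma nrm_triangle f g h (e : R) : rL2 f -> rL2 g -> rL2 h ->
  sqnrm (fun r => f r - g r) < e / 4 -> sqnrm (fun r => g r - h r) < e / 4 ->
  sqnrm (fun r => f r - h r) < e.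
Proof.
move=> f2 g2 h2 fg gh; rewrite (@eq_nrm _ _ (fun r => (f r - g r) + (g r - h r))); last first.
  by move=> r _; ring.
by apply: le_lt_trans (nrmD_le (rL2B f2 g2) (rL2B g2 h2)) _; lra.
Qed.

Lemma dirac_clos_cv (A1 A2 B1 B2 : nat -> R -> R) (a1 a2 b1 b2 : R -> R) :
  (forall n, rL2 (A1 n)) -> (forall n, rL2 (A2 n)) -> (forall n, rL2 (B1 n)) -> (forall n, rL2 (B2 n)) ->
  rL2 a1 -> rL2 a2 -> rL2 b1 -> rL2 b2 -> cvL2 A1 a1 -> cvL2 A2 a2 -> cvL2 B1 b1 -> cvL2 B2 b2 ->
  (forall n, dirac_clos (A1 n) (A2 n) (B1 n) (B2 n)) -> dirac_clos a1 a2 b1 b2.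
Proof.
move=> A12 A22 B12 B22 a12 a22 b12 b22 ca1 ca2 cb1 cb2 Cn e e0.
have e4 : 0 < e / 4 by rewrite divr_gt0.
near \oo => n.
have [f1 [f2 [[t1 t2] [d1 d2] [D1 D2] [d3 d4]]]] := Cn n _ e4.
exists f1, f2; split => //; split.
- apply: nrm_triangle d1 _ => //; [exact: rtest_rL2|near: n; exact: (cvP ca1)].
- apply: nrm_triangle d2 _ => //; [exact: rtest_rL2|near: n; exact: (cvP ca2)].
- apply: nrm_triangle d3 _ => //; near: n; exact: (cvP cb1).
- apply: nrm_triangle d4 _ => //; near: n; exact: (cvP cb2).
Unshelve. all: by end_near. Qed.

(** On a support that avoids the origin, [y / r] is a bounded coefficient. *)
Lemma rL2_coef_supp c d f : 0 < c -> supp_in f c d -> rL2 f ->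
  forall y : R, rL2 (fun r => y / r * f r) /\
    sqnrm (fun r => y / r * f r) <= (y / c) ^+ 2 * sqnrm f.
Proof.
move=> c0 fs f2 y; have [mf _] := f2.
have myf : measurable_fun H (fun r => y / r * f r).
  by apply: measurable_funM => //; apply: measurable_funM => //; exact: measurable_inv.
have le r : 0 < r -> `|y / r * f r| <= `|y / c * f r|.
  move=> r0; have [->|/fs/andP[cr _]] := eqVneq (f r) 0; first by rewrite !mulr0.
  rewrite !normrM ler_wpM2r// ler_wpM2l//.
  by rewrite !ger0_norm ?invr_ge0 ?(ltW r0) ?(ltW c0)// lef_pV2 ?posrE.
have h2 := rL2_le myf (rL2Z (y / c) f2) le; split => //.
by rewrite -nrmZ//; apply: nrm_le => //; exact: rL2Z.
Qed.

Lemma cv_coef_supp (U : nat -> R -> R) u c d (y : R) : 0 < c ->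
  (forall n, supp_in (U n) c d) -> supp_in u c d -> (forall n, rL2 (U n)) -> rL2 u -> cvL2 U u ->
  cvL2 (fun n r => y / r * U n r) (fun r => y / r * u r).
Proof.
move=> c0 Us us U2 u2 cU.
apply: (@cv_le _ _ _ (fun n => (y / c) ^+ 2 * sqnrm (fun r => U n r - u r))); last first.
  by rewrite -[X in _ --> X](mulr0 ((y / c) ^+ 2)); apply: cvgM => //; exact: cvg_cst.
apply: nearW => n; have Uu2 := rL2B (U2 n) u2.
have Uus : supp_in (fun r => U n r - u r) c d.
  move=> x h; have [e|/Us//] := eqVneq (U n x) 0; apply: us.
  by move: h; rewrite e sub0r oppr_eq0.
have [_ h] := rL2_coef_supp c0 Uus Uu2 y; apply: le_trans h.
by rewrite le_eqVlt; apply/orP; left; apply/eqP; apply: eq_nrm => r _; ring.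
Qed.

Lemma dirac_clos_compact (a1 a2 v1 v2 : R -> R) c d : 0 < c -> c <= d ->
  rL2 a1 -> rL2 a2 -> rL2 v1 -> rL2 v2 ->
  supp_in a1 c d -> supp_in a2 c d -> supp_in v1 c d -> supp_in v2 c d ->
  weak_deriv a1 v1 -> weak_deriv a2 v2 ->
  dirac_clos a1 a2 (fun r => (m + p / r) * a1 r + (- v2 r + kap / r * a2 r))
    (fun r => (v1 r + kap / r * a1 r) + (- m + q / r) * a2 r).
Proof.
move=> c0 cd a12 a22 v12 v22 a1s a2s v1s v2s w1 w2.
have [U [Ut [cU cU0 [dU Us]] Ucv U'cv]] := wd_approx c0 cd a12 v12 a1s v1s w1.
have [V [Vt [cV cV0 [dV Vs]] Vcv V'cv]] := wd_approx c0 cd a22 v22 a2s v2s w2.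
pose c' := Num.min c (Num.min cU cV); pose d' := Num.max d (Num.max dU dV).
have c'0 : 0 < c' by rewrite !lt_min c0 cU0 cV0.
have U2 n := rtest_rL2 (Ut n); have V2 n := rtest_rL2 (Vt n).
have U'2 n := rtest_rL2 (rtest_derive (Ut n)); have V'2 n := rtest_rL2 (rtest_derive (Vt n)).
have sup f x y : c' <= x -> y <= d' -> supp_in f x y -> supp_in f c' d'.
  by move=> *; apply: supp_in_le; eassumption.
have {}a1s : supp_in a1 c' d' by apply: sup a1s; rewrite ?ge_min ?le_max ?lexx.
have {}a2s : supp_in a2 c' d' by apply: sup a2s; rewrite ?ge_min ?le_max ?lexx.
have {}Us n : supp_in (U n) c' d' by apply: sup (Us n); rewrite ?ge_min ?le_max ?lexx ?orbT.
have {}Vs n : supp_in (V n) c' d' by apply: sup (Vs n); rewrite ?ge_min ?le_max ?lexx ?orbT.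
have cf f y : supp_in f c' d' -> rL2 f -> rL2 (fun r => y / r * f r).
  by move=> fs f2; exact: (rL2_coef_supp c'0 fs f2 y).1.
have cvU y := @cv_coef_supp U a1 c' d' y c'0 Us a1s U2 a12 Ucv.
have cvV y := @cv_coef_supp V a2 c' d' y c'0 Vs a2s V2 a22 Vcv.
pose X n r := m * U n r + p / r * U n r + (-1 * derive1 (V n) r + kap / r * V n r).
pose x r := m * a1 r + p / r * a1 r + (-1 * v2 r + kap / r * a2 r).
pose Y n r := derive1 (U n) r + kap / r * U n r + (- m * V n r + q / r * V n r).
pose y r := v1 r + kap / r * a1 r + (- m * a2 r + q / r * a2 r).
have X2 n : rL2 (X n) by apply: rL2D; apply: rL2D; try exact: rL2Z; exact: cf.
have Y2 n : rL2 (Y n) by apply: rL2D; apply: rL2D => //; try exact: rL2Z; exact: cf.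
have x2 : rL2 x by apply: rL2D; apply: rL2D; try exact: rL2Z; exact: cf.
have y2 : rL2 y by apply: rL2D; apply: rL2D => //; try exact: rL2Z; exact: cf.
have Xcv : cvL2 X x.
  apply: cvD2.
  - by move=> n; apply: rL2D; [exact: rL2Z|exact: cf].
  - by move=> n; apply: rL2D; [exact: rL2Z|exact: cf].
  - by apply: rL2D; [exact: rL2Z|exact: cf].
  - by apply: rL2D; [exact: rL2Z|exact: cf].
  - by apply: cvD2 => //; try (by move=> n; exact: rL2Z); try (by move=> n; exact: cf);
      [exact: rL2Z|exact: cf|exact: cvZ].
  - by apply: cvD2 => //; try (by move=> n; exact: rL2Z); try (by move=> n; exact: cf);
      [exact: rL2Z|exact: cf|exact: cvZ].
have Ycv : cvL2 Y y.
  apply: cvD2.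
  - by move=> n; apply: rL2D => //; exact: cf.
  - by move=> n; apply: rL2D; [exact: rL2Z|exact: cf].
  - by apply: rL2D => //; exact: cf.
  - by apply: rL2D; [exact: rL2Z|exact: cf].
  - by apply: cvD2 => //; try (by move=> n; exact: cf); exact: cf.
  - by apply: cvD2 => //; try (by move=> n; exact: rL2Z); try (by move=> n; exact: cf);
      [exact: rL2Z|exact: cf|exact: cvZ].
have eX n r : 0 < r -> X n r = dir1 (U n) (V n) r by move=> _; rewrite /X /dir1; ring.
have eY n r : 0 < r -> Y n r = dir2 (U n) (V n) r by move=> _; rewrite /Y /dir2; ring.
move=> e e0; near \oo => n.
exists (U n), (V n); split => //; split.
- near: n; exact: (cvP Ucv).
- near: n; exact: (cvP Vcv).
- exact: eq_rL2 (eX n) (X2 n).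
- exact: eq_rL2 (eY n) (Y2 n).
- rewrite -(@eq_nrm _ (fun r => X n r - x r)); first by near: n; exact: (cvP Xcv).
  by move=> r r0; rewrite eX// /x; ring.
- rewrite -(@eq_nrm _ (fun r => Y n r - y r)); first by near: n; exact: (cvP Ycv).
  by move=> r r0; rewrite eY// /y; ring.
Unshelve. all: by end_near. Qed.

(** Multiply by the cutoffs of [cutoff_seq]: the commutator [chi' a] tends to 0
    in L2 by the logarithmic Hardy inequality, and the compactly supported case
    applies to the products. *)
Lemma weak_dirac_clos (a1 a2 b1 b2 : R -> R) (gam : R) : weak_dirac a1 a2 b1 b2 ->
  gam ^+ 2 = kap ^+ 2 - p * q -> 2^-1 <= gam -> dirac_clos a1 a2 b1 b2.
Proof.
move=> S g2 g0; have [h1 h2] := weak_dirac_log_hardy S g2 g0.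
have [[a12 a22] [b12 b22] w1 w2] := S; have [l1 l2] := weak_dirac_loc S.
set v1 := (fun r => b2 r - _ - _) in w1 l1; set v2 := (fun r => _ - b1 r) in w2 l2.
have [K K0 [chi [cc c01 c' c1 c0]]] := cutoff_seq.
have [ca1 /(_ h1)[D12 Dc1]] := cutoff_cv K0 cc c01 c' c1 c0 a12.
have [ca2 /(_ h2)[D22 Dc2]] := cutoff_cv K0 cc c01 c' c1 c0 a22.
have [cb1 _] := cutoff_cv K0 cc c01 c' c1 c0 b12.
have [cb2 _] := cutoff_cv K0 cc c01 c' c1 c0 b22.
have c2 n f : rL2 f -> rL2 (fun r => chi n r * f r).
  by move=> f2; apply: (locL2_rL2 f2); [exact: C1c_continuous|case: (cc n)].
(* The image of [chi n * a] under the system. *)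
pose B1 n r := chi n r * b1 r + -1 * (derive1 (chi n) r * a2 r).
pose B2 n r := chi n r * b2 r + derive1 (chi n) r * a1 r.
apply: (@dirac_clos_cv (fun n r => chi n r * a1 r) (fun n r => chi n r * a2 r) B1 B2) => //.
- by move=> n; exact: c2.
- by move=> n; exact: c2.
- by move=> n; apply: rL2D; [exact: c2|exact: rL2Z].
- by move=> n; apply: rL2D; [exact: c2|exact: D12].
- have := cvD2 (fun n => c2 n _ b12) (fun n => rL2Z (-1) (D22 n)) b12 (rL2Z (-1) (@rL20 R)) cb1 (cvZ (-1) D22 (@rL20 R) Dc2).
  by apply: eq_cv => // r _; rewrite mulr0 addr0.
- have := cvD2 (fun n => c2 n _ b22) D12 b22 (@rL20 R) cb2 Dc1.
  by apply: eq_cv => // r _; rewrite addr0.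
move=> n; have [_ cn' sn] := cc n; have [c [d [cp cs]]] := sn.
pose d' := Num.max c d.
have cs' : supp_in (chi n) c d' by apply: supp_in_le cs => //; rewrite le_max lexx orbT.
have cs'' := supp_derive cs'.
have V1 : rL2 (fun r => derive1 (chi n) r * a1 r + chi n r * v1 r).
  by apply: rL2D; [exact: D12|apply: l1 => //; exact: C1c_continuous].
have V2 : rL2 (fun r => derive1 (chi n) r * a2 r + chi n r * v2 r).
  by apply: rL2D; [exact: D22|apply: l2 => //; exact: C1c_continuous].
have sM f g : supp_in f c d' -> supp_in (fun r => f r * g r) c d'.
  by move=> fs x; rewrite mulf_eq0 negb_or => /andP[/fs].
have sD f g : supp_in f c d' -> supp_in g c d' -> supp_in (fun r => f r + g r) c d'.
  move=> fs gs x; have [e|/fs//] := eqVneq (f x) 0; by rewrite e add0r => /gs.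
have cd' : c <= d' by rewrite le_max lexx.
have := dirac_clos_compact cp cd' (c2 n _ a12) (c2 n _ a22) V1 V2 (sM _ _ cs') (sM _ _ cs')
  (sD _ _ (sM _ _ cs'') (sM _ _ cs')) (sD _ _ (sM _ _ cs'') (sM _ _ cs'))
  (wd_mulC1 (cc n) (locL2_rL2 a12) l1 w1) (wd_mulC1 (cc n) (locL2_rL2 a22) l2 w2).
congr dirac_clos; apply/funext => r; rewrite /B1 /B2 /v1 /v2; ring.
Qed.

End System.

(** * Real and imaginary parts *)

Section ComplexBridge.
Context {R : realType}.
Local Open Scope complex_scope.
Notation H := (@half_line R).
Implicit Types (u w phi : R -> R[i]) (f g : spinor R).

Definition re u : R -> R := fun r => complex.Re (u r).
Definition im u : R -> R := fun r => complex.Im (u r).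
Definition cplx (a b : R -> R) : R -> R[i] := fun r => a r +i* b r.

Lemma ReM (x y : R[i]) : complex.Re (x * y) =
  complex.Re x * complex.Re y - complex.Im x * complex.Im y.
Proof. by case: x; case: y. Qed.

Lemma ImM (x y : R[i]) : complex.Im (x * y) =
  complex.Re x * complex.Im y + complex.Im x * complex.Re y.
Proof. by case: x; case: y. Qed.

Lemma ReD (x y : R[i]) : complex.Re (x + y) = complex.Re x + complex.Re y.
Proof. by case: x; case: y. Qed.

Lemma ImD (x y : R[i]) : complex.Im (x + y) = complex.Im x + complex.Im y.
Proof. by case: x; case: y. Qed.

Lemma ReN (x : R[i]) : complex.Re (- x) = - complex.Re x.
Proof. by case: x. Qed.

Lemma ImN (x : R[i]) : complex.Im (- x) = - complex.Im x.
Proof. by case: x. Qed.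

Lemma ReJ (x : R[i]) : complex.Re (x^*) = complex.Re x.
Proof. by case: x. Qed.

Lemma ImJ (x : R[i]) : complex.Im (x^*) = - complex.Im x.
Proof. by case: x. Qed.

Definition cE := (ReM, ImM, ReD, ImD, ReN, ImN, ReJ, ImJ).

Lemma complex_eqP (x y : R[i]) : complex.Re x = complex.Re y ->
  complex.Im x = complex.Im y -> x = y.
Proof. by case: x; case: y => a b c d /= -> ->. Qed.

Lemma scalar_L2P u : scalar_L2 u <-> rL2 (re u) /\ rL2 (im u).
Proof.
split.
  move=> [[mr mi] fin].
  have mS : measurable_fun H (fun r => sqnormc (u r)).
    by apply: measurable_funD; exact: measurable_funX.
  have iS : integ (fun r => sqnormc (u r)).
    apply/integrableP; split; first exact/measurable_EFinP.
    apply: le_lt_trans fin; rewrite le_eqVlt; apply/orP; left; apply/eqP.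
    by apply: eq_integral => r _ /=; rewrite ger0_norm// addr_ge0 ?sqr_ge0.
  split; split=> //; apply: (integ_le _ iS); try exact: measurable_funX.
    by move=> r _; rewrite ger0_norm ?sqr_ge0// lerDl sqr_ge0.
  by move=> r _; rewrite ger0_norm ?sqr_ge0// lerDr sqr_ge0.
move=> [[mr ir] [mi ii]]; split; first by [].
rewrite /scalar_sqnorm (EFin_rint (integD ir ii)); exact: ltry.
Qed.

Lemma scalar_sqnormE u : scalar_L2 u -> scalar_sqnorm u = (sqnrm (re u) + sqnrm (im u))%:E.
Proof.
move=> /scalar_L2P[[_ ir] [_ ii]].
by rewrite /scalar_sqnorm (EFin_rint (integD ir ii)) rintD.
Qed.

Lemma L2P f : L2 f <-> (rL2 (re f.1) /\ rL2 (im f.1)) /\ (rL2 (re f.2) /\ rL2 (im f.2)).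
Proof. by split=> -[/scalar_L2P h1 /scalar_L2P h2]. Qed.

Lemma L2B f g : L2 f -> L2 g -> L2 (f - g).
Proof.
move=> /L2P[[f1 f2] [f3 f4]] /L2P[[g1 g2] [g3 g4]]; apply/L2P; split; split.
- by apply: eq_rL2 (rL2B f1 g1) => r _; rewrite /re /= !cE.
- by apply: eq_rL2 (rL2B f2 g2) => r _; rewrite /im /= !cE.
- by apply: eq_rL2 (rL2B f3 g3) => r _; rewrite /re /= !cE.
- by apply: eq_rL2 (rL2B f4 g4) => r _; rewrite /im /= !cE.
Qed.

Definition cv4 (F : nat -> spinor R) f : Prop :=
  [/\ cvL2 (fun n => re (F n).1) (re f.1), cvL2 (fun n => im (F n).1) (im f.1),
      cvL2 (fun n => re (F n).2) (re f.2) & cvL2 (fun n => im (F n).2) (im f.2)].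

Lemma sqnorm_sub f g : L2 f -> L2 g -> sqnorm (f - g) =
  (sqnrm (fun r => re f.1 r - re g.1 r) + sqnrm (fun r => im f.1 r - im g.1 r) +
   (sqnrm (fun r => re f.2 r - re g.2 r) + sqnrm (fun r => im f.2 r - im g.2 r)))%:E.
Proof.
move=> f2 g2; have [h1 h2] := L2B f2 g2.
rewrite /sqnorm !scalar_sqnormE// -EFinD; congr (_%:E); congr (_ + _); congr (_ + _);
  by apply: eq_nrm => r _; rewrite /re /im /= !cE.
Qed.

Lemma L2_cvgP (F : nat -> spinor R) f : (forall n, L2 (F n)) -> L2 f ->
  L2_cvg F f <-> cv4 F f.
Proof.
move=> F2 f2; rewrite /L2_cvg.
pose s n : R := sqnrm (fun r => re (F n).1 r - re f.1 r) + sqnrm (fun r => im (F n).1 r - im f.1 r) +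
   (sqnrm (fun r => re (F n).2 r - re f.2 r) + sqnrm (fun r => im (F n).2 r - im f.2 r)).
rewrite (_ : (fun n => sqnorm (F n - f)) = (fun n => (s n)%:E)); last first.
  by apply/funext => n; rewrite sqnorm_sub.
split.
  move=> s0.
  have s0' : s @ \oo --> (0 : R) by exact: (@fine_cvg _ _ _ _ _ 0 s0).
  split; apply: (cv_le _ s0'); apply: nearW => n; rewrite /s;
  set x1 := sqnrm _; set x2 := sqnrm _; set x3 := sqnrm _; set x4 := sqnrm _;
  have := nrm_ge0 (fun r => re (F n).1 r - re f.1 r); have := nrm_ge0 (fun r => im (F n).1 r - im f.1 r);
  have := nrm_ge0 (fun r => re (F n).2 r - re f.2 r); have := nrm_ge0 (fun r => im (F n).2 r - im f.2 r);
  rewrite -/x1 -/x2 -/x3 -/x4; lra.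
move=> [c1 c2 c3 c4]; apply: cvg_EFin; first exact: nearW.
rewrite (_ : 0 = 0 + 0 + (0 + 0)); last by rewrite !addr0.
by apply: cvgD; apply: cvgD.
Qed.

Definition ip (a b : R -> R) : R := rint (fun r => a r * b r).

Lemma inner_re f g : L2 f -> L2 g -> complex.Re (inner f g) =
  ip (re f.1) (re g.1) + ip (im f.1) (im g.1) + (ip (re f.2) (re g.2) + ip (im f.2) (im g.2)).
Proof.
move=> /L2P[[f1 f2] [f3 f4]] /L2P[[g1 g2] [g3 g4]].
have i1 := rL2_mul f1 g1; have i2 := rL2_mul f2 g2.
have i3 := rL2_mul f3 g3; have i4 := rL2_mul f4 g4.
rewrite /ip -!rintD//; [|exact: integD|exact: integD].
by apply: eq_rint => r _; rewrite !cE /re /im; ring.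
Qed.

Lemma inner_im f g : L2 f -> L2 g -> complex.Im (inner f g) =
  ip (im f.1) (re g.1) - ip (re f.1) (im g.1) + (ip (im f.2) (re g.2) - ip (re f.2) (im g.2)).
Proof.
move=> /L2P[[f1 f2] [f3 f4]] /L2P[[g1 g2] [g3 g4]].
have i1 := rL2_mul f2 g1; have i2 := rL2_mul f1 g2.
have i3 := rL2_mul f4 g3; have i4 := rL2_mul f3 g4.
rewrite /ip -!rintB//; rewrite -rintD//; [|exact: integB|exact: integB].
by apply: eq_rint => r _; rewrite !cE /re /im; ring.
Qed.

Lemma inner_lim (F G : nat -> spinor R) f g : (forall n, L2 (F n)) -> (forall n, L2 (G n)) ->
  L2 f -> L2 g -> L2_cvg F f -> L2_cvg G g ->
  complex.Re (inner (F n) (G n)) @[n --> \oo] --> complex.Re (inner f g) /\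
  complex.Im (inner (F n) (G n)) @[n --> \oo] --> complex.Im (inner f g).
Proof.
move=> F2 G2 f2 g2 /(L2_cvgP F2 f2)[F1 F2' F3 F4] /(L2_cvgP G2 g2)[G1 G2' G3 G4].
have lF n := (L2P (F n)).1 (F2 n); have lG n := (L2P (G n)).1 (G2 n).
have [[f1' f2'] [f3' f4']] := (L2P f).1 f2; have [[g1' g2'] [g3' g4']] := (L2P g).1 g2.
have a1 n : rL2 (re (F n).1) by case: (lF n) => -[].
have a2 n : rL2 (im (F n).1) by case: (lF n) => -[].
have a3 n : rL2 (re (F n).2) by case: (lF n) => _ [].
have a4 n : rL2 (im (F n).2) by case: (lF n) => _ [].
have b1 n : rL2 (re (G n).1) by case: (lG n) => -[].
have b2 n : rL2 (im (G n).1) by case: (lG n) => -[].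
have b3 n : rL2 (re (G n).2) by case: (lG n) => _ [].
have b4 n : rL2 (im (G n).2) by case: (lG n) => _ [].
split.
  rewrite inner_re// (_ : (fun n => complex.Re (inner (F n) (G n))) = (fun n =>
    ip (re (F n).1) (re (G n).1) + ip (im (F n).1) (im (G n).1) +
    (ip (re (F n).2) (re (G n).2) + ip (im (F n).2) (im (G n).2)))); last first.
    by apply/funext => n; rewrite inner_re.
  by apply: cvgD; apply: cvgD; exact: cv_rint.
rewrite inner_im// (_ : (fun n => complex.Im (inner (F n) (G n))) = (fun n =>
    ip (im (F n).1) (re (G n).1) - ip (re (F n).1) (im (G n).1) +
    (ip (im (F n).2) (re (G n).2) - ip (re (F n).2) (im (G n).2)))); last first.
  by apply/funext => n; rewrite inner_im.
by apply: cvgD; apply: cvgB; exact: cv_rint.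
Qed.

Lemma L2_cvg_cst f : L2 f -> L2_cvg (fun=> f) f.
Proof. by move=> f2; apply/L2_cvgP => //; split; exact: cv_cst. Qed.

Lemma test_funP phi : test_fun phi <-> rtest (re phi) /\ rtest (im phi).
Proof.
split.
  move=> [s1 s2 [a [b [a0 ab]]]]; split; split => //; exists a, b; split => // x h.
    by apply: ab; apply: contraNneq h => e; rewrite /re e.
  by apply: ab; apply: contraNneq h => e; rewrite /im e.
move=> [[s1 [a [b [a0 ab]]]] [s2 [c [d [c0 cd]]]]]; split => //.
exists (Num.min a c), (Num.max b d); split; first by rewrite lt_min a0.
move=> x h; have [e|/ab/andP[ax xb]] := eqVneq (re phi x) 0; last first.
  by rewrite ge_min ax/= le_max xb.
have /cd/andP[cx xd] : im phi x != 0.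
  by apply: contraNneq h => e'; apply/eqP/complex_eqP.
by rewrite ge_min cx orbT/= le_max xd orbT.
Qed.

Lemma test_fun_cplx (a b : R -> R) : rtest a -> rtest b -> test_fun (cplx a b).
Proof. by move=> ta tb; apply/test_funP. Qed.

End ComplexBridge.

(** * The adjoint and the closure of the Dirac operator *)

Section DiracBridge.
Context {R : realType} (m nu mu0 lambda : R) (k : int).
Local Open Scope complex_scope.
Implicit Types (u w phi : R -> R[i]) (f g : spinor R) (a b s t : R -> R).

Let p := nu + mu0.
Let q := nu - mu0.
Let kap : R := k%:~R + lambda.

Notation d1 := (dir1 m p kap).
Notation d2 := (dir2 m q kap).
Notation wdirac := (weak_dirac m p q kap).
Notation h := (dirac_min m nu mu0 lambda k).
Notation expr := (dirac_expr m nu mu0 lambda k).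

Lemma rL2_div_test (y : R) s : rtest s -> rL2 (fun r => y / r * s r).
Proof.
move=> st; have [_ [a [b [a0 ab]]]] := st.
exact: (rL2_coef_supp a0 ab (rtest_rL2 st) y).1.
Qed.

Lemma dir_rL2 s t : rtest s -> rtest t -> rL2 (d1 s t) /\ rL2 (d2 s t).
Proof.
move=> st tt; have s2 := rtest_rL2 st; have t2 := rtest_rL2 tt.
have s'2 := rtest_rL2 (rtest_derive st); have t'2 := rtest_rL2 (rtest_derive tt).
split.
  apply: eq_rL2 (rL2D (rL2D (rL2Z m s2) (rL2_div_test p st))
    (rL2D (rL2Z (-1) t'2) (rL2_div_test kap tt))) => r _.
  by rewrite /dir1; ring.
apply: eq_rL2 (rL2D (rL2D s'2 (rL2_div_test kap st))
    (rL2D (rL2Z (- m) t2) (rL2_div_test q tt))) => r _.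
by rewrite /dir2; ring.
Qed.

(** Expanding the pairing turns it into the difference of the two weak equations,
    tested against [s] and [t]; the two test functions can be chosen
    independently. *)
Lemma weak_dirac_dual a1 a2 b1 b2 : rL2 a1 -> rL2 a2 -> rL2 b1 -> rL2 b2 ->
  wdirac a1 a2 b1 b2 <->
  (forall s t, rtest s -> rtest t ->
    ip (d1 s t) a1 + ip (d2 s t) a2 = ip s b1 + ip t b2).
Proof.
move=> a12 a22 b12 b22.
have al1 := locL2_rL2 a12; have al2 := locL2_rL2 a22.
have key s t : rtest s -> rtest t ->
   (ip (d1 s t) a1 + ip (d2 s t) a2 - (ip s b1 + ip t b2)) =
   (rint (fun r => a2 r * derive1 s r) + rint (fun r => ((m + p / r) * a1 r + kap / r * a2 r - b1 r) * s r))
   - (rint (fun r => a1 r * derive1 t r) + rint (fun r => (b2 r - kap / r * a1 r - (- m + q / r) * a2 r) * t r)).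
  move=> st tt; have [D1 D2] := dir_rL2 st tt.
  have s2 := rtest_rL2 st; have t2 := rtest_rL2 tt.
  have s'2 := rtest_rL2 (rtest_derive st); have t'2 := rtest_rL2 (rtest_derive tt).
  have i1 : integ (fun r => ((m + p / r) * a1 r + kap / r * a2 r - b1 r) * s r).
    apply: eq_integ (integB (integD (integD (integZ m (rL2_mul a12 s2)) (rL2_mul (rL2_div_test p st) a12))
      (rL2_mul (rL2_div_test kap st) a22)) (rL2_mul b12 s2)) => r _; by ring.
  have i2 : integ (fun r => (b2 r - kap / r * a1 r - (- m + q / r) * a2 r) * t r).
    apply: eq_integ (integD (integB (rL2_mul b22 t2) (rL2_mul (rL2_div_test kap tt) a12))
      (integB (integZ m (rL2_mul a22 t2)) (rL2_mul (rL2_div_test q tt) a22))) => r _; by ring.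
  have j1 := rL2_mul a22 s'2; have j2 := rL2_mul a12 t'2.
  have e1 := rL2_mul D1 a12; have e2 := rL2_mul D2 a22.
  have e3 := rL2_mul s2 b12; have e4 := rL2_mul t2 b22.
  have E1 : ip (d1 s t) a1 + ip (d2 s t) a2 = rint (fun r => d1 s t r * a1 r + d2 s t r * a2 r).
    by rewrite rintD.
  have E2 : ip s b1 + ip t b2 = rint (fun r => s r * b1 r + t r * b2 r) by rewrite rintD.
  transitivity (rint (fun r => (d1 s t r * a1 r + d2 s t r * a2 r) - (s r * b1 r + t r * b2 r))).
    by rewrite E1 E2 rintB//; exact: integD.
  rewrite -[X in _ = X - _](rintD j1 i1) -[X in _ = _ - X](rintD j2 i2).
  rewrite -[RHS](rintB (integD j1 i1) (integD j2 i2)).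
  by apply: eq_rint => r _; rewrite /dir1 /dir2; ring.
split.
  move=> [_ _ w1 w2] s t st tt; apply/eqP; rewrite -subr_eq0 key//.
  by rewrite (w1 _ tt) (w2 _ st) !addNr subrr.
have d0 : derive1 (fun=> 0 : R) = (fun=> 0 : R).
  by apply: derive1_ext => x; exact: isd_cst.
move=> hyp; split=> //.
- move=> t tt; have := key _ _ (@rtest0 R) tt.
  rewrite hyp ?subrr//; last exact: rtest0.
  rewrite d0 !(@eq_rint R (fun r => _ * 0) (fun=> 0)) ?rint0 ?addr0 ?sub0r;
    try by move=> r _; rewrite mulr0.
  by move=> /esym/eqP; rewrite oppr_eq0 addr_eq0 => /eqP.
- move=> s st; have := key _ _ st (@rtest0 R).
  rewrite hyp ?subrr//; last exact: rtest0.
  rewrite d0 !(@eq_rint R (fun r => _ * 0) (fun=> 0)) ?rint0 ?addr0 ?subr0;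
    try by move=> r _; rewrite mulr0.
  by move=> /esym/eqP; rewrite addr_eq0 => /eqP.
Qed.

Lemma expr_re1 f r : re (expr f).1 r = d1 (re f.1) (re f.2) r.
Proof. by rewrite /re /dir1 /= !cE /= !mul0r !subr0. Qed.

Lemma expr_im1 f r : im (expr f).1 r = d1 (im f.1) (im f.2) r.
Proof. by rewrite /im /dir1 /= !cE /= !mul0r !addr0. Qed.

Lemma expr_re2 f r : re (expr f).2 r = d2 (re f.1) (re f.2) r.
Proof. by rewrite /re /dir2 /= !cE /= !mul0r !subr0. Qed.

Lemma expr_im2 f r : im (expr f).2 r = d2 (im f.1) (im f.2) r.
Proof. by rewrite /im /dir2 /= !cE /= !mul0r !addr0. Qed.

Lemma dirac_min_L2 f g : h (f, g) -> L2 f /\ L2 g.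
Proof.
move=> [/= /test_funP[t1 t2] /test_funP[t3 t4] ->].
have [r1 r2] := dir_rL2 t1 t3; have [i1 i2] := dir_rL2 t2 t4.
split; apply/L2P.
  by split; split; exact: rtest_rL2.
split; split.
- by apply: eq_rL2 r1 => r _; rewrite expr_re1.
- by apply: eq_rL2 i1 => r _; rewrite expr_im1.
- by apply: eq_rL2 r2 => r _; rewrite expr_re2.
- by apply: eq_rL2 i2 => r _; rewrite expr_im2.
Qed.

Lemma eq_ip a b a' b' : (forall r, a r = a' r) -> (forall r, b r = b' r) -> ip a b = ip a' b'.
Proof. by move=> aa bb; apply: eq_rint => r _; rewrite aa bb. Qed.

Lemma ip0 b : ip (fun=> 0) b = 0.
Proof. by rewrite /ip (@eq_rint _ _ (fun=> 0)) ?rint0// => r _; rewrite mul0r. Qed.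

Lemma ip_dir0 b : ip (d1 (fun=> 0) (fun=> 0)) b = 0 /\ ip (d2 (fun=> 0) (fun=> 0)) b = 0.
Proof.
have d0 : derive1 (fun=> 0 : R) = (fun=> 0 : R).
  by apply: derive1_ext => x; exact: isd_cst.
by split; rewrite -[RHS](ip0 b); apply: eq_ip => // r; rewrite /dir1 /dir2 d0; ring.
Qed.

(** The coefficients being real, real spinors suffice to test the adjoint, and
    the Hermitian pairing with them separates real and imaginary parts. *)
Lemma adjointP f g : adjoint h (f, g) <->
  [/\ L2 f, L2 g, wdirac (re f.1) (re f.2) (re g.1) (re g.2) &
      wdirac (im f.1) (im f.2) (im g.1) (im g.2)].
Proof.
split.
  move=> [/= f2 g2 adj].
  have [[f1' f2'] [f3' f4']] := (L2P f).1 f2; have [[g1' g2'] [g3' g4']] := (L2P g).1 g2.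
  have dual s t : rtest s -> rtest t ->
      ip (d1 s t) (re f.1) + ip (d2 s t) (re f.2) = ip s (re g.1) + ip t (re g.2) /\
      ip (d1 s t) (im f.1) + ip (d2 s t) (im f.2) = ip s (im g.1) + ip t (im g.2).
    move=> st tt; pose u : spinor R := (cplx s (fun=> 0), cplx t (fun=> 0)).
    have hu : h (u, expr u) by split => //; apply: test_fun_cplx => //; exact: rtest0.
    have [u2 v2] := dirac_min_L2 hu; have e := adj _ _ hu.
    have e1 := congr1 (@complex.Re R) e; have e2 := congr1 (@complex.Im R) e; move: e1 e2.
    rewrite !inner_re// !inner_im// !(eq_ip (expr_re1 u) (fun=> erefl)) !(eq_ip (expr_im1 u) (fun=> erefl)).
    rewrite !(eq_ip (expr_re2 u) (fun=> erefl)) !(eq_ip (expr_im2 u) (fun=> erefl)).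
    have [z1 z2] := ip_dir0 (re f.1); have [z3 z4] := ip_dir0 (im f.1).
    have [z5 z6] := ip_dir0 (re f.2); have [z7 z8] := ip_dir0 (im f.2).
    have -> : re u.1 = s by []. have -> : re u.2 = t by [].
    have -> : im u.1 = fun=> 0 by []. have -> : im u.2 = fun=> 0 by [].
    rewrite !ip0 z1 z3 z6 z8; split; lra.
  by split => //; apply/weak_dirac_dual => // s t st tt; case: (dual s t st tt).
move=> [f2 g2 wr wi]; split => // u v huv.
have [u2 v2] := dirac_min_L2 huv.
have [[f1' f2'] [f3' f4']] := (L2P f).1 f2; have [[g1' g2'] [g3' g4']] := (L2P g).1 g2.
have [/= /test_funP[t1 t2] /test_funP[t3 t4] ev] := huv.
have Dr := (weak_dirac_dual f1' f3' g1' g3').1 wr.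
have Di := (weak_dirac_dual f2' f4' g2' g4').1 wi.
rewrite ev in v2 *.
apply: complex_eqP.
  rewrite !inner_re//.
  rewrite (eq_ip (expr_re1 u) (fun=> erefl)) (eq_ip (expr_im1 u) (fun=> erefl)).
  rewrite (eq_ip (expr_re2 u) (fun=> erefl)) (eq_ip (expr_im2 u) (fun=> erefl)).
  have := Dr _ _ t1 t3; have := Di _ _ t2 t4; lra.
rewrite !inner_im//.
rewrite (eq_ip (expr_re1 u) (fun=> erefl)) (eq_ip (expr_im1 u) (fun=> erefl)).
rewrite (eq_ip (expr_re2 u) (fun=> erefl)) (eq_ip (expr_im2 u) (fun=> erefl)).
have := Dr _ _ t2 t4; have := Di _ _ t1 t3; lra.
Qed.

Lemma dirac_min_closure (gam : R) : gam ^+ 2 = kap ^+ 2 - p * q -> 2^-1 <= gam ->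
  adjoint h `<=` op_closure h.
Proof.
move=> gam2 g0 [f g] /adjointP[f2 g2 wr wi].
have [[f1' f2'] [f3' f4']] := (L2P f).1 f2; have [[g1' g2'] [g3' g4']] := (L2P g).1 g2.
have Cr := weak_dirac_clos wr gam2 g0; have Ci := weak_dirac_clos wi gam2 g0.
have e0 (n : nat) : 0 < n.+1%:R^-1 :> R by rewrite invr_gt0 ltr0n.
have /choice[F HF] : forall n : nat, exists F : spinor R, h (F, expr F) /\
   [/\ sqnrm (fun r => re F.1 r - re f.1 r) <= n.+1%:R^-1 /\ sqnrm (fun r => im F.1 r - im f.1 r) <= n.+1%:R^-1,
       sqnrm (fun r => re F.2 r - re f.2 r) <= n.+1%:R^-1 /\ sqnrm (fun r => im F.2 r - im f.2 r) <= n.+1%:R^-1,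
       sqnrm (fun r => re (expr F).1 r - re g.1 r) <= n.+1%:R^-1 /\
         sqnrm (fun r => im (expr F).1 r - im g.1 r) <= n.+1%:R^-1 &
       sqnrm (fun r => re (expr F).2 r - re g.2 r) <= n.+1%:R^-1 /\
         sqnrm (fun r => im (expr F).2 r - im g.2 r) <= n.+1%:R^-1].
  move=> n; have [s1 [s2 [[t1 t2] [n1 n2] _ [n3 n4]]]] := Cr _ (e0 n).
  have [s3 [s4 [[t3 t4] [n5 n6] _ [n7 n8]]]] := Ci _ (e0 n).
  exists (cplx s1 s3, cplx s2 s4); split.
    by split => //; exact: test_fun_cplx.
  split; split; try exact: ltW.
  - by apply: ltW; rewrite -(@eq_nrm _ (fun r => d1 s1 s2 r - re g.1 r)) // => r _; rewrite expr_re1.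
  - by apply: ltW; rewrite -(@eq_nrm _ (fun r => d1 s3 s4 r - im g.1 r)) // => r _; rewrite expr_im1.
  - by apply: ltW; rewrite -(@eq_nrm _ (fun r => d2 s1 s2 r - re g.2 r)) // => r _; rewrite expr_re2.
  - by apply: ltW; rewrite -(@eq_nrm _ (fun r => d2 s3 s4 r - im g.2 r)) // => r _; rewrite expr_im2.
have F2 n := dirac_min_L2 (HF n).1.
split => //=; exists (fun n => (F n, expr (F n))); split => /=.
- by move=> n; case: (HF n).
- apply/L2_cvgP => // [n|]; first by case: (F2 n).
  by split; apply: cv_inv => n; have [_ [[? ?] [? ?] [? ?] [? ?]]] := HF n.
- apply/L2_cvgP => // [n|]; first by case: (F2 n).
  by split; apply: cv_inv => n; have [_ [[? ?] [? ?] [? ?] [? ?]]] := HF n.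
Qed.

Lemma closure_lim (T : operator R) f g : (forall f g, T (f, g) -> L2 f /\ L2 g) ->
  op_closure T (f, g) -> exists F G : nat -> spinor R,
  [/\ forall n, T (F n, G n), forall n, L2 (F n), forall n, L2 (G n), L2_cvg F f & L2_cvg G g].
Proof.
move=> TL [/= f2 g2 [FG [TFG cF cG]]].
exists (fun n => (FG n).1), (fun n => (FG n).2).
have TFG' n : T ((FG n).1, (FG n).2) by rewrite -surjective_pairing.
by split => // n; case: (TL _ _ (TFG' n)).
Qed.

Lemma inner_lim_eq (F G F' G' : nat -> spinor R) f g f' g' :
  (forall n, L2 (F n)) -> (forall n, L2 (G n)) -> (forall n, L2 (F' n)) -> (forall n, L2 (G' n)) ->
  L2 f -> L2 g -> L2 f' -> L2 g' -> L2_cvg F f -> L2_cvg G g -> L2_cvg F' f' -> L2_cvg G' g' ->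
  (forall n, inner (F n) (G n) = inner (F' n) (G' n)) -> inner f g = inner f' g'.
Proof.
move=> F2 G2 F2' G2' f2 g2 f2' g2' Ff Gg Ff' Gg' e.
have [r1 i1] := inner_lim F2 G2 f2 g2 Ff Gg.
have [r2 i2] := inner_lim F2' G2' f2' g2' Ff' Gg'.
have er : (fun n => complex.Re (inner (F n) (G n))) = (fun n => complex.Re (inner (F' n) (G' n))).
  by apply/funext => n; rewrite e.
have ei : (fun n => complex.Im (inner (F n) (G n))) = (fun n => complex.Im (inner (F' n) (G' n))).
  by apply/funext => n; rewrite e.
rewrite er in r1; rewrite ei in i1; apply: complex_eqP.
  by rewrite -(cvg_lim (@Rhausdorff R) r1) -(cvg_lim (@Rhausdorff R) r2).
by rewrite -(cvg_lim (@Rhausdorff R) i1) -(cvg_lim (@Rhausdorff R) i2).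
Qed.

Lemma dirac_min_dense : densely_defined h.
Proof.
move=> f f2; have [[f1 f2'] [f3 f4]] := (L2P f).1 f2.
have [F1 T1 c1] := dens_seq f1; have [F2 T2 c2] := dens_seq f2'.
have [F3 T3 c3] := dens_seq f3; have [F4 T4 c4] := dens_seq f4.
exists (fun n => (cplx (F1 n) (F2 n), cplx (F3 n) (F4 n))).
have hF n : h ((cplx (F1 n) (F2 n), cplx (F3 n) (F4 n)), expr (cplx (F1 n) (F2 n), cplx (F3 n) (F4 n))).
  by split => //; exact: test_fun_cplx.
split; first by move=> n; eexists; exact: hF.
by apply/L2_cvgP => // n; case: (dirac_min_L2 (hF n)).
Qed.

Lemma dirac_min_sub_closure : h `<=` op_closure h.
Proof.
move=> [f g] hfg; have [f2 g2] := dirac_min_L2 hfg.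
by split => //; exists (fun=> (f, g)); split => //; exact: L2_cvg_cst.
Qed.

(** Classical derivatives are weak derivatives. *)
Lemma dirac_min_symmetric : h `<=` adjoint h.
Proof.
move=> [f g] hfg; have [f2 g2] := dirac_min_L2 hfg; apply/adjointP.
have [[f1' f2'] [f3' f4']] := (L2P f).1 f2; have [[g1' g2'] [g3' g4']] := (L2P g).1 g2.
have [/= /test_funP[t1 t2] /test_funP[t3 t4] eg] := hfg.
have w a b : rtest a -> rtest b -> rL2 (d1 a b) -> rL2 (d2 a b) -> wdirac a b (d1 a b) (d2 a b).
  move=> ta tb D1 D2; split; [by split; exact: rtest_rL2|by []| |].
    by apply: eq_wd (wd_C1c (rtest_C1c ta)) => r _ //; rewrite /dir2; ring.
  by apply: eq_wd (wd_C1c (rtest_C1c tb)) => r _ //; rewrite /dir1; ring.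
have [D1 D2] := dir_rL2 t1 t3; have [D3 D4] := dir_rL2 t2 t4.
have e1 : re g.1 = d1 (re f.1) (re f.2) by rewrite eg; apply/funext => r; exact: expr_re1.
have e2 : im g.1 = d1 (im f.1) (im f.2) by rewrite eg; apply/funext => r; exact: expr_im1.
have e3 : re g.2 = d2 (re f.1) (re f.2) by rewrite eg; apply/funext => r; exact: expr_re2.
have e4 : im g.2 = d2 (im f.1) (im f.2) by rewrite eg; apply/funext => r; exact: expr_im2.
by split => //; rewrite ?e1 ?e2 ?e3 ?e4; exact: w.
Qed.

(** Symmetry passes to limits in the first entry of the graph. *)
Lemma closure_sub_adjoint : op_closure h `<=` adjoint h.
Proof.
move=> [f g] cl; have [/= f2 g2 _] := cl; have [F [G [hFG F2 G2 Ff Gg]]] := closure_lim dirac_min_L2 cl.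
split => // u v huv; have [u2 v2] := dirac_min_L2 huv.
apply: (@inner_lim_eq (fun=> v) F (fun=> u) G) => //; try exact: L2_cvg_cst.
by move=> n; have [_ _] := dirac_min_symmetric (hFG n); apply.
Qed.

(** The adjoint of the closure is contained in the adjoint, hence in the closure;
    and the closure is symmetric, as symmetry passes to limits in both
    entries. *)
Lemma closure_self_adjoint : adjoint h `<=` op_closure h -> essentially_self_adjoint h.
Proof.
move=> ac; split; first by split; [exact: dirac_min_dense|exact: dirac_min_symmetric].
split.
  move=> f f2; have [F [dF cF]] := dirac_min_dense f2.
  by exists F; split => // n; have [g hg] := dF n; exists g; exact: dirac_min_sub_closure.
apply/seteqP; split => -[f g].
  move=> cl; have [/= f2 g2 _] := cl; split => // u v clu.
  have [/= u2 v2 _] := clu; have [F [G [hFG F2 G2 Ff Gg]]] := closure_lim dirac_min_L2 clu.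
  apply: (@inner_lim_eq G (fun=> f) F (fun=> g)) => //; try exact: L2_cvg_cst.
  by move=> n; have [_ _] := closure_sub_adjoint cl; apply.
move=> [/= f2 g2 adj]; apply: ac; split => // u v huv; apply: adj.
exact: dirac_min_sub_closure.
Qed.

End DiracBridge.

(** * The free domain *)

Section FreeDomain.
Context {R : realType}.
Local Open Scope complex_scope.
Implicit Types (u w phi : R -> R[i]) (f : spinor R) (a b s t : R -> R) (c : int).

Lemma test_scalar_L2 phi : test_fun phi -> scalar_L2 phi.
Proof. by move=> /test_funP[t1 t2]; apply/scalar_L2P; split; exact: rtest_rL2. Qed.

Lemma of_fun_re u phi : scalar_L2 u -> scalar_L2 phi -> complex.Re (of_fun u phi) =
  ip (re u) (re phi) - ip (im u) (im phi).
Proof.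
move=> /scalar_L2P[u1 u2] /scalar_L2P[p1 p2].
rewrite /ip -(rintB (rL2_mul u1 p1) (rL2_mul u2 p2)).
by apply: eq_rint => r _; rewrite !cE.
Qed.

Lemma of_fun_im u phi : scalar_L2 u -> scalar_L2 phi -> complex.Im (of_fun u phi) =
  ip (re u) (im phi) + ip (im u) (re phi).
Proof.
move=> /scalar_L2P[u1 u2] /scalar_L2P[p1 p2].
rewrite /ip -(rintD (rL2_mul u1 p2) (rL2_mul u2 p1)).
by apply: eq_rint => r _; rewrite !cE.
Qed.

(** The distribution [a' + c a / r] of a real function [a], evaluated at a real
    test function. *)
Definition radial_form (c : R) a s : R := - ip a (derive1 s) + ip a (fun r => c / r * s r).

Lemma wd_rad (c : R) a (g : R -> R) : rL2 a -> rL2 g ->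
  weak_deriv a (fun r => g r - c / r * a r) <-> (forall s, rtest s -> radial_form c a s = ip g s).
Proof.
move=> a2 g2.
have key s : rtest s -> rint (fun r => (g r - c / r * a r) * s r) =
    ip g s - ip a (fun r => c / r * s r).
  move=> st; have s2 := rtest_rL2 st.
  rewrite /ip -(rintB (rL2_mul g2 s2) (rL2_mul a2 (rL2_div_test c st))).
  by apply: eq_rint => r _; ring.
split=> w s st; have := w s st; rewrite key// /radial_form /ip; lra.
Qed.

Lemma re_cmul (d : R) u : re (fun r => d%:C * u r) = (fun r => d * re u r).
Proof. by apply/funext => r; rewrite /re cE /= mul0r subr0. Qed.

Lemma im_cmul (d : R) u : im (fun r => d%:C * u r) = (fun r => d * im u r).
Proof. by apply/funext => r; rewrite /im cE /= mul0r addr0. Qed.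

Lemma re_cmulf (d : R -> R) u : re (fun r => (d r)%:C * u r) = (fun r => d r * re u r).
Proof. by apply/funext => r; rewrite /re cE /= mul0r subr0. Qed.

Lemma im_cmulf (d : R -> R) u : im (fun r => (d r)%:C * u r) = (fun r => d r * im u r).
Proof. by apply/funext => r; rewrite /im cE /= mul0r addr0. Qed.

Lemma radial_parts c u phi : scalar_L2 u -> test_fun phi ->
  complex.Re (radial_derive c u phi) = radial_form c%:~R (re u) (re phi) - radial_form c%:~R (im u) (im phi) /\
  complex.Im (radial_derive c u phi) = radial_form c%:~R (re u) (im phi) + radial_form c%:~R (im u) (re phi).
Proof.
move=> u2 pt; have [t1 t2] := (test_funP phi).1 pt.
have p'2 : scalar_L2 (cderive phi).
  by apply/scalar_L2P; split; apply: rtest_rL2; exact: rtest_derive.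
have cp2 : scalar_L2 (fun r => (c%:~R / r)%:C * phi r).
  by apply/scalar_L2P; rewrite re_cmulf im_cmulf; split; exact: rL2_div_test.
set A := of_fun u (cderive phi); set B := of_fun u (fun r => (c%:~R / r)%:C * phi r).
have eA1 : complex.Re A = ip (re u) (derive1 (re phi)) - ip (im u) (derive1 (im phi)) := of_fun_re u2 p'2.
have eA2 : complex.Im A = ip (re u) (derive1 (im phi)) + ip (im u) (derive1 (re phi)) := of_fun_im u2 p'2.
have eB1 := of_fun_re u2 cp2; have eB2 := of_fun_im u2 cp2.
rewrite -/B re_cmulf im_cmulf in eB1; rewrite -/B re_cmulf im_cmulf in eB2.
have -> : radial_derive c u phi = - A + B by [].
rewrite ReD ImD ReN ImN eA1 eA2 eB1 eB2 /radial_form.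
have R1 (x1 x2 x3 x4 : R) : - (x1 - x2) + (x3 - x4) = - x1 + x3 - (- x2 + x4) by ring.
have R2 (x1 x2 x3 x4 : R) : - (x1 + x2) + (x3 + x4) = - x1 + x3 + (- x2 + x4) by ring.
by split; [exact: R1|exact: R2].
Qed.

(** The bilinear, unconjugated pairing of distributions is determined by the
    real test functions, like the Hermitian one. *)
Lemma distr_radialP c u (g : R -> R[i]) : scalar_L2 u -> scalar_L2 g ->
  distr_eq (radial_derive c u) (of_fun g) <->
  weak_deriv (re u) (fun r => re g r - c%:~R / r * re u r) /\
  weak_deriv (im u) (fun r => im g r - c%:~R / r * im u r).
Proof.
move=> u2 g2; have [u1 u1'] := (scalar_L2P u).1 u2; have [g1 g1'] := (scalar_L2P g).1 g2.
split.
  move=> e.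
  have ee s : rtest s -> radial_form c%:~R (re u) s = ip (re g) s /\ radial_form c%:~R (im u) s = ip (im g) s.
    move=> st; have pt : test_fun (cplx s (fun=> 0)) by apply: test_fun_cplx => //; exact: rtest0.
    have p2 := test_scalar_L2 pt; have [e1 e2] := radial_parts c u2 pt.
    have := e _ pt => E; move: e1 e2; rewrite E of_fun_re// of_fun_im//.
    have -> : re (cplx s (fun=> 0)) = s by [].
    have -> : im (cplx s (fun=> 0)) = fun=> 0 by [].
    have i0 a : ip a (fun=> 0) = 0.
      by rewrite /ip (@eq_rint _ _ (fun=> 0)) ?rint0// => r _; rewrite mulr0.
    have r0 a : radial_form c%:~R a (fun=> 0) = 0.
      rewrite /radial_form (derive1_ext (fun x => isd_cst x 0)) i0 oppr0 add0r -[RHS](i0 a).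
      by apply: eq_rint => r _; rewrite mulr0.
    by rewrite !i0 !r0 !subr0 !add0r => -> ->.
  by split; apply/wd_rad => // s /ee[].
move=> [w1 w2] phi pt; have [t1 t2] := (test_funP phi).1 pt.
have p2 := test_scalar_L2 pt; have [e1 e2] := radial_parts c u2 pt.
have h1 := (wd_rad c%:~R u1 g1).1 w1; have h2 := (wd_rad c%:~R u1' g1').1 w2.
apply: complex_eqP; first by rewrite e1 of_fun_re// h1// h2.
by rewrite e2 of_fun_im// h1// h2.
Qed.

Lemma of_fun_lin (d : R) u w phi : scalar_L2 u -> scalar_L2 w -> test_fun phi ->
  of_fun (fun r => d%:C * u r + w r) phi = of_fun u (fun r => d%:C * phi r) + of_fun w phi.
Proof.
move=> u2 w2 pt; have p2 := test_scalar_L2 pt.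
have [u1 u1'] := (scalar_L2P u).1 u2; have [w1 w1'] := (scalar_L2P w).1 w2.
have [p1 p1'] := (scalar_L2P phi).1 p2.
have dp2 : scalar_L2 (fun r => d%:C * phi r).
  by apply/scalar_L2P; rewrite re_cmul im_cmul; split; exact: rL2Z.
have reE : re (fun r => d%:C * u r + w r) = (fun r => d * re u r + re w r).
  by apply/funext => r; rewrite /re !cE /= mul0r subr0.
have imE : im (fun r => d%:C * u r + w r) = (fun r => d * im u r + im w r).
  by apply/funext => r; rewrite /im !cE /= mul0r addr0.
have v2 : scalar_L2 (fun r => d%:C * u r + w r).
  by apply/scalar_L2P; rewrite reE imE; split; apply: rL2D => //; exact: rL2Z.
have lin a b s : rL2 a -> rL2 b -> rL2 s ->
    ip (fun r => d * a r + b r) s = ip a (fun r => d * s r) + ip b s.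
  move=> a2 b2 s2; rewrite /ip -(rintD (rL2_mul a2 (rL2Z d s2)) (rL2_mul b2 s2)).
  by apply: eq_rint => r _; ring.
apply: complex_eqP; rewrite cE.
  by rewrite !of_fun_re// re_cmul im_cmul reE imE !lin//; ring.
by rewrite !of_fun_im// re_cmul im_cmul reE imE !lin//; ring.
Qed.

(** Both components of the image are combinations of L2 functions as soon as the
    two distributions of the free domain are L2 functions. *)
Lemma domain_free (m : R) c : domain (dirac_free m c) = free_domain c.
Proof.
apply/seteqP; split => f; first by move=> [g []].
move=> ff; have [[f1 f2] [G1 G12 e1] [G2 G22 e2]] := ff.
have [g1 g1'] := (scalar_L2P _).1 G12; have [g2 g2'] := (scalar_L2P _).1 G22.
have [u1 u1'] := (scalar_L2P _).1 f1; have [u2 u2'] := (scalar_L2P _).1 f2.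
have nG2 : scalar_L2 (fun r => - G2 r).
  apply/scalar_L2P; split; first by apply: eq_rL2 (rL2N g2) => r _; rewrite /re cE.
  by apply: eq_rL2 (rL2N g2') => r _; rewrite /im cE.
exists ((fun r => m%:C * f.1 r + - G2 r), (fun r => (- m)%:C * f.2 r + G1 r)).
split => //=.
- split; apply/scalar_L2P; split => /=.
  + by apply: eq_rL2 (rL2B (rL2Z m u1) g2) => r _; rewrite /re !cE /= mul0r subr0.
  + by apply: eq_rL2 (rL2B (rL2Z m u1') g2') => r _; rewrite /im !cE /= mul0r addr0.
  + by apply: eq_rL2 (rL2D (rL2Z (- m) u2) g1) => r _; rewrite /re !cE /= mul0r subr0.
  + by apply: eq_rL2 (rL2D (rL2Z (- m) u2') g1') => r _; rewrite /im !cE /= mul0r addr0.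
- move=> phi pt; rewrite of_fun_lin// /distr_add /distr_mul /distr_opp e2//; congr (_ + _).
  have p2 := test_scalar_L2 pt.
  have ipN a b : rL2 a -> rL2 b -> ip (fun r => - a r) b = - ip a b.
    move=> a2 b2; rewrite /ip -rintN; last exact: rL2_mul.
    by apply: eq_rint => r _; rewrite mulNr.
  have [p1 p1'] := (scalar_L2P phi).1 p2.
  have rN : re (fun r => - G2 r) = (fun r => - re G2 r) by apply/funext => r; rewrite /re cE.
  have iN : im (fun r => - G2 r) = (fun r => - im G2 r) by apply/funext => r; rewrite /im cE.
  apply: complex_eqP; rewrite cE.
    by rewrite !of_fun_re// rN iN !ipN//; ring.
  by rewrite !of_fun_im// rN iN !ipN//; ring.
- move=> phi pt; rewrite of_fun_lin// /distr_add /distr_mul e1// addrC.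
  by [].
Qed.

Lemma int_sign c : c != 0 -> exists2 s : R, s ^+ 2 = 1 & 1 <= s * c%:~R.
Proof.
move=> c0; have [cn|cp] := ltP c 0.
  exists (-1); first by rewrite sqrrN expr1n.
  by rewrite mulN1r -mulrNz -[1]/(1%:~R) ler_int -gtz0_ge1 oppr_gt0.
exists 1; first by rewrite expr1n.
by rewrite mul1r -[1]/(1%:~R) ler_int -gtz0_ge1 lt_neqAle eq_sym c0.
Qed.

(** The exponent [- c] is an integer different from 0, hence beyond the
    threshold 1/2. *)
Lemma radial_hardy c a (g : R -> R) : c != 0 -> rL2 a -> rL2 g ->
  weak_deriv a (fun r => g r - c%:~R / r * a r) -> rL2 (fun r => a r / r).
Proof.
move=> c0 a2 g2 w; have [s s2 sc] := int_sign c0.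
apply: (@hardy _ a g (- c%:~R) (- s)) => //.
- by rewrite sqrrN.
- by rewrite mulrNN; lra.
- by apply: eq_wd w => // r _; ring.
Qed.

End FreeDomain.

(** * Comparison of the domains *)

Section Domains.
Context {R : realType} (m nu mu lambda : R) (k : int).
Local Open Scope complex_scope.
Notation h := (dirac_min m nu mu lambda k).
Notation kap := (k%:~R + lambda).
Notation wdirac := (weak_dirac m (nu + mu) (nu - mu) kap).
Implicit Types (f : spinor R) (a b : R -> R).

(** Beyond the threshold each Coulomb term of the system is in L2 on its own, so
    that those of [nu], [mu], [lambda] can be moved to the right-hand side. *)
Lemma weak_dirac_free a1 a2 b1 b2 (gam : R) : wdirac a1 a2 b1 b2 ->
  gam ^+ 2 = kap ^+ 2 - (nu + mu) * (nu - mu) -> 2^-1 < gam ->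
  exists g1 g2 : R -> R, [/\ rL2 g1, rL2 g2, weak_deriv a1 (fun r => g1 r - k%:~R / r * a1 r) &
    weak_deriv a2 (fun r => g2 r - (- k)%:~R / r * a2 r)].
Proof.
move=> S g2 g0; have [h1 h2] := weak_dirac_hardy S g2 g0.
have [[a12 a22] [b12 b22] w1 w2] := S.
exists (fun r => b2 r + m * a2 r + (- lambda * (a1 r / r) - (nu - mu) * (a2 r / r))).
exists (fun r => m * a1 r - b1 r + ((nu + mu) * (a1 r / r) + lambda * (a2 r / r))).
split.
- by apply: rL2D; [apply: rL2D => //; exact: rL2Z|apply: rL2B; exact: rL2Z].
- by apply: rL2D; [apply: rL2B => //; exact: rL2Z|apply: rL2D; exact: rL2Z].
- by apply: eq_wd w1 => // r _; ring.
- by apply: eq_wd w2 => // r _; rewrite mulrNz; ring.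
Qed.

(** Each component of an element of the free domain satisfies Hardy's inequality,
    whatever [nu], [mu], [lambda] are; the Coulomb terms are then in L2 and can
    be added to the right-hand side. *)
Lemma free_weak_dirac a1 a2 (g1 g2 : R -> R) : k != 0 -> rL2 a1 -> rL2 a2 -> rL2 g1 -> rL2 g2 ->
  weak_deriv a1 (fun r => g1 r - k%:~R / r * a1 r) -> weak_deriv a2 (fun r => g2 r - (- k)%:~R / r * a2 r) ->
  exists b1 b2, wdirac a1 a2 b1 b2.
Proof.
move=> k0 a12 a22 g12 g22 w1 w2.
have nk0 : - k != 0 by rewrite oppr_eq0.
have h1 := radial_hardy k0 a12 g12 w1; have h2 := radial_hardy nk0 a22 g22 w2.
exists (fun r => m * a1 r - g2 r + ((nu + mu) * (a1 r / r) + lambda * (a2 r / r))).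
exists (fun r => g1 r - m * a2 r + (lambda * (a1 r / r) + (nu - mu) * (a2 r / r))).
split.
- by [].
- split.
    by apply: rL2D; [apply: rL2B => //; exact: rL2Z|apply: rL2D; exact: rL2Z].
  by apply: rL2D; [apply: rL2B => //; exact: rL2Z|apply: rL2D; exact: rL2Z].
- by apply: eq_wd w1 => // r _; ring.
- by apply: eq_wd w2 => // r _; rewrite mulrNz; ring.
Qed.

Lemma free_sub_adjoint : k != 0 -> domain (dirac_free m k) `<=` domain (adjoint h).
Proof.
move=> k0; rewrite domain_free => f [[f1 f2] [G1 G12 e1] [G2 G22 e2]].
have [w1 w1'] := (distr_radialP k f1 G12).1 e1.
have [w2 w2'] := (distr_radialP (- k) f2 G22).1 e2.
have [g1 g1'] := (scalar_L2P _).1 G12; have [g2 g2'] := (scalar_L2P _).1 G22.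
have [u1 u1'] := (scalar_L2P _).1 f1; have [u2 u2'] := (scalar_L2P _).1 f2.
have [b1 [b2 Sr]] := free_weak_dirac k0 u1 u2 g1 g2 w1 w2.
have [c1 [c2 Si]] := free_weak_dirac k0 u1' u2' g1' g2' w1' w2'.
exists (cplx b1 c1, cplx b2 c2); apply/adjointP; split => //.
by have [_ [b12 b22] _ _] := Sr; have [_ [c12 c22] _ _] := Si; apply/L2P.
Qed.

Lemma adjoint_sub_free (gam : R) : gam ^+ 2 = kap ^+ 2 - (nu + mu) * (nu - mu) -> 2^-1 < gam ->
  domain (adjoint h) `<=` domain (dirac_free m k).
Proof.
move=> g2 g0 f [g /adjointP[[f1 f2] _ Sr Si]]; rewrite domain_free.
have [a1 [a2 [A1 A2 w1 w2]]] := weak_dirac_free Sr g2 g0.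
have [b1 [b2 [B1 B2 v1 v2]]] := weak_dirac_free Si g2 g0.
have c1 : scalar_L2 (cplx a1 b1) by apply/scalar_L2P.
have c2 : scalar_L2 (cplx a2 b2) by apply/scalar_L2P.
split => //.
- by exists (cplx a1 b1) => //; apply/distr_radialP.
- by exists (cplx a2 b2) => //; apply/distr_radialP.
Qed.

End Domains.

(** * Essential self-adjointness *)

Theorem theorem1p1 (R : realType) (m nu mu lambda : R) (k : int) (hk : k != 0) :
  let h := dirac_min m nu mu lambda k in
  let h0 := dirac_free m k in
  let delta : R := (k%:~R + lambda) ^+ 2 + mu ^+ 2 - nu ^+ 2 in
  let gamma := Num.sqrt delta in
  4^-1 <= delta ->
  (2^-1 < gamma ->
     essentially_self_adjoint h /\ domain (op_closure h) = domain h0) /\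
  (gamma = 2^-1 ->
     essentially_self_adjoint h /\ domain h0 `<=` domain (op_closure h)).
Proof.
move=> h h0 delta gamma hdelta.
have d0 : 0 <= delta by apply: le_trans hdelta; rewrite invr_ge0.
have g2 : gamma ^+ 2 = (k%:~R + lambda) ^+ 2 - (nu + mu) * (nu - mu).
  by rewrite sqr_sqrtr// /delta; ring.
have clE : 2^-1 <= gamma -> op_closure h = adjoint h.
  move=> g0; apply/seteqP; split; first exact: closure_sub_adjoint.
  exact: dirac_min_closure g2 g0.
have esa : 2^-1 <= gamma -> essentially_self_adjoint h.
  by move=> g0; apply: closure_self_adjoint; rewrite clE.
split=> hgam.
  have g0 := ltW hgam; split; first exact: esa.
  rewrite clE//; apply/seteqP; split; first exact: adjoint_sub_free g2 hgam.
  exact: free_sub_adjoint.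
have g0 : 2^-1 <= gamma by rewrite hgam.
split; first exact: esa.
by rewrite clE//; exact: free_sub_adjoint.
Qed.
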